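(* Let $d\ge2$, let $\mathbb P$ be an i.i.d. law of conductances $\omega_b\in[0,1]$ on the nearest-neighbor edges of $\mathbb Z^d$ with $p:=\mathbb P(\omega_b>0)>p_{\rm c}(d)$, and fix $\alpha>0$ such that $\mathbb P(\omega_b\ge\alpha)>p_{\rm c}(d)$ and $\mathbb P(0<\omega_b<\alpha)<c(p,d)$. Suppose $\psi_\omega\colon\mathscr C_{\infty,\alpha}\to\mathbb R^d$ is a function and $\theta>0$ is a number such that the following holds for a.e. $\omega$: (1) (Harmonicity) If $\varphi_\omega(x):=x+\psi_\omega(x)$, then $\mathcal L_\omega^{(\alpha)}\varphi_\omega=0$ on $\mathscr C_{\infty,\alpha}$. (2) (Sublinearity on average) For every $\epsilon>0$, $$\lim_{n\to\infty}\frac1{n^d}\sum_{x\in\mathscr C_{\infty,\alpha},\,|x|\le n}\mathbf 1_{\{|\psi_\omega(x)|\ge\epsilon n\}}=0.$$ (3) (Polynomial growth) $$\lim_{n\to\infty}\ \max_{x\in\mathscr C_{\infty,\alpha},\,|x|\le n}\frac{|\psi_\omega(x)|}{n^\theta}=0.$$ Let $Y=(Y_t)_{t\ge0}$ be the continuous-time random walk on $\mathscr C_{\infty,\alpha}$ with generator $\mathcal L_\omega^{(\alpha)}$ and suppose also: (4) (Diffusive upper bounds) For a deterministic sequence $(b_n)_{n\ge1}$ of positive numbers with $b_n=o(n^2)$ and a.e. $\omega$, $$\sup_{n\ge1}\ \max_{x\in\mathscr C_{\infty,\alpha},\,|x|\le n}\ \sup_{t\ge b_n}\frac{E_{\omega,x}|Y_t-x|}{\sqrt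 t}<\infty$$ and $$\sup_{n\ge1}\ \max_{x\in\mathscr C_{\infty,\alpha},\,|x|\le n}\ \sup_{t\ge b_n}\,t^{d/2}P_{\omega,x}(Y_t=x)<\infty.$$ Then for almost every $\omega$, $$\lim_{n\to\infty}\ \max_{x\in\mathscr C_{\infty,\alpha},\,|x|\le n}\frac{|\psi_\omega(x)|}{n}=0.$$
   Context: $\mathbb B_d$ is the set of nearest-neighbor edges of $\mathbb Z^d$; $\mathbb P$ is a product law on $\Omega=[0,1]^{\mathbb B_d}$ making $(\omega_b)_{b\in\mathbb B_d}$ i.i.d.; ''a.e. $\omega$'' is with respect to $\mathbb P$. $p_{\rm c}(d)$ is the bond-percolation threshold on $\mathbb Z^d$. $\mathscr C_\infty$ is the a.s. unique infinite connected component of the graph of edges with $\omega_b>0$. $\mathscr C_{\infty,\alpha}$ is the set of sites of $\mathbb Z^d$ connected to infinity by a path whose edges all satisfy $\omega_b\ge\alpha$. $|\cdot|$ is the Euclidean norm; a maximum over the empty set is $0$. The constant $c(p,d)>0$ is one with the following property (such a constant exists): whenever $\alpha>0$ satisfies $\mathbb P(\omega_b\ge\alpha)>p_{\rm c}(d)$ and $\mathbb P(0<\omega_b<\alpha)<c(p,d)$, then a.s. $\mathscr C_{\infty,\alpha}$ is nonempty and $\mathscr C_\infty\setminus\mathscr C_{\infty,\alpha}$ has only finite connected components (with respect to edges of positive conductance), and, writing $\mathscr F(x)$ for the (possibly empty) component of $\mathscr C_\infty\setminus\mathscr C_{\infty,\alpha}$ containing $x$, one has $\mathbb P(x\in\mathscr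 C_\infty,\ \operatorname{diam}\mathscr F(x)\ge n)\le Ce^{-\eta n}$ for all $n\ge1$, for some $C<\infty$, $\eta>0$ ($\operatorname{diam}$ in the $\ell_\infty$ distance). $X=(X_n)$ under $P_{\omega,z}$ is the Markov chain on $\mathscr C_\infty$ started at $z$ that jumps from $x$ to a nearest neighbor $y\in\mathscr C_\infty$ with probability $\omega_{xy}/(2d)$ and stays at $x$ with probability $1-\frac1{2d}\sum_{y\colon|y-x|=1}\omega_{xy}$. For $x\in\mathscr C_{\infty,\alpha}$ let $T_1:=\inf\{n\ge1\colon X_n\in\mathscr C_{\infty,\alpha}\}$ and $\hat\omega_{xy}:=P_{\omega,x}(X_{T_1}=y)$ for $x,y\in\mathscr C_{\infty,\alpha}$. The generator is $$(\mathcal L_\omega^{(\alpha)}f)(x):=\sum_{y\in\mathscr C_{\infty,\alpha}}\hat\omega_{xy}\,[f(y)-f(x)],\qquad x\in\mathscr C_{\infty,\alpha}.$$ Thus $Y$ is the continuous-time Markov chain that waits i.i.d. rate-one exponential times and then jumps according to $\hat\omega$. $P_{\omega,x}$, $E_{\omega,x}$ also denote the law and expectation of $Y$ started from $Y_0=x$. *)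

(* Defs.v *)
From HB Require Import structures.
From mathcomp Require Import all_boot all_order all_algebra.
From mathcomp Require Import all_classical all_reals all_analysis.

Set Implicit Arguments.
Unset Strict Implicit.
Unset Printing Implicit Defensive.
Import Order.TTheory GRing.Theory Num.Theory.
Import numFieldNormedType.Exports.
Local Open Scope classical_set_scope.
Local Open Scope ring_scope.

Definition site (d : nat) := 'rV[int]_d.

(* The pair (x, i) stands for the unoriented edge {x, x + e_i}; every
   nearest-neighbor edge of Z^d is obtained exactly once in this way. *)
Definition edge (d : nat) := (site d * 'I_d)%type.

Definition unit_vec (d : nat) (i : 'I_d) : site d := delta_mx 0 i.

Definition adjacent (d : nat) (x y : site d) : bool :=
  [exists i, (y == x + unit_vec i) || (x == y + unit_vec i)].

Definition embed (R : realType) (d : nat) (x : site d) : 'rV[R]_d :=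
  map_mx intr x.

(* The library norm on matrices is the sup norm, hence this definition. *)
Definition enorm (R : realType) (d : nat) (v : 'rV[R]_d) : R :=
  Num.sqrt (\sum_(i < d) v 0 i ^+ 2).

Definition linf_dist (d : nat) (x y : site d) : nat :=
  (\max_(i < d) `|x 0%R i - y 0%R i|)%N.

Definition diam (R : realType) (d : nat) (A : set (site d)) : \bar R :=
  ereal_sup [set r | exists y z, [/\ A y, A z & r = (linf_dist y z)%:R%:E]].

Definition conductance (R : realType) := {i01 R}.
HB.instance Definition _ (R : realType) := Choice.on (conductance R).
HB.instance Definition _ (R : realType) :=
  isPointed.Build (conductance R) (0%:i01 : {i01 R}).

Definition cylinders (R : realType) (d : nat) :
    set (set (edge d -> conductance R)) :=
  [set C | exists b (A : set (measurableTypeR R)),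
     measurable A /\ C = [set w | A ((w b : {i01 R})%:num)]].

(* [0,1]^{B_d} with the product sigma-algebra *)
Definition env (R : realType) (d : nat) := g_sigma_algebraType (@cylinders R d).

Definition omega (R : realType) (d : nat) (w : env R d) (b : edge d) : R :=
  ((w : edge d -> conductance R) b : {i01 R})%:num.

(* omega_{xy}: at most one summand is nonzero, and all vanish unless x and y
   are nearest neighbors. *)
Definition cond (R : realType) (d : nat) (w : env R d) (x y : site d) : R :=
  \sum_(i < d) ((y == x + unit_vec i)%:R * omega w (x, i)
              + (x == y + unit_vec i)%:R * omega w (y, i)).

Definition iid_conductances (R : realType) (d : nat)
    (P : probability (env R d) R) : Prop :=
  (forall (s : seq (edge d)) (A : edge d -> set (measurableTypeR R)),
     uniq s -> (forall b, measurable (A b)) ->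
     P [set w | forall b, b \in s -> A b (omega w b)]
     = (\prod_(b <- s) P [set w | A b (omega w b)])%E)
  /\ (forall (b b' : edge d) (A : set (measurableTypeR R)), measurable A ->
     P [set w | A (omega w b)] = P [set w | A (omega w b')]).

Definition positive_edge (R : realType) (d : nat) (w : env R d) : rel (site d) :=
  fun x y => adjacent x y && (0 < cond w x y).

Definition strong_edge (R : realType) (d : nat) (alpha : R) (w : env R d) :
    rel (site d) :=
  fun x y => adjacent x y && (alpha <= cond w x y).

Definition cluster (R : realType) (d : nat) (w : env R d) (x : site d) :
    set (site d) :=
  [set y | exists2 s, path (positive_edge w) x s & last x s = y].

(* As the infinite cluster is a.s. unique, it is the set of the sites whose
   cluster is infinite. *)
Definition C_infty (R : realType) (d : nat) (w : env R d) : set (site d) :=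
  [set x | infinite_set (cluster w x)].

Definition C_alpha (R : realType) (d : nat) (alpha : R) (w : env R d) :
    set (site d) :=
  [set x | exists gamma : nat -> site d,
     [/\ gamma 0%N = x, injective gamma
       & forall k, strong_edge alpha w (gamma k) (gamma k.+1)]].

(* Conductances in {0, 1}, equal to 1 with probability q: bond percolation. *)
Definition bernoulli_percolation (R : realType) (d : nat) (q : R)
    (P : probability (env R d) R) : Prop :=
  iid_conductances P /\
  forall b, P [set w | omega w b = 1] = q%:E /\
            P [set w | omega w b = 0] = (1 - q)%:E.

Definition p_c (R : realType) (d : nat) : R :=
  sup [set q : R | 0 <= q <= 1 /\
    exists P : probability (env R d) R,
      bernoulli_percolation q P /\ P [set w | C_infty w 0] = 0%E].

Definition hole (R : realType) (d : nat) (alpha : R) (w : env R d)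
    (x : site d) : set (site d) :=
  let D := C_infty w `\` C_alpha alpha w in
  [set y | D x /\ exists s, [/\ path (positive_edge w) x s, last x s = y
                              & forall z, z \in s -> D z]].

(* c is an admissible value of the constant c(p,d): it depends on the law of
   the conductances only through p and d. *)
Definition admissible_constant (R : realType) (d : nat) (p c : R) : Prop :=
  0 < c /\
  forall (P : probability (env R d) R) (alpha : R),
    iid_conductances P ->
    (forall b, P [set w | 0 < omega w b] = p%:E) ->
    0 < alpha ->
    (forall b, (p_c R d)%:E < P [set w | (alpha <= omega w b)%R])%E ->
    (forall b, P [set w | (0 < omega w b < alpha)%R] < c%:E)%E ->
    {ae P, forall w, C_alpha alpha w !=set0 /\
                     forall x, finite_set (hole alpha w x)} /\
    exists C eta : R, 0 < eta /\
      forall (x : site d) (n : nat), (1 <= n)%N ->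
        (P [set w | C_infty w x /\ (n%:R%:E <= diam R (hole alpha w x))%E]
         <= (C * expR (- (eta * n%:R)))%:E)%E.

(* Probability of the trajectory z_0, ..., z_n for the chain with transition
   kernel K started at x. *)
Definition trajectory_weight (R : realType) (S : eqType) (K : S -> S -> R)
    (x : S) (z : nat -> S) (n : nat) : R :=
  (z 0%N == x)%:R * \prod_(k < n) K (z k) (z k.+1).

Definition markov_chain (R : realType) (S : eqType) (dT : measure_display)
    (T : measurableType dT) (Pr : probability T R) (X : nat -> T -> S)
    (K : S -> S -> R) (x : S) : Prop :=
  (forall n z, measurable [set t | X n t = z]) /\
  (forall n (z : nat -> S),
     Pr [set t | forall k, (k <= n)%N -> X k t = z k]
     = (trajectory_weight K x z n)%:E).

(* From a site of the infinite cluster, cond vanishes towards the sites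
   outside of it, so that the walk stays in the cluster. *)
Definition rw_kernel (R : realType) (d : nat) (w : env R d) (x y : site d) : R :=
  if x == y then
    1 - (2 * d)%:R^-1 * \sum_(i < d) (cond w x (x + unit_vec i)
                                    + cond w x (x - unit_vec i))
  else cond w x y / (2 * d)%:R.

Definition first_return (S : Type) (A : set S) (X : nat -> S) (k : nat) : Prop :=
  [/\ (1 <= k)%N, A (X k) & forall m, (1 <= m < k)%N -> ~ A (X m)].

(* P_x(X_{T_1} = y), where T_1 is the first return time to A *)
Definition return_kernel (R : realType) (S : Type) (dT : measure_display)
    (T : measurableType dT) (Pr : S -> probability T R) (X : nat -> T -> S)
    (A : set S) (x y : S) : R :=
  fine (Pr x [set t | exists k, first_return A (X^~ t) k /\ X k t = y]).

(* The sum is the difference of the sums of the positive and of the negative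
   parts of its terms; it is finite only if it converges absolutely. *)
Definition generator (R : realType) (S : choiceType) (K : S -> S -> R)
    (A : set S) (f : S -> R) (x : S) : \bar R :=
  let g := fun y => (K x y * (f y - f x))%:E in
  (\esum_(y in A) (g^\+ y)%E - \esum_(y in A) (g^\- y)%E)%E.

(* Continuous-time chain started at x that waits i.i.d. rate-one exponential
   times tau_0, tau_1, ... and jumps along an independent Markov chain Z with
   kernel K; the law of (Z, tau) is given on product events. *)
Definition ctime_chain (R : realType) (S : eqType) (dT : measure_display)
    (T : measurableType dT) (Pr : probability T R) (Y : R -> T -> S)
    (K : S -> S -> R) (x : S) : Prop :=
  (forall t y, 0 <= t -> measurable [set s | Y t s = y]) /\
  exists (Z : nat -> T -> S) (tau : nat -> T -> R),
    [/\ forall k z, measurable [set s | Z k s = z],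
        forall k, measurable_fun setT (tau k : T -> measurableTypeR R),
        forall n (z : nat -> S) (A : nat -> set (measurableTypeR R)),
          (forall k, measurable (A k)) ->
          Pr [set s | forall k, (k <= n)%N -> Z k s = z k /\ A k (tau k s)]
          = ((trajectory_weight K x z n)%:E *
             \prod_(k < n.+1) exponential_prob 1 (A k))%E
      & {ae Pr, forall s, forall k t, 0 <= t ->
          \sum_(j < k) tau j s <= t < \sum_(j < k.+1) tau j s ->
          Y t s = Z k s}].

Definition in_ball (R : realType) (d : nat) (A : set (site d)) (n : nat) :
    set (site d) :=
  [set x | A x /\ enorm (embed R x) <= n%:R].

(* Used for nonnegative f and finite A only; equal to 0 if A is empty. *)
Definition max_over (R : realType) (S : Type) (A : set S) (f : S -> R) : R :=
  sup (f @` A).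

(* Main.v *)
(* Extend the kernel of Y by the identity off the strong cluster A, and let
   phi(x) = x + psi(x), which is harmonic on A. Optional stopping on leaving the
   ball of radius 3n, at an independent Poisson time t, writes psi at a point of
   the ball of radius n as the mean of phi minus the starting point. The
   probability of leaving is controlled by a superharmonic function, the
   resolvent of the probability of being far away, which the displacement bound
   makes small; the mean of |psi| at the stopped time is controlled by the
   return bound and sublinearity on average, since heat kernels satisfy
   p_t(x,y) <= (p_t(x,x) + p_t(y,y)) / 2. Hence the maxima R_n of |psi| over
   balls satisfy R_n <= eps n + delta R_{4n} for large n, and iterating this
   against polynomial growth gives R_n = o(n). A jump of the walk crosses a
   single hole of the strong cluster, so by Borel-Cantelli the jumps from the
   ball of radius 3n are eventually shorter than n. Only a lower bound on the law
   of Y_t is needed: it comes from disjoint events prescribing the skeleton and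
   the grid cells of the waiting times. *)

Require Import Defs.
From HB Require Import structures.
From mathcomp Require Import all_boot all_order all_algebra.
From mathcomp Require Import all_classical all_reals all_analysis.
From mathcomp Require Import ring lra zify.
Import Order.TTheory GRing.Theory Num.Theory.
Import numFieldNormedType.Exports.
Local Open Scope classical_set_scope.
Local Open Scope ring_scope.

Set Implicit Arguments.
Unset Strict Implicit.
Unset Printing Implicit Defensive.

(** The diffusive bounds hold at fixed times from [b n] on, while leaving a ball concerns all times
    up to [t = (q n)^2]. The resolvent bridges this: taken after a Poisson time of parameter [b], it
    is the mean of the heat semigroup at [b] plus an exponential time of mean [t], so it involves
    only admissible times, yet it is superharmonic up to the factor [t / (1 + t)]. At an exit site
    it is at least 1/2, since the walk would have to travel a distance [n] to come back. A lower
    bound on the law of [Y] suffices because it makes the heat semigroup of the skeleton the smaller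
    quantity, and both diffusive hypotheses are upper bounds; past this transfer only discrete
    averages occur. The scale [q] is small and fixed: the displacement costs [kap q n], leaving
    costs a factor of order [kap q], and each of the [o(n^d)] bad sites carries at most
    [kap / (q n)^d]. Radii grow by the factor 4 because a jump of length at most [n] from the ball
    of radius [2 n] around a point of the ball of radius [n] ends in the ball of radius [4 n]. *)

(** * Averages over an independent Poisson time *)

Section PoissonMean.
Variable R : realType.
Implicit Types (a : nat -> R) (t : R).

Definition bounded_seq a := exists M : R, forall k, `|a k| <= M.

Definition poisson_series t a : nat -> R :=
  series (fun k => a k * exp_coeff t k).

Definition poisson_mean t a : R := expR (- t) * limn (poisson_series t a).

Lemma exp_coeff_ge0 t k : 0 <= t -> 0 <= exp_coeff t k.
Proof. by move=> t0; rewrite /exp_coeff /= divr_ge0 ?exprn_ge0. Qed.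

Lemma is_cvg_poisson_series t a : bounded_seq a -> cvgn (poisson_series t a).
Proof.
move=> [M aM]; apply: normed_cvg.
have M0 : 0 <= M by apply: le_trans (aM 0%N).
apply: (@series_le_cvg _ _ (fun k => M * exp_coeff `|t| k)).
- by move=> n; exact: normr_ge0.
- by move=> n; rewrite mulr_ge0 ?exp_coeff_ge0.
- move=> n /=; rewrite normrM ler_pM//.
  by rewrite /exp_coeff /= normrM normrX normfV (ger0_norm (ler0n _ _)).
- exact: (@is_cvg_seriesZ _ (exp_coeff `|t|) M (is_cvg_series_exp_coeff _)).
Qed.

Lemma bounded_seq_const c : bounded_seq (fun=> c).
Proof. by exists `|c|. Qed.

Lemma bounded_seqD a b : bounded_seq a -> bounded_seq b ->
  bounded_seq (fun k => a k + b k).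
Proof.
move=> [M aM] [N bN]; exists (M + N) => k.
by rewrite (le_trans (ler_normD _ _))// lerD.
Qed.

Lemma bounded_seqZ c a : bounded_seq a -> bounded_seq (fun k => c * a k).
Proof. by move=> [M aM]; exists (`|c| * M) => k; rewrite normrM ler_wpM2l. Qed.

Lemma bounded_seqS a : bounded_seq a -> bounded_seq (fun k => a k.+1).
Proof. by move=> [M aM]; exists M => k. Qed.

Lemma poisson_mean_const t c : poisson_mean t (fun=> c) = c.
Proof.
rewrite /poisson_mean /poisson_series.
have -> : limn (series (fun k => c * exp_coeff t k)) = c * expR t.
  exact: (@lim_seriesZ _ (exp_coeff t) c (is_cvg_series_exp_coeff _)).
by rewrite mulrCA [_ * expR t]mulrC expRxMexpNx_1 mulr1.
Qed.

Lemma poisson_meanD t a b : bounded_seq a -> bounded_seq b ->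
  poisson_mean t (fun k => a k + b k) = poisson_mean t a + poisson_mean t b.
Proof.
move=> ba bb; rewrite /poisson_mean -mulrDr; congr (_ * _).
rewrite -lim_seriesD; [|exact: is_cvg_poisson_series..].
by congr (limn (series _)); apply/funext => k; rewrite mulrDl.
Qed.

Lemma poisson_meanZ t c a : bounded_seq a ->
  poisson_mean t (fun k => c * a k) = c * poisson_mean t a.
Proof.
move=> ba; rewrite /poisson_mean mulrCA; congr (_ * _).
rewrite -[RHS](@lim_seriesZ _ (fun k => a k * exp_coeff t k) c); last first.
  exact: is_cvg_poisson_series.
by congr (limn (series _)); apply/funext => k; rewrite -mulrA.
Qed.

Lemma le_poisson_mean t a b : 0 <= t -> bounded_seq a -> bounded_seq b ->
  (forall k, a k <= b k) -> poisson_mean t a <= poisson_mean t b.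
Proof.
move=> t0 ba bb ab; rewrite ler_wpM2l ?expR_ge0//.
apply: lim_series_le; [exact: is_cvg_poisson_series..|move=> k].
by rewrite ler_wpM2r ?exp_coeff_ge0.
Qed.

(** Bounds on truncated exponential series, for the stopped walk and for the law of [Y], pass to the
    full Poisson mean through this lemma. *)
Lemma poisson_mean_le t a c : 0 <= t -> bounded_seq a ->
  (forall N, expR (- t) * poisson_series t a N <= c) -> poisson_mean t a <= c.
Proof.
move=> t0 ba H; rewrite /poisson_mean mulrC -ler_pdivlMr ?expR_gt0//.
apply: limr_le; first exact: is_cvg_poisson_series.
by apply: nearW => N; rewrite ler_pdivlMr ?expR_gt0// mulrC.
Qed.

(** Kolmogorov's equation: differentiating the power series shifts the coefficients, and the factor
    [expR (- t)] contributes the negative term. *)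
Lemma is_derive_poisson_mean t a : bounded_seq a ->
  is_derive t 1 (fun s => poisson_mean s a)
    (poisson_mean t (fun k => a k.+1) - poisson_mean t a).
Proof.
move=> ba; have baS := bounded_seqS ba; have baSS := bounded_seqS baS.
pose c k := a k / k`!%:R.
have ec b s : poisson_series s b = pseries (fun k => b k / k`!%:R) s.
  by rewrite /poisson_series /pseries; congr series; apply/funext => k;
     rewrite /exp_coeff/= mulrA mulrAC.
have dc (b : nat -> R) : pseries_diffs (fun k => b k / k`!%:R) = (fun k => b k.+1 / k`!%:R).
  apply/funext => k; rewrite /pseries_diffs factS natrM invfM mulrCA.
  by rewrite mulVKf.
have D : is_derive t 1 (fun s => limn (poisson_series s a))
           (limn (poisson_series t (fun k => a k.+1))).
  rewrite ec -(dc a) (_ : (fun s => _) = (fun s => limn (pseries c s))); last first.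
    by apply/funext => s; rewrite ec.
  (* Termwise differentiation asks for convergence of the series and of its first two derived series
     at a point of modulus larger than that of [t]. *)
  apply: (@pseries_snd_diffs _ _ (`|t| + 1)).
  - by rewrite -(ec a); exact: is_cvg_poisson_series.
  - rewrite dc -(ec (fun k => a k.+1)).
    exact: is_cvg_poisson_series baS.
  - rewrite dc (dc (fun k => a k.+1)) -(ec (fun k => a k.+2)).
    exact: is_cvg_poisson_series baSS.
  - by rewrite [ltRHS]ger0_norm// ltrDl.
rewrite /poisson_mean.
apply: trigger_derive.
rewrite /GRing.scale/=; ring.
Qed.

End PoissonMean.

(** * Averages over an independent geometric time *)

Section Resolvent.
Variables (R : realType) (r : R).
Hypotheses (r0 : 0 <= r) (r1 : r < 1).
Implicit Types a : nat -> R.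

(** The mean of [a] at [i] plus a geometric variable of law [(1 - r) * r ^+ j]. *)
Definition resolvent a (i : nat) : R :=
  (1 - r) * limn (series (fun j => r ^+ j * a (i + j)%N)).

Lemma is_cvg_resolvent a i : bounded_seq a ->
  cvgn (series (fun j => r ^+ j * a (i + j)%N)).
Proof.
move=> [M aM]; apply: normed_cvg.
apply: (@series_le_cvg _ _ (geometric M r)).
- by move=> n; exact: normr_ge0.
- by move=> n; rewrite geometric_ge0// (le_trans _ (aM 0%N)).
- by move=> n /=; rewrite normrM ger0_norm ?exprn_ge0// mulrC ler_wpM2r ?exprn_ge0.
- by apply: is_cvg_geometric_series; rewrite ger0_norm.
Qed.

(** The term [j = 0] is split off. For nonnegative [a] this gives
    [r * resolvent a i.+1 <= resolvent a i], the source of superharmonicity. *)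
Lemma resolventS a i : bounded_seq a ->
  resolvent a i = (1 - r) * a i + r * resolvent a i.+1.
Proof.
move=> ba; rewrite /resolvent mulrCA -mulrDr; congr (_ * _).
set f := fun j => r ^+ j * a (i + j)%N.
apply: cvg_lim => //; rewrite -cvg_shiftS.
rewrite (_ : [sequence _]_n = fun n => a i +
    r * series (fun j => r ^+ j * a (i.+1 + j)%N) n); last first.
  apply/funext => n; rewrite /series /= big_nat_recl// /f expr0 mul1r addn0.
  rewrite mulr_sumr; congr (_ + _); apply: eq_bigr => j _.
  by rewrite exprS mulrA addSnnS.
apply: cvgD; first exact: cvg_cst.
by apply: cvgMr => //; first exact: is_cvg_resolvent.
Qed.

Lemma resolvent_const c i : resolvent (fun=> c) i = c.
Proof.
rewrite /resolvent.
have -> : limn (series (fun j => r ^+ j * c)) = c * (1 - r)^-1.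
  rewrite (_ : (fun j => _) = geometric c r); last first.
    by apply/funext => j; rewrite mulrC.
  apply: cvg_lim => //; apply: cvg_geometric_series; by rewrite ger0_norm.
by rewrite mulrC -mulrA mulVf ?mulr1// subr_eq0 gt_eqF.
Qed.

Lemma le_resolvent a b i : bounded_seq a -> bounded_seq b ->
  (forall k, a k <= b k) -> resolvent a i <= resolvent b i.
Proof.
move=> ba bb ab; apply: ler_wpM2l; first by rewrite subr_ge0 ltW.
apply: lim_series_le; [exact: is_cvg_resolvent..|move=> k].
by rewrite ler_wpM2l ?exprn_ge0.
Qed.

Lemma resolventD a b i : bounded_seq a -> bounded_seq b ->
  resolvent (fun k => a k + b k) i = resolvent a i + resolvent b i.
Proof.
move=> ba bb; rewrite /resolvent -mulrDr; congr (_ * _).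
rewrite -lim_seriesD; [|exact: is_cvg_resolvent..].
by congr (limn (series _)); apply/funext => k; rewrite mulrDr.
Qed.

Lemma resolventZ c a i : bounded_seq a ->
  resolvent (fun k => c * a k) i = c * resolvent a i.
Proof.
move=> ba; rewrite /resolvent mulrCA; congr (_ * _).
rewrite -[RHS](@lim_seriesZ _ (fun k => r ^+ k * a (i + k)%N) c); last first.
  exact: is_cvg_resolvent.
by congr (limn (series _)); apply/funext => k; rewrite mulrCA.
Qed.

Lemma bounded_resolvent a : bounded_seq a -> bounded_seq (resolvent a).
Proof.
move=> ba; have [M aM] := ba; exists M => i.
have bM := @bounded_seq_const R.
rewrite ler_norml -{1}(resolvent_const (- M) i) -{2}(resolvent_const M i).
by rewrite !le_resolvent// => k; have := aM k; rewrite ler_norml => /andP[].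
Qed.

End Resolvent.

(* With [l = (1 - r) / r] the Poisson mean [U s] of the resolvent satisfies
   [U' = l (U - u)], where [u] is the Poisson mean of [a]; hence
   [expR (- l s) (U s - A - B s - B / l)] is nondecreasing, and it is at most
   [expR (- l s)] as [U <= 1]. *)
Lemma poisson_mean_resolvent_le (R : realType) (r b A B : R) (a : nat -> R) :
  0 < r -> r < 1 -> 0 <= b -> 0 <= A -> 0 <= B -> (forall k, 0 <= a k <= 1) ->
  (forall s, b <= s -> poisson_mean s a <= A + B * s) ->
  poisson_mean b (resolvent r a) <= A + B * b + B * (r / (1 - r)).
Proof.
move=> r0 r1 b0 A0 B0 a01 ua.
have ba : bounded_seq a.
  by exists 1 => k; have /andP[? ?] := a01 k; rewrite ger0_norm.
pose g := resolvent r a; have bg : bounded_seq g.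
  by apply: bounded_resolvent => //; exact: ltW.
pose l : R := (1 - r) / r.
have r1' : 0 < 1 - r by rewrite subr_gt0.
have l0 : 0 < l by rewrite divr_gt0.
have gS t : poisson_mean t g = (1 - r) * poisson_mean t a +
    r * poisson_mean t (fun k => g k.+1).
  have bg1 := bounded_seqS bg.
  rewrite -!poisson_meanZ// -poisson_meanD; [|exact: bounded_seqZ..].
  by congr poisson_mean; apply/funext => k; rewrite /g resolventS// ltW.
pose D (s : R) : R := expR (- (l * s)) * (poisson_mean s g - A - B * s - B / l).
have dD (s : R) : is_derive s 1 D
    (l * expR (- (l * s)) * (A + B * s - poisson_mean s a)).
  have := is_derive_poisson_mean s bg => dg.
  rewrite /D; apply: trigger_derive; rewrite /GRing.scale/=.
  have -> : poisson_mean s (fun k => g k.+1) =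
      (poisson_mean s g - (1 - r) * poisson_mean s a) / r.
    by rewrite (gS s) addrAC subrr add0r mulrAC divff ?gt_eqF// mul1r.
  by rewrite /l; field; rewrite gt_eqF//= gt_eqF.
have Dle s : b <= s -> D b <= D s.
  move=> bs; apply: (@ger0_derive1_ndecry _ D b _ _ _ b s (lexx b) bs).
  - by move=> x _; exact: ex_derive.
  - move=> x; rewrite in_itv/= andbT => bx; rewrite derive1E derive_val.
    rewrite mulr_ge0//; first by rewrite mulr_ge0 ?expR_ge0// ltW.
    by rewrite subr_ge0 ua// ltW.
  - apply: continuous_subspaceT => x.
    apply/differentiable_continuous/derivable1_diffP.
    exact: ex_derive.
have gle s : 0 <= s -> poisson_mean s g <= 1.
  move=> s0; rewrite -(poisson_mean_const s 1); apply: le_poisson_mean => //.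
    exact: bounded_seq_const.
  move=> k; rewrite -(resolvent_const (ltW r0) r1 1 k).
  apply: le_resolvent => //; first exact: ltW; first exact: bounded_seq_const.
  by move=> i; have /andP[] := a01 i.
have Dup s : b <= s -> D s <= expR (- (l * s)).
  move=> bs; have s0 := le_trans b0 bs.
  rewrite -[leRHS]mulr1 ler_wpM2l ?expR_ge0//.
  have := gle s s0; have : 0 <= B / l by rewrite divr_ge0// ltW.
  have : 0 <= B * s by rewrite mulr_ge0.
  lra.
have Db0 : D b <= 0.
  apply/ler_addgt0Pl => e e0; rewrite addr0.
  (* Since [expR (l * s) >= 1 + l * s >= e^-1], the upper bound [expR (- (l * s))] is at most
     [e]. *)
  pose s := Num.max b (e^-1 / l).
  apply: (le_trans (Dle s _)); first by rewrite le_max lexx.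
  apply: (le_trans (Dup s _)); first by rewrite le_max lexx.
  rewrite expRN -[leRHS]invrK lef_pV2 ?posrE ?invr_gt0 ?expR_gt0//.
  apply: le_trans (expR_ge1Dx (l * s)); rewrite ler_wpDl//.
  by rewrite mulrC -ler_pdivrMr// le_max lexx orbT.
move: Db0; rewrite /D pmulr_rle0 ?expR_gt0//.
rewrite /l invf_div -/g; lra.
Qed.

Lemma eq_big_seq_support (R : nmodType) (I : eqType) (s L : seq I) (F : I -> R) :
  uniq s -> uniq L -> {subset s <= L} ->
  (forall i, i \notin s -> F i = 0) ->
  \sum_(i <- s) F i = \sum_(i <- L) F i.
Proof.
move=> us uL sL F0; rewrite (bigID (mem s) _ F (r := L))/=.
rewrite [X in _ + X]big1 ?addr0//.
rewrite -[RHS]big_filter; apply: perm_big; apply: uniq_perm => //.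
  exact: filter_uniq.
by move=> i; rewrite mem_filter; case: (boolP (i \in s)) => //= /sL ->.
Qed.

(* Cauchy product of the exponential series, cut to a triangle. *)
Lemma exp_coeff_triangle (R : realType) (s : R) (a : nat -> R) N :
  \sum_(0 <= m < N) a m * exp_coeff (s + s) m =
  \sum_(0 <= j < N) \sum_(0 <= k < N | (j + k < N)%N)
    exp_coeff s j * exp_coeff s k * a (j + k)%N.
Proof.
transitivity (\sum_(0 <= j < N) \sum_(0 <= m < N | (j <= m)%N)
    exp_coeff s j * exp_coeff s (m - j)%N * a m); last first.
  apply: eq_big_nat => j /andP[_ jN].
  transitivity (\sum_(j <= m < N) exp_coeff s j * exp_coeff s (m - j)%N * a m).
    by rewrite [RHS](big_nat_widenl _ 0%N).
  rewrite -{1}[j]add0n big_addn; under eq_bigr do rewrite addnK.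
  under eq_bigr do rewrite addnC.
  rewrite (big_nat_widen _ _ N) ?leq_subr//=.
  by apply: eq_bigl => m; rewrite ltn_subRL.
rewrite (exchange_big_dep_nat xpredT)//=.
apply: eq_big_nat => m /andP[_ mN].
rewrite -[RHS]mulr_suml mulrC; congr (_ * _).
rewrite /exp_coeff /= exprDn mulr_suml.
rewrite -(big_mkord xpredT (fun i => s ^+ (m - i)%N * s ^+ i *+ 'C(m, i) / m`!%:R)).
rewrite (big_nat_widen _ _ N)//=; apply: eq_big => [j|j]; first by rewrite ltnS.
move=> jm.
rewrite ltnS in jm.
rewrite -mulr_natr -(bin_fact jm) !natrM.
have f0 n : (n`!%:R : R) != 0 by rewrite pnatr_eq0 -lt0n fact_gt0.
have b0 : ('C(m, j)%:R : R) != 0 by rewrite pnatr_eq0 -lt0n bin_gt0.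
by field; rewrite !f0 b0.
Qed.

(** * Symmetric Markov kernels of finite support: powers and heat kernel *)

Section Averaging.
Variables (R : realType) (S : eqType) (K : S -> S -> R) (supp : S -> seq S).
Hypotheses (supp_uniq : forall x, uniq (supp x))
  (K_supp : forall x y, y \notin supp x -> K x y = 0)
  (K_ge0 : forall x y, 0 <= K x y)
  (K_sum1 : forall x, \sum_(y <- supp x) K x y = 1)
  (K_sym : forall x y, K x y = K y x).
Implicit Types (f g : S -> R) (x y z : S) (k : nat).

Definition avg f x : R := \sum_(y <- supp x) K x y * f y.

Definition avgn k f : S -> R := iter k avg f.

Lemma le_avg f g x : (forall y, K x y != 0 -> f y <= g y) -> avg f x <= avg g x.
Proof.
move=> fg; apply: ler_sum => y _; have [->|Kxy] := eqVneq (K x y) 0.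
  by rewrite !mul0r.
by rewrite ler_wpM2l// fg.
Qed.

Lemma avg_const c x : avg (fun=> c) x = c.
Proof. by rewrite /avg -mulr_suml K_sum1 mul1r. Qed.

Lemma avgD f g x : avg (fun y => f y + g y) x = avg f x + avg g x.
Proof. by rewrite /avg -big_split; apply: eq_bigr => y _; rewrite mulrDr. Qed.

Lemma avgZ c f x : avg (fun y => c * f y) x = c * avg f x.
Proof. by rewrite /avg mulr_sumr; apply: eq_bigr => y _; rewrite mulrCA. Qed.

Lemma le_avgn k f g : (forall y, f y <= g y) -> forall x, avgn k f x <= avgn k g x.
Proof. by move=> fg; elim: k => //= k IH x; apply: le_avg. Qed.

Lemma avgn_const k c : avgn k (fun=> c) = fun=> c.
Proof. by elim: k => //= k ->; apply/funext => x; rewrite avg_const. Qed.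

Lemma avgnD k f g x : avgn k (fun y => f y + g y) x = avgn k f x + avgn k g x.
Proof.
elim: k x => //= k IH x.
rewrite (_ : avgn k _ = fun y => avgn k f y + avgn k g y); last exact/funext.
exact: avgD.
Qed.

Lemma avgnZ k c f x : avgn k (fun y => c * f y) x = c * avgn k f x.
Proof.
elim: k x => //= k IH x.
rewrite (_ : avgn k _ = fun y => c * avgn k f y); last exact/funext.
exact: avgZ.
Qed.

Lemma avgn_between k f m M : (forall y, m <= f y <= M) ->
  forall x, m <= avgn k f x <= M.
Proof.
move=> fmM x; have constE c : avgn k (fun=> c) x = c by rewrite avgn_const.
apply/andP; split; [rewrite -(constE m)|rewrite -(constE M)];
  by apply: le_avgn => y; have /andP[] := fmM y.
Qed.

Lemma bounded_avgn f m M : (forall y, m <= f y <= M) ->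
  forall x, bounded_seq (fun k => avgn k f x).
Proof.
move=> fmM x; exists (Num.max (- m) M) => k.
have /andP[? ?] := avgn_between k fmM x.
by rewrite ler_norml lerNl !le_max !lerN2; apply/andP; split; apply/orP; [left|right].
Qed.

Definition delta y : S -> R := fun z => (z == y)%:R.

Definition step_prob k x y : R := avgn k (delta y) x.

(** A finite list, possibly with repetitions, that carries the law after [k] steps from [x]. It
    turns averages into finite sums over any larger list, so that different [k] can share one
    list. *)
Fixpoint reach k x : seq S :=
  if k is k'.+1 then flatten [seq reach k' y | y <- supp x] else [:: x].

Lemma avgE (L : seq S) f x : uniq L -> {subset supp x <= L} ->
  avg f x = \sum_(y <- L) K x y * f y.
Proof.
by move=> uL sL; apply: eq_big_seq_support => // y ny; rewrite K_supp ?mul0r.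
Qed.

Lemma avgnE k (L : seq S) f x : uniq L -> {subset reach k x <= L} ->
  avgn k f x = \sum_(w <- L) step_prob k x w * f w.
Proof.
elim: k x => [|k IH] x uL sL.
  rewrite -(@eq_big_seq_support _ _ [:: x])//.
    by rewrite big_seq1 /step_prob /delta /= eqxx mul1r.
  by move=> i; rewrite inE /step_prob /delta /= eq_sym => /negbTE ->; rewrite mul0r.
transitivity (\sum_(y <- supp x) K x y * avgn k f y); first by [].
under eq_big_seq => y ysx.
  rewrite (IH y uL); last first.
    by move=> w wr; apply: sL; apply/flattenP; exists (reach k y) => //; exact: map_f.
  rewrite mulr_sumr; over.
rewrite exchange_big/=; apply: eq_bigr => w _.
rewrite /step_prob /= /avg mulr_suml; apply: eq_bigr => y _.
by rewrite mulrA.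
Qed.

Lemma avg_delta w y : avg (delta y) w = K w y.
Proof.
rewrite /avg; have [ysw|ysw] := boolP (y \in supp w).
  rewrite (bigD1_seq y)//= /delta eqxx mulr1 big1 ?addr0// => z zy.
  by rewrite (negbTE zy) mulr0.
rewrite K_supp// big1_seq// => z /andP[_ zs]; rewrite /delta.
by case: eqP => [zy|]; rewrite ?mulr0//; rewrite -zy zs in ysw.
Qed.

Lemma avgnSr k f : avgn k.+1 f = avgn k (avg f).
Proof. by rewrite /avgn iterSr. Qed.

(** One side is expanded along its last step and the other along its first; the list [L] covers both
    sums. *)
Lemma step_prob_sym k x y : step_prob k x y = step_prob k y x.
Proof.
elim: k x y => [|k IH] x y; first by rewrite /step_prob /= /delta eq_sym.
rewrite [LHS]/step_prob avgnSr.
pose L := undup (reach k x ++ supp y).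
rewrite (avgnE (L := L)) ?undup_uniq//; last first.
  by move=> w; rewrite mem_undup mem_cat => ->.
rewrite [RHS]/step_prob /= (avgE (L := L)) ?undup_uniq//; last first.
  by move=> w; rewrite mem_undup mem_cat => ->; rewrite orbT.
apply: eq_bigr => w _; rewrite avg_delta K_sym mulrC; congr (_ * _).
exact: IH.
Qed.

(** Chapman-Kolmogorov with the second factor reversed by symmetry, which makes it an inner product
    of a row at [x] and a row at [y]. *)
Lemma step_probD j k x y (L : seq S) : uniq L -> {subset reach j x <= L} ->
  step_prob (j + k) x y = \sum_(w <- L) step_prob j x w * step_prob k y w.
Proof.
move=> uL sL; rewrite {1}/step_prob /avgn iterD -/(avgn k _) -/(avgn j _).
by rewrite (avgnE _ uL sL); apply: eq_bigr => w _; rewrite (step_prob_sym k y).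
Qed.

Lemma delta_between y z : 0 <= delta y z <= 1.
Proof. by rewrite /delta; case: eqP; rewrite ?lexx ?ler01. Qed.

Lemma step_prob_between k x y : 0 <= step_prob k x y <= 1.
Proof. by apply: avgn_between => z; exact: delta_between. Qed.

(** The semigroup [exp (t (avg - 1))] of the walk jumping at rate one, as a Poisson mixture of
    powers. *)
Definition heat t f x : R := poisson_mean t (fun k => avgn k f x).

(** Sums over the square [j, k < N] are Gram products of the rows [A x] and [A y], so for them the
    inequality is that between arithmetic and geometric means. The truncated series are the
    triangles [j + k < N]. The rest [D] of the square is nonnegative and largest for the constant 1,
    where it equals the error term. *)
Lemma poisson_series_step_prob_le t x y N : 0 <= t ->
  poisson_series (t + t) (fun k => step_prob k x y) N <=
  (poisson_series (t + t) (fun k => step_prob k x x) N +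
   poisson_series (t + t) (fun k => step_prob k y y) N) / 2 +
  (series (exp_coeff t) N ^+ 2 - series (exp_coeff (t + t)) N).
Proof.
move=> t0; pose c := exp_coeff t.
have c0 k : 0 <= c k by exact: exp_coeff_ge0.
pose Q (a : nat -> R) :=
  \sum_(0 <= j < N) \sum_(0 <= k < N) c j * c k * a (j + k)%N.
pose D (a : nat -> R) :=
  \sum_(0 <= j < N) \sum_(0 <= k < N | ~~ (j + k < N)%N) c j * c k * a (j + k)%N.
have QE a : Q a = poisson_series (t + t) a N + D a.
  rewrite /poisson_series /series /= exp_coeff_triangle -big_split/=.
  by apply: eq_bigr => j _; rewrite (bigID (fun k => j + k < N)%N)/=.
have D0 a : (forall k, 0 <= a k) -> 0 <= D a.
  by move=> a0; apply: sumr_ge0 => j _; apply: sumr_ge0 => k _; do 2?apply: mulr_ge0.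
have D1 a : (forall k, a k <= 1) -> D a <= D (fun=> 1).
  move=> a1; apply: ler_sum => j _; apply: ler_sum => k _.
  apply: ler_wpM2l => //; exact: mulr_ge0.
have D1E : D (fun=> 1) = series c N ^+ 2 - series (exp_coeff (t + t)) N.
  have := QE (fun=> 1).
  have -> : Q (fun=> 1) = series c N ^+ 2.
    rewrite expr2 /series /= big_distrl/=; apply: eq_bigr => j _.
    by rewrite mulr_sumr; apply: eq_bigr => k _; rewrite mulr1.
  have -> : poisson_series (t + t) (fun=> 1) N = series (exp_coeff (t + t)) N.
    by rewrite /poisson_series /series /=; apply: eq_bigr => k _; rewrite mul1r.
  by move=> ->; rewrite addrAC subrr add0r.
pose L := undup (flatten [seq reach j x | j <- iota 0 N] ++
                 flatten [seq reach j y | j <- iota 0 N]).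
have uL : uniq L by exact: undup_uniq.
have Lx j : (j < N)%N -> {subset reach j x <= L}.
  move=> jN w wr; rewrite mem_undup mem_cat; apply/orP; left; apply/flattenP.
  by exists (reach j x) => //; apply: map_f; rewrite mem_iota.
have Ly j : (j < N)%N -> {subset reach j y <= L}.
  move=> jN w wr; rewrite mem_undup mem_cat; apply/orP; right; apply/flattenP.
  by exists (reach j y) => //; apply: map_f; rewrite mem_iota.
pose A u w := \sum_(0 <= j < N) c j * step_prob j u w.
have QA u v : (forall j, (j < N)%N -> {subset reach j u <= L}) ->
    Q (fun k => step_prob k u v) = \sum_(w <- L) A u w * A v w.
  move=> Lu; rewrite /Q.
  under eq_big_nat => j /andP[_ jN].
    under eq_bigr => k _ do rewrite (step_probD _ _ uL (Lu _ jN)) mulr_sumr.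
    rewrite exchange_big/=; over.
  rewrite exchange_big/=; apply: eq_bigr => w _.
  rewrite /A big_distrl/=; apply: eq_bigr => j _.
  by rewrite mulr_sumr; apply: eq_bigr => k _; rewrite mulrACA.
have Qle : Q (fun k => step_prob k x y) <=
    (Q (fun k => step_prob k x x) + Q (fun k => step_prob k y y)) / 2.
  rewrite !QA// -big_split/= mulr_suml; apply: ler_sum => w _.
  rewrite ler_pdivlMr//; have := sqr_ge0 (A x w - A y w).
  rewrite sqrrB -!expr2; lra.
have p01 u v k : 0 <= step_prob k u v <= 1 by exact: step_prob_between.
have DD u v : D (fun k => step_prob k u v) <= D (fun=> 1).
  by apply: D1 => k; have /andP[] := p01 u v k.
have Dxy : 0 <= D (fun k => step_prob k x y).
  by apply: D0 => k; have /andP[] := p01 x y k.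
move: Qle; rewrite !QE -D1E.
have := DD x x; have := DD y y; lra.
Qed.

(* Positive semidefiniteness of the heat kernel; in the proof the Cauchy
   product of two truncated exponentials is compared with a truncated
   exponential, with error [e_N(t)^2 - e_N(2t) --> 0]. *)
Lemma heat_delta_le t x y : 0 <= t ->
  heat t (delta y) x <= (heat t (delta x) x + heat t (delta y) y) / 2.
Proof.
move=> t0; rewrite (_ : t = t / 2 + t / 2); last by rewrite -splitr.
set s := t / 2; have s0 : 0 <= s by rewrite divr_ge0.
have cvgp u v := is_cvg_poisson_series (t := s + s)
  (bounded_avgn (delta_between v) u).
rewrite /heat /poisson_mean -(mulrDr (expR _)) -mulrA ler_wpM2l ?expR_ge0//.
set l := limn _; set lx := limn _; set ly := limn _.
rewrite -[leRHS]addr0 -(subrr (expR (s + s))) {1}expRD -expr2.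
have ce u := is_cvg_series_exp_coeff u.
apply: (@ler_cvg_to _ \oo _ R (poisson_series (s + s) (fun k => step_prob k x y))
  (fun N => (poisson_series (s + s) (fun k => step_prob k x x) N +
   poisson_series (s + s) (fun k => step_prob k y y) N) / 2 +
  (series (exp_coeff s) N ^+ 2 - series (exp_coeff (s + s)) N))).
- exact: (cvgp x y).
- apply: cvgD.
    apply: cvgMr_tmp.
    by apply: cvgD; [exact: (cvgp x x)|exact: (cvgp y y)].
  apply: cvgB; last exact: ce.
  by rewrite expr2; under eq_fun do rewrite expr2; apply: cvgM; exact: ce.
- by apply: nearW => N; exact: poisson_series_step_prob_le.
Qed.

(** * The walk stopped on leaving a set *)

Variable B : pred S.

Definition stop f x : R := if B x then avg f x else f x.

Definition stopn k f : S -> R := iter k stop f.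

(** The walk started in [B] and stopped outside never leaves this set, so assumptions on exit sites
    are needed only here. *)
Definition stop_dom x := B x \/ exists2 u, B u & K u x != 0.

Lemma le_stopn k f g : (forall x, stop_dom x -> f x <= g x) ->
  forall x, stop_dom x -> stopn k f x <= stopn k g x.
Proof.
move=> fg; elim: k => // k IH x xd /=; rewrite /stop; case: ifPn => [Bx|_].
  by apply: le_avg => y Kxy; apply: IH; right; exists x.
exact: IH.
Qed.

(** Optional stopping in discrete form: a function harmonic on [B] is a fixed point of the stopped
    average. *)
Lemma stopn_harmonic k f : (forall x, B x -> avg f x = f x) -> stopn k f = f.
Proof.
move=> hf; elim: k => //= k ->; apply/funext => x; rewrite /stop.
by case: ifP => // /hf.
Qed.

Lemma stopnD k f g x : stopn k (fun y => f y + g y) x = stopn k f x + stopn k g x.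
Proof.
elim: k x => //= k IH x.
rewrite (_ : stopn k _ = fun y => stopn k f y + stopn k g y); last exact/funext.
by rewrite /stop; case: ifP => // _; exact: avgD.
Qed.

Lemma stopnZ k c f x : stopn k (fun y => c * f y) x = c * stopn k f x.
Proof.
elim: k x => //= k IH x.
rewrite (_ : stopn k _ = fun y => c * stopn k f y); last exact/funext.
by rewrite /stop; case: ifP => // _; exact: avgZ.
Qed.

(** Paths that have left [B] contribute zero to the stopped average, whereas without stopping they
    may still return and contribute. *)
Lemma stopn_le_avgn k f : (forall x, 0 <= f x) -> (forall x, ~~ B x -> f x = 0) ->
  forall x, stopn k f x <= avgn k f x.
Proof.
move=> f0 fB; have a0 j x : 0 <= avgn j f x.
  by have := @le_avgn j (fun=> 0) f f0 x; rewrite avgn_const.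
have s0 j x : ~~ B x -> stopn j f x = 0.
  by move=> nBx; elim: j => [|j IH] /=; [exact: fB|rewrite /stop (negbTE nBx)].
elim: k => // k IH x; have [Bx|nBx] := boolP (B x); last by rewrite s0.
by rewrite /= /stop Bx; apply: le_avg => y _; exact: IH.
Qed.

(** A maximal inequality: along the walk stopped on leaving [B], [r ^+ j * V] is a supermartingale,
    and on an exit by time [k] it is at least [r ^+ k / 2]. *)
Lemma stopn_exit_le (r : R) V k : 0 < r <= 1 ->
  (forall x, B x -> 0 <= V x) ->
  (forall x, B x -> r * avg V x <= V x) ->
  (forall x, stop_dom x -> ~~ B x -> 1 <= 2 * V x) ->
  forall x, stop_dom x -> stopn k (fun y => (~~ B y)%:R) x <= 2 * V x * r ^- k.
Proof.
move=> /andP[r0 r1] V0 Vr V1; elim: k => [|k IH] x xd.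
  rewrite /= expr0 invr1 mulr1; have [Bx|nBx] := boolP (B x); last exact: V1.
  by rewrite mulr_ge0 ?V0.
rewrite /= /stop; case: ifPn => [Bx|nBx].
  apply: (@le_trans _ _ (avg (fun y => (2 * r ^- k) * V y) x)).
    apply: le_avg => y Kxy; rewrite mulrAC; apply: IH; by right; exists x.
  rewrite avgZ exprSr invfM -!mulrA ler_wpM2l// [leRHS]mulrCA ler_wpM2l//.
    by rewrite invr_ge0 exprn_ge0// ltW.
  by rewrite mulrC ler_pdivlMl// Vr.
have := V1 x xd nBx => V1x.
have s1 j : stopn j (fun y => (~~ B y)%:R) x = 1.
  by elim: j => [|j IHj] /=; [rewrite nBx|rewrite /stop (negbTE nBx)].
rewrite -/(stopn k _) s1; apply: (le_trans V1x); rewrite ler_peMr//.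
  exact: le_trans V1x.
by rewrite -exprVn exprn_ege1// invr_ge1// unitfE gt_eqF.
Qed.

(* The walk stopped on leaving [B], observed at an independent Poisson time:
   the two terms account for the paths staying in [B] and leaving it. *)
Lemma harmonic_le_heat (r t M C : R) (f F V : S -> R) z :
  0 < r <= 1 -> 0 <= t -> 0 <= M -> B z ->
  (forall x, B x -> avg f x = f x) ->
  (forall x, B x -> 0 <= V x) ->
  (forall x, B x -> r * avg V x <= V x) ->
  (forall x, stop_dom x -> ~~ B x -> 1 <= 2 * V x) ->
  (forall x, 0 <= F x <= C) -> (forall x, ~~ B x -> F x = 0) ->
  (forall x, B x -> f x <= F x) ->
  (forall x, stop_dom x -> ~~ B x -> f x <= M) ->
  f z <= heat t F z + M * (2 * V z) * expR (t / r - t).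
Proof.
move=> r01 t0 M0 Bz hf V0 Vr V1 FC FB fF fM; have /andP[r0 r1] := r01.
have zd : stop_dom z by left.
have key k : f z - avgn k F z <= M * (2 * V z) * r ^- k.
  rewrite lerBlDl -{1}(stopn_harmonic k hf).
  apply: (@le_trans _ _ (stopn k (fun y => F y + M * (~~ B y)%:R) z)).
    apply: le_stopn => // x xd; have [Bx|nBx] := boolP (B x).
      by rewrite mulr0 addr0 fF.
    by rewrite FB// add0r mulr1 fM.
  rewrite stopnD stopnZ -mulrA; apply: lerD.
    by apply: stopn_le_avgn => // x; have /andP[] := FC x.
  by rewrite ler_wpM2l// stopn_exit_le.
have bF := bounded_avgn FC z.
have ba : bounded_seq (fun k => f z - avgn k F z).
  have := bounded_seqD (bounded_seq_const (f z)) (bounded_seqZ (-1) bF).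
  by under eq_fun do rewrite mulN1r.
have E : poisson_mean t (fun k => f z - avgn k F z) = f z - heat t F z.
  rewrite /heat -[in RHS](poisson_mean_const t (f z)) -mulN1r -poisson_meanZ//.
  rewrite -poisson_meanD//; [|exact: bounded_seq_const|exact: bounded_seqZ].
  by congr poisson_mean; apply/funext => k; rewrite mulN1r.
rewrite -lerBlDl -E; apply: poisson_mean_le => // N.
have c0 : 0 <= M * (2 * V z) by rewrite !mulr_ge0// V0.
(* The weights [r ^- k] turn the exponential series at [t] into the one at [t / r]. *)
apply: (@le_trans _ _ (expR (- t) * (M * (2 * V z) * series (exp_coeff (t / r)) N))).
  rewrite ler_wpM2l ?expR_ge0// /poisson_series /series /= mulr_sumr.
  apply: ler_sum => k _; apply: (le_trans (ler_wpM2r (exp_coeff_ge0 _ t0) (key k))).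
  by rewrite -[leLHS]mulrA ler_wpM2l// /exp_coeff /= exprMn exprVn mulrA [r ^- k * _]mulrC.
rewrite mulrCA ler_wpM2l// addrC expRD ler_wpM2l ?expR_ge0//.
apply: nondecreasing_cvgn_le; last exact: is_cvg_series_exp_coeff.
by apply: nondecreasing_series => k _ _; rewrite exp_coeff_ge0// divr_ge0// ltW.
Qed.


Lemma poisson_mean_sum (I : Type) (s : seq I) (c : I -> R) (a : I -> nat -> R) t :
  (forall i, bounded_seq (a i)) ->
  poisson_mean t (fun k => \sum_(i <- s) c i * a i k) =
    \sum_(i <- s) c i * poisson_mean t (a i) /\
  bounded_seq (fun k => \sum_(i <- s) c i * a i k).
Proof.
move=> ba; elim: s => [|i s [IH bIH]].
  under eq_fun do rewrite big_nil.
  by rewrite big_nil poisson_mean_const; split => //; exact: bounded_seq_const.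
under eq_fun do rewrite big_cons.
rewrite poisson_meanD//; last exact: bounded_seqZ.
rewrite poisson_meanZ// IH big_cons; split => //.
by apply: bounded_seqD => //; exact: bounded_seqZ.
Qed.

Lemma resolvent_sum (r : R) (I : Type) (s : seq I) (c : I -> R)
    (a : I -> nat -> R) n :
  0 <= r -> r < 1 -> (forall i, bounded_seq (a i)) ->
  resolvent r (fun k => \sum_(i <- s) c i * a i k) n =
    \sum_(i <- s) c i * resolvent r (a i) n.
Proof.
move=> r0 r1 ba; elim: s => [|i s IH].
  by under eq_fun do rewrite big_nil; rewrite big_nil resolvent_const.
have [_ bs] := poisson_mean_sum s c 0 ba.
under eq_fun do rewrite big_cons.
rewrite resolventD//; last exact: bounded_seqZ.
by rewrite resolventZ// IH big_cons.
Qed.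

Section ExitWeight.
Variables (b r : R) (f : S -> R).
Hypotheses (b0 : 0 <= b) (r0 : 0 <= r) (r1 : r < 1) (f01 : forall x, 0 <= f x <= 1).

(** For [0 < r < 1] and bounded [g] this is the mean of [heat] at time [b] plus an independent
    exponential time of rate [(1 - r) / r]. Starting at [b] keeps it within the times where the
    diffusive bounds hold, and the discrete form yields superharmonicity by algebra. *)
Definition exit_weight g x : R :=
  poisson_mean b (resolvent r (fun k => avgn k g x)).

Let bf x : bounded_seq (fun k => avgn k f x) := bounded_avgn f01 x.

Lemma exit_weight_ge0 x : 0 <= exit_weight f x.
Proof.
rewrite -(poisson_mean_const b 0); apply: le_poisson_mean => //.
- exact: bounded_seq_const.
- exact: bounded_resolvent.
- move=> k; rewrite -(resolvent_const r0 r1 0 k); apply: le_resolvent => //.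
    exact: bounded_seq_const.
  by move=> i; have /andP[] := avgn_between i f01 x.
Qed.

(** Averaging commutes with both mixtures and shifts the step index by one; [resolventS] then
    compares the two sides, up to the nonnegative term [(1 - r) * avgn k f x]. *)
Lemma exit_weight_superharmonic x : r * avg (exit_weight f) x <= exit_weight f x.
Proof.
have bg y := bounded_resolvent r0 r1 (bf y).
rewrite /avg /exit_weight -(poisson_mean_sum _ _ b bg).1.
have [_ bs] := poisson_mean_sum (supp x) (K x) b bg.
rewrite -poisson_meanZ//; apply: le_poisson_mean => //; first exact: bounded_seqZ.
move=> k; rewrite -resolvent_sum//.
rewrite [leRHS]resolventS// (_ : resolvent r (fun i => \sum_(y <- _) _) k =
  resolvent r (fun k => avgn k f x) k.+1).
  rewrite lerDr mulr_ge0 ?subr_ge0 ?(ltW r1)//.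
  by have /andP[] := avgn_between k f01 x.
by rewrite /resolvent; under [in RHS]eq_fun do rewrite addSn.
Qed.

(** It turns the lower bound wanted at exit sites into an upper bound for the complementary
    function. *)
Lemma exit_weightC x : exit_weight f x = 1 - exit_weight (fun y => 1 - f y) x.
Proof.
have f01' y : 0 <= 1 - f y <= 1.
  by have /andP[? ?] := f01 y; rewrite subr_ge0 lerBlDr lerDl; apply/andP.
have bf' := bounded_avgn f01' x.
have bg := bounded_resolvent r0 r1 (bf x).
have bg' := bounded_resolvent r0 r1 bf'.
apply/eqP; rewrite eq_sym subr_eq -(poisson_meanD b bg bg').
apply/eqP; rewrite -[LHS](poisson_mean_const b); congr poisson_mean.
apply/funext => k; rewrite -(resolventD r0 r1 _ (bf x) bf') -[LHS](resolvent_const r0 r1 1 k).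
congr (resolvent r _ k); apply/funext => i; rewrite -avgnD.
rewrite (_ : (fun y => f y + _) = fun=> 1) ?avgn_const//.
by apply/funext => y; rewrite addrC subrK.
Qed.

End ExitWeight.

(** The parameter [t / (1 + t)] gives the exponential time the mean [t]. The square root is replaced
    by its tangent at [t], an affine majorant. The factor 3/2 collects one half from each of [A],
    [B' * b] (as [b <= t]) and [B' * t]. *)
Lemma exit_weight_le (b t kap : R) f x : 0 <= b -> b <= t -> 0 < t -> 0 <= kap ->
  (forall x, 0 <= f x <= 1) ->
  (forall s, b <= s -> heat s f x <= kap * Num.sqrt s) ->
  exit_weight b (t / (1 + t)) f x <= 3 / 2 * (kap * Num.sqrt t).
Proof.
move=> b0 bt t0 kap0 f01 hs.
have st0 : 0 < Num.sqrt t by rewrite sqrtr_gt0.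
have t10 : 0 < 1 + t by rewrite ltr_pwDl// ltW.
have r1 : t / (1 + t) < 1 by rewrite ltr_pdivrMr// mul1r ltrDr.
have tE : t = Num.sqrt t * Num.sqrt t by rewrite -expr2 sqr_sqrtr// ltW.
pose A := kap * Num.sqrt t / 2; pose B' := kap / (2 * Num.sqrt t).
have B0 : 0 <= B' by rewrite divr_ge0// mulr_ge0// ltW.
have := @poisson_mean_resolvent_le R (t / (1 + t)) b A B' (fun k => avgn k f x).
move=> /(_ _ r1 b0 _ B0 _ _)/le_trans; apply.
- by rewrite divr_gt0.
- by rewrite divr_ge0// mulr_ge0// ltW.
- by move=> k; exact: avgn_between.
- move=> s bs; apply: (le_trans (hs s bs)).
  have s0 : 0 <= s by exact: le_trans bs.
  rewrite -[s in leRHS](sqr_sqrtr s0) /A /B'.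
  rewrite (_ : _ + _ = kap * ((Num.sqrt t ^+ 2 + Num.sqrt s ^+ 2) / (2 * Num.sqrt t))).
    rewrite ler_wpM2l// ler_pdivlMr ?mulr_gt0//.
    have := sqr_ge0 (Num.sqrt s - Num.sqrt t); rewrite sqrrB; lra.
  by field; rewrite gt_eqF.
- have -> : t / (1 + t) / (1 - t / (1 + t)) = t.
    by field; rewrite gt_eqF//= addrK oner_neq0.
  have B'b : B' * b <= B' * t by rewrite ler_wpM2l.
  have B't : B' * t = kap * Num.sqrt t / 2.
    by rewrite /B' [X in _ * X]tE; field; rewrite gt_eqF.
  by rewrite B't in B'b *; rewrite /A; lra.
Qed.

End Averaging.

(** * Measurability of events built from countable connectives; finite sums of measures *)

Section MeasurableComprehension.
Context d (T : measurableType d).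
Implicit Types P Q : T -> Prop.

Lemma measurable_and P Q : measurable [set t | P t] -> measurable [set t | Q t] ->
  measurable [set t | P t /\ Q t].
Proof. exact: measurableI. Qed.

Lemma measurable_not P : measurable [set t | P t] -> measurable [set t | ~ P t].
Proof. exact: measurableC. Qed.

Lemma measurable_cst_prop (Q : Prop) : measurable [set t : T | Q].
Proof.
have [q|nq] := pselect Q.
  by rewrite (_ : [set t | _] = setT)//; apply/seteqP; split.
by rewrite (_ : [set t | _] = set0)//; apply/seteqP; split.
Qed.

Lemma measurable_exists (I : countType) (P : I -> T -> Prop) :
  (forall i, measurable [set t | P i t]) -> measurable [set t | exists i, P i t].
Proof.
move=> mP; rewrite (_ : [set t | _] = \bigcup_i [set t | P i t]).
  exact: countable_bigcupT_measurable.
by apply/seteqP; split => [t [i Pi]|t [i _ Pi]]; exists i.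
Qed.

Lemma measurable_forall (I : countType) (P : I -> T -> Prop) :
  (forall i, measurable [set t | P i t]) -> measurable [set t | forall i, P i t].
Proof.
move=> mP; rewrite (_ : [set t | _] = [set t | ~ exists i, ~ P i t]).
  by apply/measurable_not/measurable_exists => i; exact/measurable_not.
apply/seteqP; split => t /=; first by move=> H [i]; exact.
by move=> H i; apply: contrapT => nP; apply: H; exists i.
Qed.

Lemma measurable_imply (Q : Prop) P : measurable [set t | P t] ->
  measurable [set t | Q -> P t].
Proof.
move=> mP; have [q|nq] := pselect Q.
  rewrite (_ : [set t | _] = [set t | P t])//.
  by apply/seteqP; split => t /= Pt; [exact: Pt q|move=> _; exact: Pt].
by rewrite (_ : [set t | _] = setT)//; apply/seteqP; split => t //= _ q.
Qed.

Lemma measurable_preimage_discrete (S : countType) (X : T -> S) (D : set S) :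
  (forall z, measurable [set t | X t = z]) -> measurable [set t | D (X t)].
Proof.
move=> mX; rewrite (_ : [set t | _] = [set t | exists z, X t = z /\ D z]).
  apply: measurable_exists => z; apply: measurable_and => //.
  exact: measurable_cst_prop.
apply/seteqP; split => t /=; first by move=> Dt; exists (X t).
by move=> [z [<-]].
Qed.

Lemma sum_disjoint_le (R : realType) (mu : {measure set T -> \bar R})
    (I : eqType) (s : seq I) (F : I -> set T) (G : set T) :
  uniq s -> (forall i, measurable (F i)) -> measurable G ->
  (forall i j t, i \in s -> j \in s -> F i t -> F j t -> i = j) ->
  (forall i, i \in s -> F i `<=` G) ->
  (\sum_(i <- s) mu (F i) <= mu G)%E.
Proof.
move=> us mF; elim: s us G => [|i s IH] /= us G mG dF FG; first by rewrite big_nil.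
case/andP: us => nis us; rewrite big_cons.
have -> : mu G = (mu (F i) + mu (G `\` F i))%E.
  rewrite -measureU//; first last.
  - by rewrite setIDA setIC setDE -setIA setICr setI0.
  - exact: measurableD.
  by rewrite setDUK//; apply: FG; rewrite mem_head.
apply: leeD2l; apply: IH => //.
- exact: measurableD.
- by move=> j k t js ks; apply: dF; rewrite inE ?js ?ks orbT.
- move=> j js t Fj; split; first by apply: (FG j) => //; rewrite inE js orbT.
  move=> Fi; move: nis; suff -> : i = j by rewrite js.
  by apply: (dF i j t) => //; rewrite inE ?js ?eqxx ?orbT.
Qed.

Lemma measure_le_sum (R : realType) (mu : {measure set T -> \bar R})
    (I : eqType) (s : seq I) (F : I -> set T) (G : set T) :
  (forall i, measurable (F i)) -> measurable G ->
  (forall t, G t -> exists2 i, i \in s & F i t) ->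
  (mu G <= \sum_(i <- s) mu (F i))%E.
Proof.
move=> mF; elim: s G => [|i s IH] G mG GF.
  rewrite big_nil (_ : G = set0) ?measure0//.
  by apply/seteqP; split => // t /GF [].
rewrite big_cons -[G](setUIDK _ (F i)).
apply: le_trans (measureU2 _ _ _) _; [exact: measurableI|exact: measurableD|].
apply: leeD; first by apply: le_measure; rewrite ?inE//; exact: measurableI.
apply: IH; first exact: measurableD.
move=> t [Gt nF]; have [j] := GF _ Gt; rewrite inE => /predU1P[-> //|js Fj].
by exists j.
Qed.

End MeasurableComprehension.

(** * The exponential law on intervals *)

Section ExponentialIntervals.
Variable R : realType.
Local Notation expo := (exponential_prob (1 : R)).

Lemma exponential_prob_gt (u : R) : 0 <= u -> expo `]u, +oo[ = (expR (- u))%:E.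
Proof.
move=> u0.
pose mu : probability _ R :=
  exponential_distribution_exponential_prob__canonical__probability_measure_Probability
  (@ltr01 R).
have muE (A : set _) : expo A = mu A by [].
have mu_neg : mu `]-oo, 0%R[%classic = 0%E.
  rewrite -muE /exponential_prob; apply: integral0_eq => x /=.
  by rewrite in_itv/= => x0; rewrite lt0_exponential_pdf.
have mu_cc : mu `[0%R, u]%classic = (1 - (expR (- u))%:E)%E.
  rewrite -muE; move: u0; rewrite le_eqVlt => /predU1P[<-|u0].
    by rewrite set_itv1 /exponential_prob integral_set1 oppr0 expR0 subee.
  by rewrite exponential_prob_itv0c// mulN1r.
have mu_le : mu `]-oo, u]%classic = (1 - (expR (- u))%:E)%E.
  have -> : `]-oo, u]%classic = `]-oo, 0%R[%classic `|` `[0%R, u]%classic.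
    apply/seteqP; split => x /=; rewrite !in_itv/=.
      by move=> xu; case: (ltP x 0) => x0; [left|right].
    by case=> [x0|/andP[]//]; rewrite (le_trans (ltW x0)).
  have -> : mu (`]-oo, 0%R[%classic `|` `[0%R, u]%classic) =
      (mu `]-oo, 0%R[%classic + mu `[0%R, u]%classic)%E.
    apply: measureU => //.
    apply/seteqP; split => x //=; rewrite !in_itv/= => -[x0 /andP[]].
    by rewrite leNgt x0.
  by rewrite mu_neg mu_cc add0e.
have : mu setT = 1%E by exact: probability_setT.
have -> : [set: R] = `]-oo, u]%classic `|` `]u, +oo[%classic.
  apply/seteqP; split => x //= _; rewrite !in_itv/= andbT.
  by case: (leP x u) => xu; [left|right].
have -> : mu (`]-oo, u]%classic `|` `]u, +oo[%classic) =
    (mu `]-oo, u]%classic + mu `]u, +oo[%classic)%E.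
  apply: measureU => //.
  apply/seteqP; split => x //=; rewrite !in_itv/= andbT => -[xu].
  by rewrite ltNge xu.
rewrite mu_le muE => H.
have : mu `]u, +oo[%classic \is a fin_num by exact: fin_num_measure.
case: (mu `]u, +oo[%classic) H => // v [H] _; congr EFin.
by move: H; lra.
Qed.

Lemma exponential_prob_oc (u v : R) : 0 <= u -> u <= v ->
  expo `]u, v] = (expR (- u) - expR (- v))%:E.
Proof.
move=> u0 uv.
pose mu : probability _ R :=
  exponential_distribution_exponential_prob__canonical__probability_measure_Probability
  (@ltr01 R).
have muE (A : set _) : expo A = mu A by [].
have := exponential_prob_gt u0.
have -> : `]u, +oo[%classic = `]u, v]%classic `|` `]v, +oo[%classic.
  apply/seteqP; split => x /=; rewrite !in_itv/= !andbT.
    by move=> ux; case: (leP x v) => xv; [left; rewrite ux|right].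
  by case=> [/andP[]//|]; exact: le_lt_trans.
rewrite muE.
have -> : mu (`]u, v]%classic `|` `]v, +oo[%classic) =
    (mu `]u, v]%classic + mu `]v, +oo[%classic)%E.
  apply: measureU => //.
  apply/seteqP; split => x //=; rewrite !in_itv/= andbT => -[/andP[_ xv]].
  by rewrite ltNge xv.
rewrite -(muE `]v, +oo[%classic) exponential_prob_gt; last exact: le_trans uv.
rewrite muE.
have : mu `]u, v]%classic \is a fin_num by exact: fin_num_measure.
case: (mu `]u, v]%classic) => // w _ [H]; congr EFin.
by move: H; lra.
Qed.

Lemma exponential_probT : expo [set: R] = 1%E.
Proof.
have := @probability_setT _ _ _
  (exponential_distribution_exponential_prob__canonical__probability_measure_Probability
  (@ltr01 R)).
by [].
Qed.

End ExponentialIntervals.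

(** * A lower bound for the law of the continuous-time chain *)

Section ContinuousTimeLaw.
Context (R : realType) (S : countType) dT (T : measurableType dT)
  (Pr : probability T R) (K : S -> S -> R) (supp : S -> seq S).
Hypotheses (supp_uniq : forall y, uniq (supp y)) (K_ge0 : forall y z, 0 <= K y z).

Local Notation expo := (exponential_prob (1 : R)).

Section Skeleton.
Variables (x : S) (Z : nat -> T -> S) (tau : nat -> T -> R).
Hypotheses (mZ : forall k z, measurable [set s | Z k s = z])
  (mtau : forall k, measurable_fun setT (tau k : T -> measurableTypeR R))
  (law : forall n (z : nat -> S) (A : nat -> set (measurableTypeR R)),
     (forall k, measurable (A k)) ->
     Pr [set s | forall k, (k <= n)%N -> Z k s = z k /\ A k (tau k s)]
     = ((trajectory_weight K x z n)%:E *
        \prod_(k < n.+1) expo (A k))%E).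

Lemma measurable_holding k (A : set (measurableTypeR R)) : measurable A ->
  measurable [set s | A (tau k s)].
Proof. by move=> mA; rewrite -[X in measurable X]setTI; exact: mtau. Qed.

Lemma measurable_skeleton n m (z : nat -> S) (A : nat -> set (measurableTypeR R))
    (D : set S) : (forall k, measurable (A k)) ->
  measurable [set s | [/\ forall k, (k <= n)%N -> Z k s = z k,
    forall k, (k <= m)%N -> A k (tau k s) & D (Z m s)]].
Proof.
move=> mA; rewrite (_ : [set s | _] =
  [set s | forall k, (k <= n)%N -> Z k s = z k] `&`
  ([set s | forall k, (k <= m)%N -> A k (tau k s)] `&` [set s | D (Z m s)])).
  apply: measurableI; [|apply: measurableI].
  - by apply: measurable_forall => k; exact: measurable_imply.
  - apply: measurable_forall => k; apply: measurable_imply.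
    exact: measurable_holding.
  - by apply: measurable_preimage_discrete.
by apply/seteqP; split => s /= [] => [? ? ?|? [? ?]].
Qed.

(** The law is known for fully prescribed trajectories. Here the last [i] steps are free, and each
    is summed over the finite support; the resulting events are disjoint, whence an inequality by
    induction on [i]. *)
Lemma skeleton_ge n i (z : nat -> S) (A : nat -> set (measurableTypeR R))
    (D : set S) : (forall k, measurable (A k)) ->
  ((trajectory_weight K x z n * avgn K supp i \1_D (z n))%:E *
     \prod_(k < (n + i).+1) expo (A k) <=
   Pr [set s | [/\ forall k, (k <= n)%N -> Z k s = z k,
    forall k, (k <= n + i)%N -> A k (tau k s) & D (Z (n + i)%N s)]])%E.
Proof.
move=> mA; have expo0 m : (0 <= \prod_(k < m) expo (A k))%E.
  by apply: prode_ge0 => k _; exact: measure_ge0.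
elim: i n z => [|i IH] n z.
  rewrite addn0 /= indicE; have [zD|zD] := boolP (z n \in D); last first.
    by rewrite mulr0 mul0e.
  rewrite mulr1 -law//; apply: le_measure; rewrite ?inE.
  - apply: measurable_forall => k; apply: measurable_imply.
    have := measurableI _ _ (mZ k (z k)) (measurable_holding k (mA k)).
    exact.
  - exact: (measurable_skeleton n n z D mA).
  - move=> s /= H; split => [k /H[]//|k /H[]//|].
    by have [-> _] := H n (leqnn n); rewrite inE in zD.
pose z' y k := if (k <= n)%N then z k else y.
have z'n y : z' y n.+1 = y by rewrite /z' ltnn.
have tw y : trajectory_weight K x (z' y) n.+1 = trajectory_weight K x z n * K (z n) y.
  rewrite /trajectory_weight /z' leq0n big_ord_recr/= leqnn ltnn mulrA.
  congr (_ * _ * _); apply: eq_bigr => k _.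
  by rewrite ltnW ?ltn_ord//= ltn_ord.
pose F y := [set s | [/\ forall k, (k <= n.+1)%N -> Z k s = z' y k,
    forall k, (k <= n.+1 + i)%N -> A k (tau k s) & D (Z (n.+1 + i)%N s)]].
apply: (@le_trans _ _ (\sum_(y <- supp (z n)) Pr (F y))%E); last first.
  apply: sum_disjoint_le => //.
  - by move=> y; exact: measurable_skeleton.
  - exact: (measurable_skeleton n (n + i.+1) z D mA).
  - move=> y y' s _ _ [Fy _ _] [Fy' _ _].
    by rewrite -(z'n y) -(z'n y') -Fy// -Fy'.
  - move=> y _ s [F1 F2 F3]; rewrite -addSnnS; split => // k kn.
    by rewrite (F1 k (leqW kn)) /z' kn.
apply: (@le_trans _ _ (\sum_(y <- supp (z n))
    (trajectory_weight K x (z' y) n.+1 * avgn K supp i \1_D (z' y n.+1))%:E *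
    \prod_(k < (n.+1 + i).+1) expo (A k))%E); last exact: lee_sum.
rewrite addSnnS; have [q qE] : exists q, (\prod_(k < (n + i.+1).+1) expo (A k) = q%:E)%E.
  exists (\prod_(k < (n + i.+1).+1) fine (expo (A k))); rewrite -prodEFin.
  apply: eq_bigr => k _; rewrite fineK//.
  exact: (@fin_num_measure _ _ _ (exponential_distribution_exponential_prob__canonical__probability_measure_Probability
  (@ltr01 R))).
rewrite qE -EFinM.
rewrite (eq_bigr (fun y => (trajectory_weight K x z n *
  (K (z n) y * avgn K supp i \1_D y) * q)%:E)); last first.
  by move=> y _; rewrite tw z'n mulrA.
by rewrite sumEFin lee_fin -mulr_suml -mulr_sumr.
Qed.

(** The last waiting time must exceed [s] minus the sum of the left endpoints, hence the time
    actually left, wherever the earlier waiting times lie in their cells. *)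
Definition cell (s : R) (M : nat) (l : seq nat) (j : nat) : set (measurableTypeR R) :=
  let h := s / M%:R in
  if (j < size l)%N then `](nth 0%N l j)%:R * h, (nth 0%N l j).+1%:R * h]%classic
  else `]s - (\sum_(i <- l) i)%N%:R * h, +oo[%classic.

(* On this event exactly [size l] jumps occur before time [s], at times read
   off from [l] up to [s / M]. *)
Definition grid_event (D : set S) (s : R) (M : nat) (l : seq nat) : set T :=
  [set w | [/\ forall k, (k <= 0)%N -> Z k w = x,
    forall k, (k <= size l)%N -> cell s M l k (tau k w) & D (Z (size l) w)]].

Lemma measurable_grid_event D s M l : measurable (grid_event D s M l).
Proof.
apply: (@measurable_skeleton 0 (size l) (fun=> x)) => k.
by rewrite /cell; case: ifP => _; exact: measurable_itv.
Qed.

(** The left endpoints cancel between the cells and the final tail, so the bound depends on [l] only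
    through its length. *)
Lemma grid_event_ge D s M l : 0 < s -> (0 < M)%N ->
  (\sum_(i <- l) i + size l <= M)%N ->
  ((avgn K supp (size l) \1_D x *
     (expR (- s) * (1 - expR (- (s / M%:R))) ^+ size l))%:E <=
   Pr (grid_event D s M l))%E.
Proof.
move=> s0 M0 lM; have mc k : measurable (cell s M l k).
  by rewrite /cell; case: ifP => _; exact: measurable_itv.
have := @skeleton_ge 0 (size l) (fun=> x) (cell s M l) D mc.
rewrite /= add0n {1}/trajectory_weight eqxx big_ord0 !mul1r; apply: le_trans.
rewrite EFinM.
set h := s / M%:R.
have h0 : 0 < h by rewrite divr_gt0// ltr0n.
have Mh : s = M%:R * h by rewrite /h mulrC divfK// pnatr_eq0 -lt0n.
suff -> : (\prod_(k < (size l).+1) expo (cell s M l k) =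
    (expR (- s) * (1 - expR (- h)) ^+ size l)%:E)%E by [].
rewrite big_ord_recr/= {2}/cell ltnn exponential_prob_gt; last first.
  rewrite subr_ge0 {2}Mh ler_pM2r// ler_nat.
  by rewrite (leq_trans _ lM)// leq_addr.
rewrite (_ : \prod_(k < size l) _ =
    (\prod_(k < size l) (expR (- ((nth 0%N l k)%:R * h)) * (1 - expR (- h))))%:E)%E.
  rewrite -EFinM; congr EFin; rewrite big_split/= prodr_const card_ord.
  rewrite mulrAC; congr (_ * _); rewrite -expR_sum -expRD; congr expR.
  rewrite sumrN -mulr_suml -natr_sum (big_nth 0%N) big_mkord -/h; lra.
rewrite -prodEFin; apply: eq_bigr => k _; rewrite /cell ltn_ord.
rewrite exponential_prob_oc.
- rewrite mulrBr mulr1 -expRD; congr (_ - expR _)%:E.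
  by rewrite -[in LHS]natr1 -/h; lra.
- by rewrite mulr_ge0// ltW.
- by rewrite ler_pM2r// ler_nat.
Qed.

(** The condition on [l] says that the right endpoints add up to at most [s], so [size l] jumps
    occur by time [s]. The left endpoints put the next jump after [s] and make the last waiting time
    nonnegative. *)
Lemma grid_event_holding D s M l w : 0 < s -> (0 < M)%N ->
  (\sum_(i <- l) i + size l <= M)%N -> grid_event D s M l w ->
  [/\ forall j, (j <= size l)%N -> 0 <= tau j w,
     \sum_(j < size l) tau j w <= s &
     s < \sum_(j < (size l).+1) tau j w].
Proof.
move=> s0 M0 lM [_ cl _]; set h := s / M%:R.
have h0 : 0 < h by rewrite divr_gt0// ltr0n.
have Mh : s = M%:R * h by rewrite /h mulrC divfK// pnatr_eq0 -lt0n.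
have in_cell j : (j < size l)%N ->
    (nth 0%N l j)%:R * h < tau j w <= (nth 0%N l j).+1%:R * h.
  by move=> jl; have := cl j (ltnW jl); rewrite /cell jl /= in_itv.
have last_cell : s - (\sum_(i <- l) i)%N%:R * h < tau (size l) w.
  by have := cl _ (leqnn _); rewrite /cell ltnn /= in_itv/= andbT.
have sumE : (\sum_(i <- l) i)%N%:R * h = \sum_(j < size l) (nth 0%N l j)%:R * h.
  by rewrite (big_nth 0%N) big_mkord natr_sum mulr_suml.
split.
- move=> j; rewrite leq_eqVlt => /predU1P[->|jl]; last first.
    by have /andP[/ltW + _] := in_cell j jl; apply: le_trans; rewrite mulr_ge0// ltW.
  apply: le_trans (ltW last_cell); rewrite subr_ge0 [leRHS]Mh ler_pM2r// ler_nat.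
  by rewrite (leq_trans _ lM)// leq_addr.
- apply: (@le_trans _ _ (\sum_(j < size l) (nth 0%N l j).+1%:R * h)).
    by apply: ler_sum => j _; have /andP[] := in_cell j (ltn_ord j).
  rewrite -mulr_suml -natr_sum [leRHS]Mh ler_pM2r// ler_nat.
  rewrite (leq_trans _ lM)// (big_nth 0%N) big_mkord.
  rewrite -[X in (_ <= _ + X)%N]card_ord -sum1_card -big_split/=.
  by apply: leq_sum => j _; rewrite addn1.
- rewrite big_ord_recr/= -ltrBlDl; apply: le_lt_trans last_cell.
  rewrite lerB// sumE; apply: ler_sum => j _.
  by have /andP[/ltW] := in_cell j (ltn_ord j).
Qed.

(** A strictly shorter list would put more than [s] into a partial sum of waiting times that the
    longer list bounds by [s]. At equal lengths, the half-open cells of the grid are disjoint. *)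
Lemma grid_event_inj D s M l l' w : 0 < s -> (0 < M)%N ->
  (\sum_(i <- l) i + size l <= M)%N -> (\sum_(i <- l') i + size l' <= M)%N ->
  grid_event D s M l w -> grid_event D s M l' w -> l = l'.
Proof.
move=> s0 M0; have h0 : 0 < s / M%:R by rewrite divr_gt0// ltr0n.
wlog ll' : l l' / (size l <= size l')%N.
  move=> H lM lM' E E'; have [ll'|/ltnW ll'] := leqP (size l) (size l').
    exact: (H l l').
  exact/esym/(H l' l).
move=> lM lM' E E'.
have [p1 _ p3] := grid_event_holding s0 M0 lM E.
have [p1' p2' _] := grid_event_holding s0 M0 lM' E'.
have sz : size l = size l'.
  apply/eqP; rewrite eqn_leq ll' leqNgt; apply/negP => lt.
  suff le : \sum_(j < (size l).+1) tau j w <= \sum_(j < size l') tau j w.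
    by have := lt_le_trans p3 (le_trans le p2'); rewrite ltxx.
  rewrite -!(big_mkord xpredT (fun j => tau j w)).
  rewrite [leRHS](@big_cat_nat _ _ _ (size l).+1)//= lerDl big_nat_cond.
  by apply: sumr_ge0 => j /andP[/andP[_ jl] _]; apply: p1'; exact: ltnW.
apply: (@eq_from_nth _ 0%N) => // j jl.
move: E E' => [_ c _] [_ c' _].
have := c j (ltnW jl); have := c' j; rewrite -sz => /(_ (ltnW jl)).
rewrite /cell -sz jl /= !in_itv/= => /andP[a b] /andP[a' b'].
have := lt_le_trans a b'; have := lt_le_trans a' b.
rewrite !ltr_pM2r// !ltr_nat !ltnS => u v.
by apply/eqP; rewrite eqn_leq u v.
Qed.

End Skeleton.

(** The lists of length [k] with sum at most [M - k] number ['C(M, k)], and their grid events are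
    disjoint with a common lower bound. *)
Lemma ctime_chain_binomial_ge (Y : R -> T -> S) x (D : set S) s N M : 0 < s -> (N < M)%N ->
  ctime_chain Pr Y K x ->
  ((\sum_(k < N) 'C(M, k)%:R * (avgn K supp k \1_D x *
     (expR (- s) * (1 - expR (- (s / M%:R))) ^+ k)))%:E <=
   Pr [set w | D (Y s w)])%E.
Proof.
move=> s0 NM [mY [Z [tau [mZ mtau law Yae]]]].
have [N0 [mN0 PN0 N0P]] := Yae.
have M0 : (0 < M)%N by exact: leq_trans NM.
have kM (k : 'I_N) : (k <= M)%N.
  by rewrite ltnW// (ltn_trans (ltn_ord k)).
pose J (k : 'I_N) := (k.-tuple 'I_(M - k).+1)%type.
pose good k : pred (J k) := fun t => (\sum_(i <- t) i <= M - k)%N.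
pose val_seq (p : {k : 'I_N & J k}) : seq nat :=
  [seq val i | i <- tval (tagged p)].
have sz p : size (val_seq p) = tag p :> nat by rewrite size_map size_tuple.
have val_good p : good (tag p) (tagged p) ->
    (\sum_(i <- val_seq p) i + size (val_seq p) <= M)%N.
  move=> gp; rewrite sz big_map; move: gp; rewrite /good => gp.
  by rewrite addnC -leq_subRL//.
have val_inj : injective val_seq.
  move=> [k t] [k' t'] e; have := congr1 size e; rewrite !sz /= => ek.
  have {}ek : k = k' by exact: val_inj.
  subst k'; congr existT; apply: val_inj; apply: (inj_map val_inj).
  exact: e.
(* [Y] is read off from the skeleton only outside the null set [N0], which is added to the target
   event. *)
apply: (@le_trans _ _ (Pr ([set w | D (Y s w)] `|` N0))); last first.
  rewrite (le_trans (measureU2 _ _ _))//; first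
    exact: measurable_preimage_discrete (fun z => mY s z (ltW s0)).
  by rewrite [X in (_ + X)%E]PN0 adde0.
apply: (@le_trans _ _ (\sum_(p <- [seq p <- index_enum {k : 'I_N & J k} |
      good (tag p) (tagged p)]) Pr (grid_event x Z tau D s M (val_seq p)))%E).
  rewrite big_filter.
  rewrite (_ : (\sum_(p <- _ | _) _)%E = \sum_(k < N) \sum_(t : J k | good k t)
      Pr (grid_event x Z tau D s M (val_seq (Tagged J t))))%E; last first.
    rewrite (sig_big_dep xpredT good
      (fun k t => Pr (grid_event x Z tau D s M (val_seq (Tagged J t)))))/=.
    by apply: eq_bigr => -[].
  rewrite -sumEFin; apply: lee_sum => k _.
  have <- : #|finset (good k)| = 'C(M, k).
    by have := card_partial_ord_partitions k (M - k); rewrite subnKC.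
  apply: (@le_trans _ _ (\sum_(t : J k | good k t) (avgn K supp k \1_D x *
     (expR (- s) * (1 - expR (- (s / M%:R))) ^+ k))%:E)%E).
    rewrite sumEFin lee_fin (eq_bigl (fun t => t \in finset (good k))).
      by rewrite sumr_const mulr_natl.
    by move=> t; rewrite inE.
  apply: lee_sum => t gt.
  have := @grid_event_ge x Z tau mZ mtau law D s M (val_seq (Tagged J t)) s0 M0
    (@val_good (Tagged J t) gt).
  by rewrite sz.
apply: sum_disjoint_le.
- by rewrite filter_uniq// index_enum_uniq.
- by move=> p; exact: measurable_grid_event.
- apply: measurableU => //.
  exact: measurable_preimage_discrete (fun z => mY s z (ltW s0)).
- move=> p q w; rewrite !mem_filter => /andP[gp _] /andP[gq _] Ep Eq.
  apply: val_inj.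
  exact: (grid_event_inj s0 M0 (val_good _ gp) (val_good _ gq) Ep Eq).
- move=> p; rewrite mem_filter => /andP[gp _] w E.
  have [h1 h2 h3] := grid_event_holding s0 M0 (val_good _ gp) E.
  have [N0w|nN0w] := pselect (N0 w); [by right|left].
  have Yw : Y s w = Z (size (val_seq p)) w.
    apply: contrapT => neq; apply/nN0w/N0P => H; apply: neq.
    by apply: H; [exact: ltW|rewrite h2].
  by rewrite /= Yw; case: E.
Qed.

(** The grid is refined at fixed [N]: binomial weights tend to Poisson weights. *)
Lemma ctime_chain_poisson_ge (Y : R -> T -> S) x (D : set S) s N : 0 < s ->
  ctime_chain Pr Y K x ->
  ((expR (- s) * poisson_series s (fun k => avgn K supp k \1_D x) N)%:E <=
   Pr [set w | D (Y s w)])%E.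
Proof.
move=> s0 hY.
have finP : Pr [set w | D (Y s w)] \is a fin_num.
  apply: fin_num_measure; case: hY => mY _.
  exact: measurable_preimage_discrete (fun z => mY s z (ltW s0)).
rewrite -(fineK finP) lee_fin; set c := fine _.
have a0 k y : 0 <= avgn K supp k \1_D y.
  elim: k y => [|k IH] y /=; first by rewrite indicE.
  by apply: sumr_ge0 => z _; rewrite mulr_ge0.
(* With [M = m + N.+1] and [h = s / M], this is [(M - k) * (h / (1 + h))]. Its [k]-th power over
   [k!] is below the binomial term, because the falling factorial is at least [(M - k) ^ k] and
   [1 - expR (- h) >= h / (1 + h)]. *)
pose u (k m : nat) := s * (m%:R + (N.+1 - k)%N%:R) / (m%:R + (N.+1%:R + s)).
have ucvg (k : 'I_N) : u k @ \oo --> s.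
  have cE m : u k m = s * (1 - (k%:R + s) * (m%:R + (N.+1%:R + s))^-1).
    rewrite /u natrB ?(ltnW (leqW (ltn_ord k)))//; field.
    by rewrite gt_eqF// ltr_wpDl// ltr_wpDl.
  rewrite (_ : u k = fun m => s * (1 - (k%:R + s) * (m%:R + (N.+1%:R + s))^-1)); last first.
    exact/funext.
  rewrite -[X in _ --> X]mulr1; apply: cvgMl_tmp.
  rewrite -[X in _ --> X]subr0; apply: cvgB; first exact: cvg_cst.
  rewrite -[X in _ --> X](mulr0 (k%:R + s)).
  apply: cvgMl_tmp.
  apply: (@squeeze_cvgr _ _ _ _ (fun=> 0) harmonic); last 2 first.
  - exact: cvg_cst.
  - exact: cvg_harmonic.
  apply: nearW => m; rewrite invr_ge0 !addr_ge0 ?(ltW s0)//= lef_pV2 ?posrE//.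
    rewrite -natr1 lerD2l; apply: (@le_trans _ _ N.+1%:R); first by rewrite ler1n.
    by rewrite lerDl ltW.
  by rewrite ltr_wpDl// ltr_wpDl.
have lim_sum : (fun m => \sum_(k < N) (u k m ^+ k / k`!%:R) *
    (avgn K supp k \1_D x * expR (- s))) @ \oo -->
    \sum_(k < N) (s ^+ k / k`!%:R) * (avgn K supp k \1_D x * expR (- s)).
  apply: cvg_big => [|k _]; first exact: add_continuous.
  apply: cvgMr_tmp.
  apply: cvgMr_tmp.
  exact: (continuous_cvg _ (@exprn_continuous R k s) (ucvg k)).
rewrite (_ : _ * _ = \sum_(k < N) (s ^+ k / k`!%:R) *
    (avgn K supp k \1_D x * expR (- s))); last first.
  rewrite /poisson_series /series /= big_mkord mulr_sumr.
  by apply: eq_bigr => k _; rewrite /exp_coeff /=; ring.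
apply: (ler_cvg_to lim_sum (cvg_cst c)); apply: nearW => m.
have NM : (N < m + N.+1)%N by rewrite leq_addl.
have := ctime_chain_binomial_ge D s0 NM hY; rewrite -(fineK finP) lee_fin -/c.
apply: le_trans; apply: ler_sum => k _.
rewrite [leRHS](_ : _ = ('C(m + N.+1, k)%:R *
  (1 - expR (- (s / (m + N.+1)%:R))) ^+ k) *
  (avgn K supp k \1_D x * expR (- s))); last by ring.
rewrite ler_wpM2r ?mulr_ge0 ?expR_ge0//.
set M := (m + N.+1)%N; have kM : (k <= M)%N.
  by rewrite ltnW// (ltn_trans (ltn_ord k)).
have M0 : 0 < M%:R :> R by rewrite ltr0n (leq_trans _ NM).
rewrite ler_pdivrMr ?ltr0n ?fact_gt0// mulrAC -natrM bin_ffact.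
have uE : u k m = (M - k)%N%:R * (s / M%:R / (1 + s / M%:R)).
  have -> : (M - k = m + (N.+1 - k))%N.
    by rewrite /M addnBA// leqW// ltnW ?ltn_ord.
  rewrite /u [in RHS]natrD -(_ : M%:R + s = m%:R + (N.+1%:R + s)).
    by field; rewrite !gt_eqF ?addr_gt0.
  by rewrite /M natrD addrA.
rewrite uE exprMn -natrX ler_pM//.
- by rewrite exprn_ge0// divr_ge0 ?addr_ge0// divr_ge0// ltW.
- rewrite ler_nat ffact_prod -[X in (_ ^ X)%N]card_ord -prod_nat_const.
  by apply: leq_prod => i _; rewrite leq_sub2l// ltnW ?ltn_ord.
- have h0 : 0 < s / M%:R by rewrite divr_gt0.
  have h1 : 0 < 1 + s / M%:R by rewrite addr_gt0.
  apply: lerXn2r; rewrite ?nnegrE; first by rewrite divr_ge0// ltW.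
    by rewrite subr_ge0 -[leRHS]expR0 ler_expR oppr_le0 ltW.
  rewrite (_ : _ / _ = 1 - (1 + s / M%:R)^-1); last first.
    by field; rewrite !gt_eqF ?addr_gt0.
  rewrite lerB// expRN lef_pV2 ?posrE ?expR_gt0//.
  exact: expR_ge1Dx.
Qed.

Lemma ctime_chain_heat_le (Y : R -> T -> S) x (D : set S) s : 0 < s ->
  (forall y, \sum_(z <- supp y) K y z = 1) -> ctime_chain Pr Y K x ->
  heat K supp s \1_D x <= fine (Pr [set w | D (Y s w)]).
Proof.
move=> s0 K1 hY; apply: poisson_mean_le; first exact: ltW.
  apply: (@bounded_avgn _ _ _ _ K_ge0 K1 _ 0 1) => y.
  by rewrite indicE; case: (_ \in _); rewrite ?lexx ?ler01.
move=> N; rewrite -lee_fin fineK; first exact: ctime_chain_poisson_ge.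
apply: fin_num_measure; case: hY => mY _.
exact: measurable_preimage_discrete (fun z => mY s z (ltW s0)).
Qed.

(** The total mass of the kernel is read off from the chain: [Z 0] is almost surely [x], and the
    countably many values of [Z 1] outside the support have probability zero. *)
Lemma ctime_chain_sum1 (Y : R -> T -> S) x :
  (forall y, y \notin supp x -> K x y = 0) -> ctime_chain Pr Y K x ->
  \sum_(y <- supp x) K x y = 1.
Proof.
move=> K0 [mY [Z [tau [mZ mtau law _]]]].
pose F y := [set s | forall k, (k <= 1)%N -> Z k s = (if k == 0%N then x else y) /\
   setT (tau k s)].
have PF y : Pr (F y) = (K x y)%:E.
  rewrite (law 1%N (fun k => if k == 0%N then x else y) (fun=> setT))//.
  rewrite /trajectory_weight /= eqxx big_ord1 mul1r big1 ?mule1//.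
  by move=> k _; rewrite exponential_probT.
have mF y : measurable (F y).
  apply: measurable_forall => k; apply: measurable_imply.
  rewrite (_ : [set t | _] = [set s | Z k s = (if k == 0%N then x else y)])//.
  by apply/seteqP; split => s //= -[].
have mZ0 : measurable [set s | Z 0%N s = x] by exact: mZ.
have PZ0 : Pr [set s | Z 0%N s = x] = 1%E.
  have := law 0%N (fun=> x) (fun=> setT) (fun=> measurableT).
  rewrite /trajectory_weight eqxx big_ord0 mul1r big_ord1 exponential_probT mule1.
  move=> <-; congr (Pr _); apply/seteqP; split => s /=.
    by move=> Zx k; rewrite leqn0 => /eqP ->.
  by move=> /(_ 0%N isT)[].
have N1 : Pr (~` [set s | Z 0%N s = x]) = 0%E.
  by rewrite probability_setC// PZ0 subee.
pose G := [set s | exists y, y \notin supp x /\ F y s].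
have mG : measurable G.
  apply: measurable_exists => y; apply: measurableI; last exact: mF.
  exact: measurable_cst_prop.
have PG : Pr G = 0%E.
  apply: measure_negligible => //.
  pose F' n := if unpickle n is Some y then (if y \in supp x then set0 else F y) else set0.
  apply: (@negligibleS _ _ _ Pr (\bigcup_n F' n)).
    move=> s [y [ny Fy]]; exists (pickle y) => //.
    by rewrite /F' pickleK (negbTE ny).
  apply: negligible_bigcup => n; rewrite /F'; case: unpickle => [y|]; last first.
    exact: negligible_set0.
  case: ifPn => ys; first exact: negligible_set0.
  by apply/negligibleP => //; have := PF y; rewrite K0.
have sumE : (\sum_(y <- supp x) Pr (F y) = (\sum_(y <- supp x) K x y)%:E)%E.
  by rewrite -sumEFin; apply: eq_bigr => y _; rewrite PF.
apply/eqP; rewrite eq_le -!lee_fin -sumE; apply/andP; split.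
  rewrite -(probability_setT Pr); apply: sum_disjoint_le => //.
  move=> y y' s _ _ F1 F2; have [/= e1 _] := F1 1%N isT.
  by have [/= e2 _] := F2 1%N isT; rewrite -e1 -e2.
rewrite -PZ0; apply: (@le_trans _ _ (Pr ([set s | Z 0%N s = x] `\` G) + Pr G)%E).
  rewrite -measureU//; last 2 first.
  - exact: measurableD.
  - by apply/seteqP; split => s //= -[[]].
  apply: le_measure; rewrite ?inE//; first by apply: measurableU => //; exact: measurableD.
  by move=> s Zs; have [Gs|nGs] := pselect (G s); [right|left].
rewrite [X in (_ + X)%E]PG adde0; apply: measure_le_sum => //.
  exact: measurableD.
move=> s [Zs nG]; have Fs : F (Z 1%N s) s by case=> [|[|k]].
exists (Z 1%N s) => //; apply: contrapT => /negP ns; apply: nG.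
by exists (Z 1%N s).
Qed.

End ContinuousTimeLaw.

(** * The Euclidean norm *)

Section EuclideanNorm.
Variables (R : realType) (d : nat).
Implicit Types u v : 'rV[R]_d.

Definition dotp u v : R := \sum_(i < d) u 0 i * v 0 i.

Lemma enorm_ge0 u : 0 <= enorm u.
Proof. exact: sqrtr_ge0. Qed.

Lemma sqr_enorm u : enorm u ^+ 2 = dotp u u.
Proof.
rewrite sqr_sqrtr; last by apply: sumr_ge0 => i _; exact: sqr_ge0.
by apply: eq_bigr => i _; rewrite expr2.
Qed.

Lemma enorm_eq0_coord u i : enorm u = 0 -> u 0 i = 0.
Proof.
move=> u0; have := sqr_enorm u; rewrite u0 expr0n /= => /esym/eqP.
rewrite psumr_eq0; last by move=> j _; rewrite -expr2 sqr_ge0.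
by move=> /allP/(_ i (mem_index_enum _)); rewrite /= -expr2 sqrf_eq0 => /eqP.
Qed.

(** Cauchy-Schwarz, from expanding the squared norm of [b u - a v], where [a] and [b] are the norms
    of [u] and [v]. *)
Lemma dotp_le u v : dotp u v <= enorm u * enorm v.
Proof.
have [u0|u0] := eqVneq (enorm u) 0.
  rewrite u0 mul0r /dotp big1// => i _.
  by rewrite (enorm_eq0_coord i u0) mul0r.
have [v0|v0] := eqVneq (enorm v) 0.
  rewrite v0 mulr0 /dotp big1// => i _.
  by rewrite (enorm_eq0_coord i v0) mulr0.
set a := enorm u; set b := enorm v.
have ab0 : 0 < a * b by rewrite mulr_gt0 ?lt_def ?u0 ?v0 ?enorm_ge0.
have : 0 <= \sum_(i < d) (b * u 0 i - a * v 0 i) ^+ 2.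
  by apply: sumr_ge0 => i _; exact: sqr_ge0.
rewrite (eq_bigr (fun i => b ^+ 2 * (u 0 i * u 0 i) +
  a ^+ 2 * (v 0 i * v 0 i) - 2 * (a * b) * (u 0 i * v 0 i))); last first.
  by move=> i _; ring.
rewrite sumrB big_split/= -!mulr_sumr -/(dotp u u) -/(dotp v v) -/(dotp u v).
rewrite -!sqr_enorm -/a -/b => H; rewrite -(ler_pM2l ab0).
by move: H; rewrite [b ^+ 2 * _]mulrC -exprMn expr2; lra.
Qed.

Lemma dotpDr u v v' : dotp u (v + v') = dotp u v + dotp u v'.
Proof.
by rewrite /dotp -big_split; apply: eq_bigr => i _; rewrite mxE mulrDr.
Qed.

Lemma dotpC u v : dotp u v = dotp v u.
Proof. by apply: eq_bigr => i _; rewrite mulrC. Qed.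

Lemma ler_enormD u v : enorm (u + v) <= enorm u + enorm v.
Proof.
rewrite -(@ler_pXn2r _ 2)// ?nnegrE ?addr_ge0 ?enorm_ge0//.
rewrite sqr_enorm dotpDr ![dotp (u + v) _]dotpC !dotpDr -!sqr_enorm [dotp v u]dotpC.
have := dotp_le u v; rewrite sqrrD; lra.
Qed.

Lemma enormN u : enorm (- u) = enorm u.
Proof. by congr Num.sqrt; apply: eq_bigr => i _; rewrite mxE sqrrN. Qed.

Lemma coord_le_enorm u i : `|u 0 i| <= enorm u.
Proof.
rewrite -(@ler_pXn2r _ 2)// ?nnegrE ?enorm_ge0//.
rewrite real_normK ?num_real// sqr_enorm /dotp (bigD1 i)//= -expr2 lerDl.
by apply: sumr_ge0 => j _; rewrite -expr2 sqr_ge0.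
Qed.

Lemma embedD (x y : site d) : embed R (x + y) = embed R x + embed R y.
Proof. by rewrite /embed map_mxD. Qed.

Lemma embedB (x y : site d) : embed R (x - y) = embed R x - embed R y.
Proof. by rewrite /embed map_mxB. Qed.

End EuclideanNorm.

Lemma enorm_le_max (R : realType) (d : nat) (u : 'rV[R]_d) (c : R) :
  (forall i, `|u 0 i| <= c) -> enorm u <= d%:R * c.
Proof.
move=> uc; case: d u uc => [|d'] u uc.
  by rewrite /enorm big_ord0 sqrtr0 mul0r.
have c0 : 0 <= c by exact: le_trans (uc ord0).
have dc0 : 0 <= d'.+1%:R * c by rewrite mulr_ge0.
rewrite -(@ler_pXn2r _ 2)// ?nnegrE ?enorm_ge0//.
rewrite sqr_enorm; apply: (@le_trans _ _ (\sum_(i < d'.+1) c ^+ 2)).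
  apply: ler_sum => i _; rewrite -expr2 -[leLHS]real_normK ?num_real//.
  by rewrite lerXn2r ?nnegrE.
rewrite sumr_const card_ord exprMn -[leLHS]mulr_natl ler_wpM2r ?sqr_ge0//.
by rewrite -natrX ler_nat -[X in (X <= _)%N]expn1 leq_pexp2l.
Qed.


(** * Sup distance, boxes and neighbours in the lattice *)

Section SupDistance.
Variable d : nat.
Implicit Types x y z : site d.

Lemma linf_dist_leP x y n :
  reflect (forall i, (`|x 0%R i - y 0%R i|%N <= n)%N) (linf_dist x y <= n)%N.
Proof.
apply: (iffP idP) => [xy i|xy]; last by apply/bigmax_leqP => i _.
by move/bigmax_leqP: xy => /(_ i isT).
Qed.

Lemma linf_dist_triangle y x z : (linf_dist x z <= linf_dist x y + linf_dist y z)%N.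
Proof.
apply/linf_dist_leP => i.
apply: leq_trans (leqD_dist (x 0%R i) (y 0%R i) (z 0%R i)) _.
by apply: leq_add; [move: i|move: i]; apply/linf_dist_leP.
Qed.

Lemma enorm_le_linf (R : realType) x y :
  enorm (embed R (y - x)) <= d%:R * (linf_dist x y)%:R.
Proof.
apply: enorm_le_max => i; rewrite /embed !mxE -intr_norm -abszE.
have /linf_dist_leP/(_ i) := leqnn (linf_dist x y).
by rewrite distnC -(ler_nat R).
Qed.

Lemma linf_le_enorm (R : realType) x y n :
  enorm (embed R (y - x)) <= n%:R -> (linf_dist x y <= n)%N.
Proof.
move=> h; apply/linf_dist_leP => i; rewrite distnC -(ler_nat R).
apply: le_trans h; apply: le_trans (coord_le_enorm _ i).
by rewrite /embed !mxE -intr_norm -abszE.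
Qed.

Definition box x n : seq (site d) :=
  [seq x + \row_i ((f i)%:Z - n%:Z) | f : {ffun 'I_d -> 'I_(n + n).+1}].

Lemma mem_box x y n : (linf_dist x y <= n)%N -> y \in box x n.
Proof.
move=> /linf_dist_leP xy.
have b i : (0 <= y 0 i - x 0 i + n%:Z)%R /\ (`|(y 0 i - x 0 i + n%:Z)%R|%N < (n + n).+1)%N.
  have := xy i; lia.
apply/mapP; exists [ffun i => inord `|(y 0 i - x 0 i + n%:Z)%R|%N].
  by rewrite mem_enum.
apply/rowP => i; rewrite !mxE ffunE inordK; last by case: (b i).
by have [b0 _] := b i; rewrite gez0_abs// addrK addrC subrK.
Qed.

Lemma size_box x n : size (box x n) = ((n + n).+1 ^ d)%N.
Proof. by rewrite size_image card_ffun !card_ord. Qed.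

Definition nbhd x : seq (site d) :=
  [seq x + unit_vec i | i : 'I_d] ++ [seq x - unit_vec i | i : 'I_d].

Lemma adjacentC x y : Defs.adjacent x y = Defs.adjacent y x.
Proof. by apply: eq_existsb => i; rewrite orbC. Qed.

Lemma adjacent_nbhd x y : Defs.adjacent x y -> y \in nbhd x.
Proof.
move=> /existsP[i /orP[/eqP ->|/eqP ->]]; rewrite mem_cat; apply/orP.
  by left; apply: map_f; rewrite mem_enum.
by right; apply/mapP; exists i; rewrite ?mem_enum ?addrK.
Qed.

Lemma adjacent_linf x y : Defs.adjacent x y -> (linf_dist x y <= 1)%N.
Proof.
have u i j : (`|(unit_vec i : site d) 0%R j|%N <= 1)%N.
  by rewrite /unit_vec mxE; case: (_ && _).
move=> /existsP[i /orP[/eqP ->|/eqP ->]]; apply/linf_dist_leP => j.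
  by rewrite mxE opprD addrA subrr add0r abszN.
by rewrite mxE addrAC subrr add0r.
Qed.

End SupDistance.

(** * Infinite self-avoiding paths in a locally finite graph *)

Section Koenig.
Variables (S : choiceType) (e : rel S) (nb : S -> seq S) (x : S).
Hypothesis e_nb : forall y z, e y z -> z \in nb y.

(** The invariant of the construction: [s] is a self-avoiding path from [x] with self-avoiding
    continuations of every length. *)
Let extensible (s : seq S) := forall n, exists t,
  [/\ size t = n, path e x (s ++ t) & uniq (x :: s ++ t)].

Let extensible_step s : extensible s -> exists y, extensible (rcons s y).
Proof.
move=> sE; apply: contrapT => /forallNP nE.
have /choice[f fP] : forall y, exists n, forall t, size t = n ->
    path e x (rcons s y ++ t) -> uniq (x :: rcons s y ++ t) -> False.
  move=> y; apply: contrapT => /forallNP H; apply: (nE y) => n.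
  apply: contrapT => /forallNP H'; apply: (H n) => t st pt ut.
  by apply: (H' t).
(* Each neighbour [y] has a length [f y] that no continuation through it attains. A continuation of
   length [N.+1], cut after [f y] steps beyond its first site [y], contradicts this. *)
pose N := (\max_(y <- nb (last x s)) f y)%N.
have [[|y t] [st pt ut]] := sE N.+1; first by [].
case: st => st.
have fyt : (f y <= size t)%N.
  rewrite st; apply: leq_bigmax_seq => //; apply: e_nb.
  by move: pt; rewrite cat_path /= => /and3P[].
apply: (fP y (take (f y) t)).
- by rewrite size_take_min; apply/minn_idPl.
- move: pt; rewrite -cat_rcons -{1}(cat_take_drop (f y) t) catA cat_path.
  by case/andP.
- move: ut; rewrite -cat_rcons -{1}(cat_take_drop (f y) t) catA -cat_cons.
  by rewrite cat_uniq => /and3P[].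
Qed.

Lemma koenig_ray :
  (exists gamma : nat -> S,
    [/\ gamma 0%N = x, injective gamma & forall k, e (gamma k) (gamma k.+1)]) <->
  (forall n, exists s, [/\ size s = n, path e x s & uniq (x :: s)]).
Proof.
split=> [[g [g0 ginj ge]] n|H].
  exists (mkseq (fun k => g k.+1) n); split; first exact: size_mkseq.
    apply/(pathP x) => i; rewrite size_mkseq => iN.
    rewrite nth_mkseq//; case: i iN => [|i] iN /=; first by rewrite -g0.
    by rewrite nth_mkseq// ltnW.
  have -> : x :: mkseq (fun k => g k.+1) n = mkseq g n.+1.
    by rewrite /mkseq /= g0 -[1%N]/(1 + 0)%N iotaDl -map_comp.
  by rewrite map_inj_uniq ?iota_uniq.
have /choice[f fP] : forall s, exists y, extensible s -> extensible (rcons s y).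
  move=> s; have [/extensible_step[y yE]|nE] := pselect (extensible s).
    by exists y.
  by exists x.
pose p n := iter n (fun s => rcons s (f s)) [::].
have pS n : p n.+1 = rcons (p n) (f (p n)) by [].
have pE n : extensible (p n) by elim: n => [//|n IH] /=; exact: fP.
have pP n : path e x (p n) /\ uniq (x :: p n).
  by have [t [st]] := pE n 0%N; rewrite (size0nil st) cats0.
pose g k := last x (p k).
have gS k : g k.+1 = f (p k) by rewrite /g pS last_rcons.
have gmem i n : (i <= n)%N -> g i \in x :: p n.
  elim: n => [|n IH]; first by rewrite leqn0 => /eqP ->; rewrite mem_head.
  rewrite leq_eqVlt => /predU1P[->|/IH].
    by rewrite pS -rcons_cons mem_rcons gS mem_head.
  by rewrite pS -rcons_cons mem_rcons !inE => ->; rewrite orbT.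
have gneq i j : (i < j)%N -> g i <> g j.
  case: j => // j ij gij; have [_] := pP j.+1.
  by rewrite pS -rcons_cons rcons_uniq -gS -gij gmem.
exists g; split => // [i j gij|k].
  by case: (ltngtP i j) => // /gneq; rewrite gij.
have [+ _] := pP k.+1; rewrite pS rcons_path => /andP[_].
by rewrite gS.
Qed.

End Koenig.

(** * Measurability and size of the holes *)

Section HoleEvent.
Variables (R : realType) (d : nat) (alpha : R).
Hypothesis alpha_gt0 : 0 < alpha.
Implicit Types (x y z : site d) (w : env R d).

Lemma measurable_omega (b : edge d) :
  measurable_fun setT (fun w : env R d => omega w b : measurableTypeR R).
Proof.
move=> _ A mA; rewrite setTI; apply: sub_sigma_algebra.
by exists b, A.
Qed.

Lemma measurable_cond x y :
  measurable_fun setT (fun w : env R d => cond w x y : measurableTypeR R).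
Proof.
apply: measurable_sum => i; apply: measurable_realfun.measurable_funD;
  by apply: measurable_realfun.measurable_funM => //; exact: measurable_omega.
Qed.

Lemma measurable_positive_edge x y : measurable [set w : env R d | positive_edge w x y].
Proof.
rewrite /positive_edge; case: (Defs.adjacent x y) => /=; last exact: measurable_cst_prop.
have := measurable_cond x y measurableT (measurable_itv `]0, +oo[).
rewrite setTI; congr measurable.
by apply/seteqP; split => w /=; rewrite in_itv/= andbT.
Qed.

Lemma measurable_strong_edge x y : measurable [set w : env R d | strong_edge alpha w x y].
Proof.
rewrite /strong_edge; case: (Defs.adjacent x y) => /=; last exact: measurable_cst_prop.
have := measurable_cond x y measurableT (measurable_itv `[alpha, +oo[).
rewrite setTI; congr measurable.
by apply/seteqP; split => w /=; rewrite in_itv/= andbT.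
Qed.

Lemma measurable_path (e : env R d -> rel (site d)) x s :
  (forall y z, measurable [set w | e w y z]) ->
  measurable [set w | path (e w) x s].
Proof.
move=> me; elim: s x => [|y s IH] x /=; first exact: measurable_cst_prop.
rewrite (_ : [set w | _] = [set w | e w x y /\ path (e w) y s]).
  by apply: measurableI; [exact: me|exact: IH].
by apply/seteqP; split => w /= /andP.
Qed.

Lemma measurable_cluster x y : measurable [set w : env R d | Defs.cluster w x y].
Proof.
rewrite (_ : [set w | _] = [set w : env R d | exists s : seq (site d),
    path (positive_edge w) x s /\ last x s = y]).
  apply: measurable_exists => s; apply: measurableI; last exact: measurable_cst_prop.
  apply: measurable_path; exact: measurable_positive_edge.
by apply/seteqP; split => w [s]; [exists s|case; exists s].
Qed.

(** A set is infinite when no finite list exhausts it, and finite lists of sites are countable in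
    number. *)
Lemma measurable_C_infty x : measurable [set w : env R d | C_infty w x].
Proof.
rewrite (_ : [set w | _] = [set w : env R d | forall l : seq (site d),
    exists y, Defs.cluster w x y /\ y \notin l]).
  apply: measurable_forall => l; apply: measurable_exists => y.
  apply: measurableI; first exact: measurable_cluster.
  exact: measurable_cst_prop.
apply/seteqP; split => w /=; last first.
  by move=> H /finite_seqP[l lE]; have [y []] := H l; rewrite lE /= => ->.
move=> inf l; apply: contrapT => /forallNP H; apply: inf.
apply: (sub_finite_set _ (finite_seq l)) => y cy /=.
by apply: contrapT => /negP yl; apply: (H y).
Qed.

Lemma measurable_C_alpha x : measurable [set w : env R d | C_alpha alpha w x].
Proof.
rewrite (_ : [set w | _] = [set w : env R d | forall n : nat, exists s : seq (site d),
    (size s = n /\ uniq (x :: s)) /\ path (strong_edge alpha w) x s]).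
  apply: measurable_forall => n; apply: measurable_exists => s.
  apply: measurableI; first exact: measurable_cst_prop.
  apply: measurable_path; exact: measurable_strong_edge.
have nb w y z : strong_edge alpha w y z -> z \in nbhd y.
  by move=> /andP[/adjacent_nbhd].
apply/seteqP; split => w /=.
  move=> /(koenig_ray _ (@nb w))H n; have [s [? ? ?]] := H n.
  by exists s.
move=> H; apply/(koenig_ray _ (@nb w)) => n; have [s [[? ?] ?]] := H n.
by exists s.
Qed.

Lemma measurable_hole x y : measurable [set w : env R d | hole alpha w x y].
Proof.
have mD z : measurable [set w : env R d | (C_infty w `\` C_alpha alpha w) z].
  apply: measurableI; first exact: measurable_C_infty.
  exact: measurableC (measurable_C_alpha z).
rewrite (_ : [set w | _] = [set w : env R d | (C_infty w `\` C_alpha alpha w) x] `&`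
  [set w : env R d | exists s : seq (site d),
    (path (positive_edge w) x s /\ last x s = y) /\
    forall z, z \in s -> (C_infty w `\` C_alpha alpha w) z]).
  apply: measurableI => //; apply: measurable_exists => s; apply: measurableI.
    apply: measurableI; last exact: measurable_cst_prop.
    apply: measurable_path; exact: measurable_positive_edge.
  by apply: measurable_forall => z; exact: measurable_imply.
by apply/seteqP; split => w [Dx [s H]]; split => //; exists s; [case: H|case: H => -[]].
Qed.

(** Distances are integers: if none reaches [n], the supremum is at most [n.-1]. *)
Lemma le_diamP (A : set (site d)) n : (0 < n)%N ->
  (n%:R%:E <= diam R A)%E <-> exists y z, (A y /\ A z) /\ (n <= linf_dist y z)%N.
Proof.
move=> n0; split => [H|[y [z [[Ay Az] nyz]]]]; last first.
  apply: (@le_trans _ _ (linf_dist y z)%:R%:E); first by rewrite lee_fin ler_nat.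
  by apply: ereal_sup_ubound; exists y, z.
apply: contrapT => nH.
have : (diam R A <= n.-1%:R%:E)%E.
  apply: ge_ereal_sup => _ [y [z [Ay Az ->]]]; rewrite lee_fin ler_nat.
  rewrite -ltnS prednK// ltnNge; apply/negP => nyz; apply: nH.
  by exists y, z.
move=> /(le_trans H); rewrite lee_fin ler_nat leqNgt prednK// leqnn.
by [].
Qed.

Lemma measurable_hole_diam x n : (0 < n)%N ->
  measurable [set w : env R d | C_infty w x /\ (n%:R%:E <= diam R (hole alpha w x))%E].
Proof.
move=> n0.
rewrite (_ : [set w | _] = [set w : env R d | C_infty w x] `&`
  [set w : env R d | exists y, exists z,
  (hole alpha w x y /\ hole alpha w x z) /\ (n <= linf_dist y z)%N]).
  apply: measurableI; first exact: measurable_C_infty.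
  apply: measurable_exists => y; apply: measurable_exists => z.
  apply: measurableI; last exact: measurable_cst_prop.
  by apply: measurableI; exact: measurable_hole.
by apply/seteqP; split => w [Cx /(le_diamP _ n0) H].
Qed.

(* Borel-Cantelli over the polynomially many sites of the box of size [L * n] *)
Lemma holes_small (P : probability (env R d) R) (C eta : R) (L : nat) : 0 < eta ->
  (0 < d)%N ->
  (forall (x : site d) (n : nat), (1 <= n)%N ->
     (P [set w | C_infty w x /\ (n%:R%:E <= diam R (hole alpha w x))%E]
      <= (C * expR (- (eta * n%:R)))%:E)%E) ->
  {ae P, forall w, exists n0 : nat, forall n, (n0 <= n)%N -> forall x,
     (linf_dist 0%R x <= L * n)%N -> C_infty w x ->
     forall y z, hole alpha w x y -> hole alpha w x z -> (linf_dist y z < n)%N}.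
Proof.
move=> eta0 d0 PC.
pose F x n := [set w : env R d | C_infty w x /\ (n%:R%:E <= diam R (hole alpha w x))%E].
pose E n := [set w : env R d | exists x, (linf_dist 0%R x <= L * n.+1)%N /\ F x n.+1 w].
have mE n : measurable (E n).
  apply: measurable_exists => x; apply: measurableI; first exact: measurable_cst_prop.
  exact: measurable_hole_diam.
(* Half of the exponential rate absorbs the number of sites, of order [n ^ d]; the other half gives
   a summable geometric sequence. *)
pose c := eta / 2; have c0 : 0 < c by rewrite divr_gt0.
pose C' : R := `|C| * ((2 * L).+1 ^ d)%N%:R * (d`!%:R / c ^+ d).
have C'0 : 0 <= C'.
  by rewrite /C' !mulr_ge0// invr_ge0 exprn_ge0// ltW.
have PE n : (P (E n) <= (C' * expR (- c) ^+ n.+1)%:E)%E.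
  apply: (@le_trans _ _ (\sum_(x <- box (0%R : site d) (L * n.+1)) P (F x n.+1))%E).
    apply: measure_le_sum => //; first by move=> x; exact: measurable_hole_diam.
    by move=> w [x [xn Fx]]; exists x => //; exact: mem_box.
  apply: (@le_trans _ _ (\sum_(x <- box (0%R : site d) (L * n.+1))
      (`|C| * expR (- (eta * n.+1%:R)))%:E)%E).
    apply: lee_sum => x _; apply: (le_trans (PC x n.+1 _)) => //.
    by rewrite lee_fin ler_wpM2r ?expR_ge0// ler_norm.
  rewrite sumEFin lee_fin big_const_seq count_predT iter_addr_0 size_box.
  have le1 : ((L * n.+1 + L * n.+1).+1 ^ d <= (2 * L).+1 ^ d * n.+1 ^ d)%N.
    by rewrite -expnMn leq_exp2r//; lia.
  have le2 : (n.+1%:R : R) ^+ d <= d`!%:R / c ^+ d * expR (c * n.+1%:R).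
    have f0 : 0 < (d`!%:R : R) by rewrite ltr0n fact_gt0.
    have cd0 : 0 < c ^+ d by rewrite exprn_gt0.
    rewrite mulrAC ler_pdivlMr// [leRHS]mulrC -ler_pdivrMr//.
    rewrite -exprMn [_ * c]mulrC.
    have := @expR_ge1Dxn R (c * n.+1%:R) d.-1; rewrite prednK// => H.
    apply: le_trans (H _); first by rewrite lerDr.
    by rewrite mulr_ge0// ltW.
  rewrite -[leLHS]mulr_natr; apply: (@le_trans _ _ (`|C| * expR (- (eta * n.+1%:R)) *
      (((2 * L).+1 ^ d)%N%:R * (n.+1%:R ^+ d)))).
    by rewrite ler_wpM2l ?mulr_ge0 ?expR_ge0// -natrX -natrM ler_nat.
  apply: (@le_trans _ _ (`|C| * expR (- (eta * n.+1%:R)) *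
      (((2 * L).+1 ^ d)%N%:R * (d`!%:R / c ^+ d * expR (c * n.+1%:R))))).
    by rewrite ler_wpM2l ?mulr_ge0 ?expR_ge0// ler_wpM2l.
  have -> : expR (- c) ^+ n.+1 = expR (- (eta * n.+1%:R)) * expR (c * n.+1%:R).
    rewrite -expRM_natl -expRD; congr expR; rewrite /c; by field.
  rewrite /C' le_eqVlt; apply/orP; left; apply/eqP; ring.
have rlt1 : `|expR (- c)| < 1.
  by rewrite ger0_norm ?expR_ge0// -[ltRHS]expR0 ltr_expR oppr_lt0.
have sumE : (\sum_(n <oo) P (E n) < +oo)%E.
  pose G : R ^nat := geometric (C' * expR (- c)) (expR (- c)).
  apply: (@le_lt_trans _ _ (limn (series G))%:E); last exact: ltry.
  apply: lime_le; first exact: is_cvg_nneseries.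
  apply: nearW => N; apply: (@le_trans _ _ (series G N)%:E).
    rewrite /series /= -sumEFin; apply: lee_sum => n _.
    by apply: (le_trans (PE n)); rewrite lee_fin /G /= exprS mulrA.
  rewrite lee_fin; apply: nondecreasing_cvgn_le; last exact: is_cvg_geometric_series.
  by apply: nondecreasing_series => k _ _; rewrite /G /=;
    do 2?[exact: expR_ge0|apply: mulr_ge0|apply: exprn_ge0].
have limE := lim_sup_set_cvg0 mE sumE.
exists (lim_sup_set E); split => //.
  by apply: bigcap_measurable => // k _; exact: bigcup_measurable.
move=> w /= nH; apply: contrapT => nlim; apply: nH.
have [k nk] : exists k, forall n, (k <= n)%N -> ~ E n w.
  apply: contrapT => /forallNP H; apply: nlim => k _.
  apply: contrapT => H'; apply: (H k) => n kn En; apply: H'.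
  by exists n.
exists k.+1 => -[//|n] kn x xn Cx y z hy hz; rewrite ltnNge; apply/negP => nyz.
apply: (nk n kn); exists x; split => //; split => //.
by apply/le_diamP => //; exists y, z.
Qed.

End HoleEvent.

(** * Union bounds over a countable type *)

Section DiscreteUnions.
Context (R : realType) dT (T : measurableType dT) (I : countType).

Lemma sum_pmap (mu : I -> \bar R) (Q : pred I) (f : nat -> option I) (r : seq nat) :
  (\sum_(n <- r) (if f n is Some i then if Q i then mu i else 0 else 0) =
   \sum_(i <- [seq i <- pmap f r | Q i]) mu i)%E.
Proof.
elim: r => [|n r IH]; first by rewrite !big_nil.
rewrite big_cons /=; case: (f n) => [i|] /=; last by rewrite add0e IH.
by case: ifP => Qi /=; rewrite ?add0e ?big_cons IH.
Qed.

(** The bound is checked on finite duplicate-free lists, where words can be reversed without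
    rearranging a series. *)
Lemma measure_union_le (mu : {measure set T -> \bar R}) (Q : pred I)
    (F : I -> set T) (G : set T) (c : \bar R) :
  measurable G -> (forall i, measurable (F i)) ->
  (forall t, G t -> exists i, Q i /\ F i t) ->
  (forall s, uniq s -> all Q s -> (\sum_(i <- s) mu (F i) <= c)%E) ->
  (mu G <= c)%E.
Proof.
move=> mG mF GF Hc.
pose F' n := if pickle_inv n is Some i then if Q i then F i else set0 else set0.
have mF' n : measurable (F' n).
  by rewrite /F'; case: pickle_inv => [i|//]; case: ifP.
apply: (@le_trans _ _ (\sum_(n <oo) mu (F' n))%E).
  apply: measure_sigma_subadditive => // t /GF[i [Qi Fi]]; exists (pickle i) => //.
  by rewrite /F' pickleK_inv Qi.
apply: lime_le; first exact: is_cvg_nneseries.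
apply: nearW => N; rewrite (eq_bigr (fun n => if pickle_inv n is Some i
    then if Q i then mu (F i) else 0 else 0)%E); last first.
  by move=> n _; rewrite /F'; case: pickle_inv => [i|//]; case: ifP.
rewrite sum_pmap; apply: Hc; last exact: filter_all.
by apply: filter_uniq; apply: (pmap_uniq (@pickle_invK I)); exact: iota_uniq.
Qed.

End DiscreteUnions.

(** * The kernel of the walk observed on a set, as a sum over excursions *)

Section ReturnKernel.
Context (R : realType) (S : countType) dT (T : measurableType dT).
Variables (Pr : S -> probability T R) (X : nat -> T -> S) (K : S -> S -> R).
Variables (A D : set S).
Hypotheses (AD : A `<=` D)
  (chain : forall x, D x -> markov_chain (Pr x) X K x)
  (K_sym : forall x y, K x y = K y x).

Definition word_weight x (p : seq S) y : R :=
  let z := nth x (x :: rcons p y) in \prod_(k < (size p).+1) K (z k) (z k.+1).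

Lemma word_weight_rev x p y : word_weight x p y = word_weight y (rev p) x.
Proof.
rewrite /word_weight size_rev.
rewrite -(big_mkord xpredT (fun k => K (nth x (x :: rcons p y) k)
  (nth x (x :: rcons p y) k.+1))).
rewrite big_nat_rev /= add0n big_mkord; apply: eq_bigr => k _.
have kp := ltn_ord k; have kp' : (k <= size p)%N by rewrite -ltnS.
rewrite K_sym subSS.
have rE : y :: rcons (rev p) x = rev (x :: rcons p y).
  by rewrite rev_cons rev_rcons.
rewrite rE !nth_rev /= ?size_rcons ?ltnS//; last exact: ltnW.
congr (K _ _).
- by rewrite subSS subSn//=; apply: set_nth_default; rewrite size_rcons ltnS leq_subr.
- rewrite -rev_cons nth_rev//= subSS -rcons_cons nth_rcons /= ltnS leq_subr.
  by apply: set_nth_default; rewrite /= ltnS leq_subr.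
Qed.

Let word_event x p y : set T :=
  [set t | forall k, (k <= (size p).+1)%N -> X k t = nth x (x :: rcons p y) k].

Let word_event_prob x p y : D x -> Pr x (word_event x p y) = (word_weight x p y)%:E.
Proof.
move=> /chain[_ ->]; congr EFin.
by rewrite /trajectory_weight /= eqxx mul1r.
Qed.

Let return_event y : set T := [set t | exists k, first_return A (X^~ t) k /\ X k t = y].

Let interior (p : seq S) : bool := all (fun z => `[< ~ A z >]) p.

(** The first return to [A] traces a word whose interior avoids [A]; this cuts the return event into
    countably many events of known probability. *)
Let return_words x y t : X 0%N t = x -> return_event y t ->
  A y /\ exists p, interior p /\ word_event x p y t.
Proof.
move=> X0 [k [[k1 Ak km] Xk]]; split; first by rewrite -Xk.
have sz : size (mkseq (fun i => X i.+1 t) k.-1) = k.-1 by rewrite size_mkseq.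
exists (mkseq (fun i => X i.+1 t) k.-1); split.
  apply/allP => z /mapP[i]; rewrite mem_iota add0n => /andP[_ ik] ->.
  by apply/asboolP/km; rewrite /= -ltn_predRL.
move=> [|j] /=; first by rewrite X0.
rewrite sz => jk; rewrite nth_rcons sz.
case: ltngtP => [jlt|jgt|je]; first by rewrite nth_mkseq.
  by move: jk; rewrite ltnS leqNgt jgt.
by rewrite je prednK.
Qed.

Let words_return x y p t : A y -> interior p -> word_event x p y t ->
  return_event y t /\ X 0%N t = x.
Proof.
move=> Ay /allP pA W; split; last by rewrite (W 0%N).
have Xl : X (size p).+1 t = y by rewrite W//= nth_rcons ltnn eqxx.
exists (size p).+1; split => //; split; rewrite ?Xl// => -[//|m] /andP[_ mp].
rewrite W ?(ltnW mp)//= nth_rcons -ltnS mp.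
by apply/asboolP/pA; rewrite mem_nth// -ltnS.
Qed.

Let measurable_word x p y : D x -> measurable (word_event x p y).
Proof.
move=> /chain[mX _]; apply: measurable_forall => k.
exact/measurable_imply/mX.
Qed.

Let measurable_return x y : D x -> measurable (return_event y).
Proof.
move=> /chain[mX _].
rewrite (_ : return_event y = [set t | exists k, (((1 <= k)%N /\ A (X k t)) /\
   forall m, (1 <= m < k)%N -> ~ A (X m t)) /\ X k t = y]).
  apply: measurable_exists => k; apply: measurableI; last exact: (mX k y).
  apply: measurableI.
    apply: measurableI; first exact: measurable_cst_prop.
    exact: measurable_preimage_discrete.
  apply: measurable_forall => m; apply: measurable_imply.
  by apply: measurableC; exact: measurable_preimage_discrete.
apply/seteqP; split => t [k]; first by move=> [[? ? ?] ?]; exists k.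
by move=> [[[? ?] ?] ?]; exists k.
Qed.

(** Words prescribe the starting site while the return event does not; the difference is a null
    set. *)
Let start_ae x : D x -> Pr x [set t | X 0%N t <> x] = 0%E.
Proof.
move=> Dx; have [mX law] := chain Dx.
have : Pr x [set t | X 0%N t = x] = 1%E.
  have := law 0%N (fun=> x); rewrite /trajectory_weight eqxx big_ord0 mul1r => <-.
  congr (Pr x _); apply/seteqP; split => t /=; last by move=> /(_ 0%N isT).
  by move=> Xx k; rewrite leqn0 => /eqP ->.
move=> P1; have -> : [set t | X 0%N t <> x] = ~` [set t | X 0%N t = x] by [].
by rewrite probability_setC ?P1 ?subee//; exact: mX.
Qed.

Let return_le x y (c : \bar R) : D x ->
  (forall s, uniq s -> all interior s -> A y ->
    (\sum_(p <- s) (word_weight x p y)%:E <= c)%E) ->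
  (0 <= c)%E -> (Pr x (return_event y) <= c)%E.
Proof.
move=> Dx H c0; have [mX _] := chain Dx.
pose B := [set t | X 0%N t = x].
have mB : measurable B by exact: mX.
apply: (@le_trans _ _ (Pr x (return_event y `&` B) + Pr x (~` B))%E).
  apply: (@le_trans _ _ (Pr x ((return_event y `&` B) `|` ~` B))).
    apply: le_measure; rewrite ?inE.
    - exact: (measurable_return y Dx).
    - apply: measurableU; last exact: measurableC.
      by apply: measurableI => //; exact: (measurable_return y Dx).
    - by move=> t Et; have [Bt|nBt] := pselect (B t); [left|right].
  apply: measureU2; last exact: measurableC.
  by apply: measurableI => //; exact: (measurable_return y Dx).
rewrite [X in (_ + X)%E](start_ae Dx) adde0.
have [Ay|nAy] := pselect (A y); last first.
  rewrite (_ : _ `&` _ = set0) ?measure0//; apply/seteqP; split => // t [Et Bt].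
  by have [] := return_words Bt Et.
apply: (@measure_union_le _ _ _ _ (Pr x) interior (fun p => word_event x p y)).
- by apply: measurableI => //; exact: (measurable_return y Dx).
- by move=> p; exact: measurable_word.
- by move=> t [Et Bt]; have [_] := return_words Bt Et.
- move=> s us sI; rewrite (eq_bigr (fun p => (word_weight x p y)%:E)).
    exact: H.
  by move=> p _; exact: word_event_prob.
Qed.

Let words_le x y s : D x -> A y -> uniq s -> all interior s ->
  (\sum_(p <- s) (word_weight x p y)%:E <= Pr x (return_event y))%E.
Proof.
move=> Dx Ay us /allP sI.
under eq_bigr do rewrite -word_event_prob//.
apply: sum_disjoint_le => //.
- by move=> p; exact: measurable_word.
- exact: (measurable_return y Dx).
(* At time [(size p).+1] the word [p] is at [y], in [A], while a longer word [q] is still at an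
   interior site, outside [A]. So distinct words give disjoint events. *)
- have aux p q t : interior q -> (size p < size q)%N ->
      word_event x p y t -> word_event x q y t -> False.
    move=> /allP qI pq Wp Wq.
    have := Wq (size p).+1; rewrite ltnS (ltnW pq) => /(_ isT).
    rewrite (Wp _ (leqnn _)) /= !nth_rcons ltnn eqxx pq => yE.
    by have /asboolP := qI _ (mem_nth x pq); rewrite -yE.
  move=> p q t ps qs Wp Wq; have [pI qI] := (sI _ ps, sI _ qs).
  have sz : size p = size q.
    by case: (ltngtP (size p) (size q)) => // lt; exfalso;
      [exact: (aux p q t)|exact: (aux q p t)].
  apply: (@eq_from_nth _ x) => // i ip.
  have ip1 : (i.+1 <= (size p).+1)%N by rewrite ltnS ltnW.
  have := Wp i.+1 ip1; have := Wq i.+1; rewrite -sz => /(_ ip1) ->.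
  by rewrite /= !nth_rcons -sz ip.
- by move=> p ps t W; have [] := words_return Ay (sI _ ps) W.
Qed.

Local Notation hat := (return_kernel Pr X A).

Lemma return_kernel_ge0 x y : 0 <= hat x y.
Proof. by apply: fine_ge0; exact: measure_ge0. Qed.

Lemma return_kernel_notin x y : ~ A y -> hat x y = 0.
Proof.
move=> nAy; rewrite /return_kernel (_ : [set t | _] = set0) ?measure0//.
by apply/seteqP; split => // t [k [[_ Ak _] Xk]]; rewrite -Xk in nAy.
Qed.

Let fin_return x y : D x -> Pr x (return_event y) \is a fin_num.
Proof. by move=> Dx; apply: fin_num_measure; exact: measurable_return Dx. Qed.

(** Reversal maps excursions from [x] to [y] onto those from [y] to [x] and preserves weights, as
    [K] is symmetric. *)
Lemma return_kernel_sym x y : A x -> A y -> hat x y = hat y x.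
Proof.
have le u v : A u -> A v -> hat u v <= hat v u.
  move=> Au Av; have [Du Dv] := (AD Au, AD Av).
  rewrite -lee_fin !fineK ?fin_return//; apply: return_le => // s us sI _.
  rewrite (eq_bigr (fun p => (word_weight v (rev p) u)%:E)); last first.
    by move=> p _; rewrite word_weight_rev.
  rewrite -(big_map rev xpredT (fun p => (word_weight v p u)%:E)).
  apply: words_le => //; first by rewrite map_inj_uniq//; exact: can_inj revK.
  apply/allP => _ /mapP[p ps ->]; rewrite /interior all_rev.
  by move/allP: sI; exact.
by move=> Ax Ay; apply/eqP; rewrite eq_le !le.
Qed.

Lemma return_kernel_word x y : A x -> hat x y != 0 ->
  exists p, (forall z, z \in p -> ~ A z) /\ word_weight x p y != 0.
Proof.
move=> Ax; apply: contra_neqP => /forallNP H.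
have Dx := AD Ax; apply/eqP; rewrite eq_le return_kernel_ge0 andbT.
rewrite -lee_fin fineK ?fin_return//; apply: return_le => // s us sI _.
rewrite big1_seq// => p /andP[_ ps]; have /allP/(_ p ps)/allP pI := sI.
apply/eqP; rewrite eqe; apply: contrapT => /negP w0; apply: (H p); split => //.
by move=> z /pI/asboolP.
Qed.

End ReturnKernel.

(** * A jump of the observed walk crosses a single hole *)

Section WalkKernel.
Variables (R : realType) (d : nat) (alpha : R) (w : env R d).
Hypothesis alpha_gt0 : 0 < alpha.
Implicit Types x y z : site d.

Lemma omega_ge0 b : 0 <= omega w b.
Proof.
have /andP[_] := Itv.P ((w : edge d -> conductance R) b : {i01 R}).
by rewrite in_itv /= mulr0z => /andP[].
Qed.

Lemma cond_ge0 x y : 0 <= cond w x y.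
Proof. by apply: sumr_ge0 => i _; rewrite addr_ge0 ?mulr_ge0 ?omega_ge0. Qed.

Lemma condC x y : cond w x y = cond w y x.
Proof. by apply: eq_bigr => i _; rewrite addrC. Qed.

Lemma cond_adjacent x y : cond w x y != 0 -> Defs.adjacent x y.
Proof.
apply: contra_neqT => /existsPn nxy; rewrite /cond big1// => i _.
by have := nxy i; rewrite negb_or => /andP[/negbTE -> /negbTE ->]; rewrite !mul0r addr0.
Qed.

Lemma positive_edgeC x y : positive_edge w x y = positive_edge w y x.
Proof. by rewrite /positive_edge adjacentC condC. Qed.

Lemma rw_kernel_sym x y : rw_kernel w x y = rw_kernel w y x.
Proof. by rewrite /rw_kernel eq_sym; case: eqP => [->|_]//; rewrite condC. Qed.

Lemma rw_kernel_step x y : rw_kernel w x y != 0 -> x = y \/ positive_edge w x y.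
Proof.
rewrite /rw_kernel; have [->|xy] := eqVneq x y; first by left.
move=> H.
have c0 : cond w x y != 0 by apply: contra_neq H => ->; rewrite mul0r.
right; rewrite /positive_edge cond_adjacent//= lt_def c0.
exact: cond_ge0.
Qed.

Lemma C_infty_edge x y : positive_edge w x y -> C_infty w x -> C_infty w y.
Proof.
move=> xy; apply: contra_not => /sub_finite_set; apply => u [s ps <-].
by exists (x :: s) => //=; rewrite positive_edgeC xy.
Qed.

Lemma C_alpha_infty x : C_alpha alpha w x -> C_infty w x.
Proof.
move=> [g [<- ginj ge]] fin.
have gc k : Defs.cluster w (g 0%N) (g k).
  elim: k => [|k [s ps ls]]; first by exists [::].
  exists (rcons s (g k.+1)); last by rewrite last_rcons.
  rewrite rcons_path ps ls /=; have /andP[adj str] := ge k.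
  by rewrite /positive_edge adj (lt_le_trans alpha_gt0).
apply: infinite_nat.
rewrite (_ : [set: nat] = g @^-1` Defs.cluster w (g 0%N)).
  by apply: finite_preimage => // i j _ _; exact: ginj.
by apply/seteqP; split => k // _; exact: gc.
Qed.

(** The interior sites of a word of nonzero weight all lie in the hole of the first one, so the
    first and last are less than [n] apart. The steps into and out of the hole add 1 each, which
    gives [n.+1]. *)
Lemma word_weight_range x p y n : C_alpha alpha w x -> C_alpha alpha w y ->
  (forall z, z \in p -> ~ C_alpha alpha w z) ->
  word_weight (rw_kernel w) x p y != 0 ->
  (forall z, (linf_dist x z <= 1)%N -> C_infty w z ->
     forall u v, hole alpha w z u -> hole alpha w z v -> (linf_dist u v < n)%N) ->
  (linf_dist x y <= n.+1)%N.
Proof.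
move=> Ax Ay pA /prodf_neq0 Kn Hn.
have step k : (k < (size p).+1)%N ->
    let z := nth x (x :: rcons p y) in z k = z k.+1 \/ positive_edge w (z k) (z k.+1).
  by move=> kp; apply: rw_kernel_step; exact: (Kn (Ordinal kp)).
case: p pA {Kn} step => [|z p] pA step.
  have /= [<-|/andP[/adjacent_linf xy _]] := step 0%N isT.
    by apply/linf_dist_leP => i; rewrite subrr.
  exact: leq_trans xy _.
have nzA : ~ C_alpha alpha w z by apply: pA; rewrite mem_head.
have /= [xz|xz] := step 0%N isT; first by rewrite xz in Ax.
have Cz : C_infty w z by apply: C_infty_edge xz _; exact: C_alpha_infty.
(* By induction along the word: a lazy step keeps the site, a genuine one prolongs the connecting
   path inside the hole. *)
have hz j : (j < (size p).+1)%N ->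
    C_infty w (nth x (z :: p) j) /\ hole alpha w z (nth x (z :: p) j).
  elim: j => [_|j IH jp] /=; first by split => //; split => //; exists [::].
  have [Cj [Dz [s [ps ls sD]]]] := IH (ltnW jp).
  have := step j.+1 (ltnW jp); rewrite /= -/(nth x (rcons (z :: p) y)).
  have -> : nth x (rcons (z :: p) y) j = nth x (z :: p) j.
    by rewrite nth_rcons /= (ltnW jp).
  have -> : nth x (rcons p y) j = nth x p j by rewrite nth_rcons -ltnS jp.
  case=> [<-|e]; first by split => //; split => //; exists s.
  have Cj1 := C_infty_edge e Cj; split => //; split => //.
  exists (rcons s (nth x p j)); split; last 2 first.
  - by rewrite last_rcons.
  - move=> u; rewrite mem_rcons inE => /predU1P[->|/sD//]; split => //.
    by apply: pA; rewrite inE mem_nth ?orbT.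
  - by rewrite rcons_path ps ls.
have zu : (linf_dist z (nth x (z :: p) (size p)) < n)%N.
  apply: (Hn z) => //; first by apply: adjacent_linf; case/andP: xz.
    by have [] := hz 0%N isT.
  by have [] := hz (size p) (ltnSn _).
have := step (size p).+1 (ltnSn _); rewrite /= -/(nth x (rcons (z :: p) y)).
have -> : nth x (rcons (z :: p) y) (size p) = nth x (z :: p) (size p).
  by rewrite nth_rcons /= ltnSn.
have -> : nth x (rcons p y) (size p) = y by rewrite nth_rcons ltnn eqxx.
case=> [uy|/andP[/adjacent_linf uy _]].
  by exfalso; apply: (pA (nth x (z :: p) (size p))); [exact: mem_nth|rewrite uy].
have xz1 : (linf_dist x z <= 1)%N by apply: adjacent_linf; case/andP: xz.
have := linf_dist_triangle z x y.
have := linf_dist_triangle (nth x (z :: p) (size p)) z y.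
lia.
Qed.

End WalkKernel.

(** * Generators of kernels with finite support *)

Lemma esum_seq (R : realType) (S : choiceType) (A : set S) (s : seq S)
    (a : S -> \bar R) : uniq s -> (forall y, (0 <= a y)%E) ->
  (forall y, y \notin s -> a y = 0%E) -> (forall y, ~ A y -> a y = 0%E) ->
  (\esum_(y in A) a y = \sum_(y <- s) a y)%E.
Proof.
move=> us a0 as0 aA0.
rewrite esum_mkcond.
rewrite (_ : (fun i => _) = fun i => if i \in [set` s] then a i else 0%E); last first.
  apply/funext => i; case: ifPn => iA; case: ifPn => is_ //.
    by apply: as0; apply: contraNN is_ => h; rewrite inE.
  by apply/esym/aA0 => /mem_set; exact/negP.
rewrite -esum_mkcond esum_fset//; first by rewrite -fsbig_seq.
Qed.

(** On a finite support the sums of positive and negative parts are finite, so their difference is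
    the ordinary sum. *)
Lemma generator_eq0 (R : realType) (S : choiceType) (K : S -> S -> R) (A : set S)
    (f : S -> R) x (s : seq S) : uniq s ->
  (forall y, y \notin s -> K x y = 0) -> (forall y, ~ A y -> K x y = 0) ->
  generator K A f x = 0%E -> \sum_(y <- s) K x y * (f y - f x) = 0.
Proof.
move=> us Ks KA; rewrite /generator.
set g := fun y => (K x y * (f y - f x))%:E.
have g0 y : K x y = 0 -> g y = 0%E by rewrite /g => ->; rewrite mul0r.
have gp0 y : K x y = 0 -> (g^\+ y)%E = 0%E.
  by move=> /g0 gy; rewrite funeposE gy maxxx.
have gn0 y : K x y = 0 -> (g^\- y)%E = 0%E.
  by move=> /g0 gy; rewrite funenegE gy oppe0 maxxx.
rewrite (esum_seq us)//; last 2 first.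
- by move=> y /Ks; exact: gp0.
- by move=> y /KA; exact: gp0.
rewrite (esum_seq us)//; last 2 first.
- by move=> y /Ks; exact: gn0.
- by move=> y /KA; exact: gn0.
pose h y := K x y * (f y - f x).
rewrite (eq_bigr (fun y => (Num.max (h y) 0)%:E)); last first.
  by move=> y _; rewrite funeposE /g EFin_max.
rewrite [X in (_ - X)%E](eq_bigr (fun y => (Num.max (- h y) 0)%:E)); last first.
  by move=> y _; rewrite funenegE /g EFin_max EFinN.
rewrite !sumEFin -EFinB -sumrB => -[H]; rewrite -[RHS]H; apply: eq_bigr => y _.
rewrite -/(h y); case: (leP (h y) 0) => h0.
  by rewrite max_l ?oppr_ge0// sub0r opprK.
by rewrite max_r ?subr0// oppr_le0 ltW.
Qed.

(** * Monotonicity and linearity of the heat semigroup on bounded functions *)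

Section HeatLinear.
Variables (R : realType) (S : eqType) (K : S -> S -> R) (supp : S -> seq S).
Hypotheses (K_ge0 : forall x y, 0 <= K x y)
  (K_sum1 : forall x, \sum_(y <- supp x) K x y = 1).
Local Notation heat := (heat K supp).

Definition bounded_fun_on (f : S -> R) := exists C, forall y, `|f y| <= C.

Lemma bounded_avgn_norm f x : bounded_fun_on f ->
  bounded_seq (fun k => avgn K supp k f x).
Proof.
move=> [C fC]; apply: (@bounded_avgn _ _ _ _ K_ge0 K_sum1 _ (- C) C) => y.
by rewrite -ler_norml.
Qed.

Lemma le_heat t f g x : 0 <= t -> bounded_fun_on f -> bounded_fun_on g ->
  (forall y, f y <= g y) -> heat t f x <= heat t g x.
Proof.
move=> t0 bf bg fg; apply: le_poisson_mean => //; try exact: bounded_avgn_norm.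
by move=> k; apply: le_avgn.
Qed.

Lemma heat_const t c x : heat t (fun=> c) x = c.
Proof.
rewrite /heat -[RHS](poisson_mean_const t c); congr poisson_mean.
by apply/funext => k; rewrite avgn_const.
Qed.

Lemma heatD t f g x : bounded_fun_on f -> bounded_fun_on g ->
  heat t (fun y => f y + g y) x = heat t f x + heat t g x.
Proof.
move=> bf bg; rewrite /heat -poisson_meanD; [|exact: bounded_avgn_norm..].
by congr poisson_mean; apply/funext => k; rewrite avgnD.
Qed.

Lemma bounded_delta y : bounded_fun_on (delta R y).
Proof.
by exists 1 => z; rewrite /delta; case: eqP; rewrite ?normr1 ?normr0.
Qed.

Lemma heat_sum_delta t (L : seq S) (c : S -> R) x :
  heat t (fun y => \sum_(v <- L) c v * delta R v y) x =
    \sum_(v <- L) c v * heat t (delta R v) x /\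
  bounded_fun_on (fun y => \sum_(v <- L) c v * delta R v y).
Proof.
elim: L => [|v L [IH bIH]].
  under eq_fun do rewrite big_nil.
  by rewrite heat_const big_nil; split => //; exists 0 => y; rewrite normr0.
have bv : bounded_fun_on (fun y => c v * delta R v y).
  exists (`|c v| * 1) => y; rewrite normrM ler_wpM2l//.
  by rewrite /delta; case: eqP; rewrite ?normr1 ?normr0.
have bvL : bounded_fun_on (fun y => c v * delta R v y + \sum_(v <- L) c v * delta R v y).
  have [C1 H1] := bv; have [C2 H2] := bIH; exists (C1 + C2) => y.
  by rewrite (le_trans (ler_normD _ _))// lerD.
under eq_fun do rewrite big_cons.
split => //; rewrite heatD// IH big_cons; congr (_ + _).
rewrite /heat -poisson_meanZ; last exact/bounded_avgn_norm/bounded_delta.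
by congr poisson_mean; apply/funext => k; rewrite avgnZ.
Qed.

End HeatLinear.

(** * Maxima over balls *)

Section MaxBall.
Variables (R : realType) (d : nat) (A : set (site d)) (psi : site d -> 'rV[R]_d).
Local Notation pnorm x := (enorm (embed R x)).

Definition ball_seq n : seq (site d) :=
  [seq y <- undup (box (0%R : site d) n) | `[< in_ball R A n y >]].

Lemma mem_ball_seq n y : (y \in ball_seq n) = `[< in_ball R A n y >].
Proof.
rewrite mem_filter mem_undup andbC; apply: andb_idl => /asboolP[_ yn].
by apply: mem_box; apply: (@linf_le_enorm d R); rewrite subr0.
Qed.

Lemma ball_seq_uniq n : uniq (ball_seq n).
Proof. by rewrite filter_uniq ?undup_uniq. Qed.

Lemma in_ballE n : in_ball R A n = [set` ball_seq n].
Proof.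
apply/seteqP; split => y /=; first by move=> ?; rewrite mem_ball_seq; apply/asboolP.
by rewrite mem_ball_seq => /asboolP.
Qed.

Definition max_psi n : R := \big[Num.max/0]_(x <- ball_seq n) enorm (psi x).

Lemma max_psi_ge0 n : 0 <= max_psi n.
Proof. exact: bigmax_ge_id. Qed.

Lemma le_max_psi n x : in_ball R A n x -> enorm (psi x) <= max_psi n.
Proof.
move=> /asboolP xn; have xs : x \in ball_seq n by rewrite mem_ball_seq.
exact: (le_bigmax_seq 0 x xpredT (fun y => enorm (psi y)) xs isT).
Qed.

Lemma max_psi_le n c : 0 <= c -> (forall x, in_ball R A n x -> enorm (psi x) <= c) ->
  max_psi n <= c.
Proof.
move=> c0 H; rewrite /max_psi big_seq; apply: bigmax_le => // x.
by rewrite mem_ball_seq => /asboolP; exact: H.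
Qed.

End MaxBall.

(** * The recursive inequality for the maxima and its iteration *)

Section Sublinearity.
Variables (R : realType) (d : nat) (A : set (site d)) (psi : site d -> 'rV[R]_d).
Variables (K : site d -> site d -> R) (supp : site d -> seq (site d)).
Variables (b : nat -> R) (kap : R).
Local Notation pnorm x := (enorm (embed R x)).
Local Notation heat := (heat K supp).
Hypotheses (supp_uniq : forall x, uniq (supp x))
  (K_supp : forall x y, y \notin supp x -> K x y = 0)
  (K_ge0 : forall x y, 0 <= K x y)
  (K_sum1 : forall x, \sum_(y <- supp x) K x y = 1)
  (K_sym : forall x y, K x y = K y x).
Hypothesis K_range : exists n1, forall n, (n1 <= n)%N -> forall x y, A x ->
  pnorm x <= (3 * n)%:R -> K x y != 0 -> A y /\ pnorm (y - x) <= n%:R.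
Hypothesis harmonic : forall x, A x -> forall i,
  avg K supp (fun y => (embed R y + psi y) 0 i) x = (embed R x + psi x) 0 i.
Hypothesis average : forall eps : R, 0 < eps ->
  (fun n : nat => (n%:R ^+ d)^-1 *
     (size [seq y <- ball_seq R A n | eps * n%:R <= enorm (psi y)])%:R)
  @ \oo --> (0 : R).
Hypotheses (b_gt0 : forall n, (1 <= n)%N -> 0 < b n)
  (b_small : (fun n : nat => b n / n%:R ^+ 2) @ \oo --> (0 : R)).
Hypothesis kap_ge0 : 0 <= kap.
Hypothesis far_le : forall n x (s r : R), (1 <= n)%N -> in_ball R A n x -> b n <= s ->
  0 < r -> heat s (fun y => (r <= pnorm (y - x))%R%:R) x <= kap / r * Num.sqrt s.
Hypothesis displacement_le : forall n x (s : R) (L : seq (site d)), (1 <= n)%N ->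
  in_ball R A n x -> b n <= s -> uniq L ->
  \sum_(v <- L) pnorm (v - x) * heat s (delta R v) x <= kap * Num.sqrt s.
Hypothesis return_le : forall n x (s : R), (1 <= n)%N -> in_ball R A n x -> b n <= s ->
  s `^ (d%:R / 2) * heat s (delta R x) x <= kap.
Local Notation M := (max_psi A psi).

(** At time [t = (q n)^2] the four terms are the displacement, the sites where [psi] is below the
    threshold, the bad sites weighted by the heat kernel, and the exits. *)
Lemma psi_ball_le n z (q eps : R) : (1 <= n)%N -> 0 < q -> kap * q <= 1 / 3 ->
  (forall x y, A x -> pnorm x <= (3 * n)%:R -> K x y != 0 ->
     A y /\ pnorm (y - x) <= n%:R) ->
  b (4 * n)%N <= (q * n%:R) ^+ 2 -> 0 <= eps ->
  in_ball R A n z -> 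
  enorm (psi z) <= kap * (q * n%:R) + eps * n%:R +
    M (4 * n)%N * ((size [seq y <- ball_seq R A (4 * n)%N |
        eps * n%:R <= enorm (psi y)])%:R * (kap / (q * n%:R) ^+ d)) +
    (M (4 * n)%N + 3 * n%:R) * (3 * (kap * q)) * expR 1.
Proof.
move=> n1 q0 kq Krange bn eps0 [Az zn].
have n0 : 0 < n%:R :> R by rewrite ltr0n.
have n41 : (1 <= 4 * n)%N by rewrite muln_gt0.
set t := (q * n%:R) ^+ 2; have qn0 : 0 < q * n%:R by rewrite mulr_gt0.
have t0 : 0 < t by rewrite exprn_gt0.
have sqt : Num.sqrt t = q * n%:R by rewrite sqrtr_sqr gtr0_norm.
set M4 := M (4 * n)%N; have M40 : 0 <= M4 by exact: max_psi_ge0.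
have [pz0|pz0] := eqVneq (enorm (psi z)) 0.
  rewrite pz0; repeat first [apply: addr_ge0|apply: mulr_ge0];
  by rewrite ?invr_ge0 ?exprn_ge0 ?expR_ge0 ?(ltW qn0) ?(ltW q0) ?ler0n ?kap_ge0.
have pz : 0 < enorm (psi z) by rewrite lt_def pz0 enorm_ge0.
(* Radius [2 * n] around [z] keeps [B] in the ball of radius [3 * n], where jumps are at most [n].
   It also puts exit sites at distance between [2 * n] and [3 * n] from [z]. *)
pose B y := `[< A y /\ pnorm (y - z) < (2 * n)%:R >].
have Bz : B z.
  apply/asboolP; split => //; rewrite subrr /embed map_mx0.
  rewrite (_ : enorm 0 = 0); first by rewrite ltr0n muln_gt0.
  by rewrite /enorm big1 ?sqrtr0// => i _; rewrite mxE expr0n.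
have tri (x y u : site d) : pnorm (y - x) <= pnorm (y - u) + pnorm (u - x).
  by apply: le_trans (ler_enormD _ _); rewrite -embedD subrKA.
have tri0 (x y : site d) : pnorm y <= pnorm (y - x) + pnorm x.
  by apply: le_trans (ler_enormD _ _); rewrite -embedD subrK.
have nz : (3 * n)%:R = 3 * n%:R :> R by rewrite natrM.
have nz2 : (2 * n)%:R = 2 * n%:R :> R by rewrite natrM.
have nz4 : (4 * n)%N%:R = 4 * n%:R :> R by rewrite natrM.
have B3 x : B x -> A x /\ pnorm x <= (3 * n)%:R.
  move=> /asboolP[Ax xz]; split => //.
  by have := tri0 z x; move: xz zn; rewrite nz nz2; lra.
have domP x : stop_dom K B x -> A x /\ pnorm (x - z) <= 3 * n%:R.
  case=> [/[dup] /B3[Ax _] /asboolP[_]|[u /[dup] Bu /B3[Au un] Kux]].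
    by rewrite nz2; split => //; lra.
  have [Ax xu] := Krange _ _ Au un Kux; split => //.
  by have := tri z x u; move/asboolP: Bu => [_]; rewrite nz2; lra.
have ball4 x : A x -> pnorm (x - z) <= 3 * n%:R -> in_ball R A (4 * n)%N x.
  by move=> Ax xz; split => //; have := tri0 z x; rewrite nz4; lra.
have z4 : in_ball R A (4 * n)%N z by split => //; rewrite nz4; lra.
(* Projecting [phi - z] on the direction of [psi z] gives a scalar harmonic function whose value at
   [z] is the norm to be bounded. *)
pose f y := dotp (psi z) (embed R y + psi y - embed R z) / enorm (psi z).
have fz : f z = enorm (psi z).
  by rewrite /f addrAC subrr add0r -sqr_enorm expr2 mulfK.
have f_le y : f y <= pnorm (y - z) + enorm (psi y).
  rewrite /f ler_pdivrMr// addrAC -embedB dotpDr mulrC mulrDr.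
  by apply: lerD; exact: dotp_le.
have f_harm x : B x -> avg K supp f x = f x.
  move=> /B3[Ax _]; rewrite /f /avg.
  rewrite (eq_bigr (fun y => \sum_(i < d) (psi z 0 i / enorm (psi z)) *
     (K x y * (embed R y + psi y) 0 i - K x y * embed R z 0 i))); last first.
    move=> y _; rewrite /dotp mulr_suml mulr_sumr; apply: eq_bigr => i _.
    rewrite [X in psi z 0 i * X]mxE [(- embed R z) 0 i]mxE; ring.
  rewrite exchange_big/= /dotp mulr_suml; apply: eq_bigr => i _.
  rewrite -mulr_sumr sumrB -mulr_suml K_sum1 mul1r.
  rewrite -/(avg K supp (fun y => (embed R y + psi y) 0 i) x).
  rewrite harmonic// [X in _ = psi z 0 i * X / _]mxE [(- embed R z) 0 i]mxE; ring.
pose far y : R := (n%:R <= pnorm (y - z))%R%:R.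
have far01 y : 0 <= far y <= 1 by rewrite /far ler0n lern1 leq_b1.
have far01' y : 0 <= 1 - far y <= 1.
  by have /andP[? ?] := far01 y; rewrite subr_ge0 lerBlDr lerDl; apply/andP.
pose V := exit_weight K supp (b (4 * n)%N) (t / (1 + t)) far.
have b0 : 0 <= b (4 * n)%N by rewrite ltW// b_gt0.
have t10 : 0 < 1 + t by rewrite ltr_pwDl// ltW.
have r1 : t / (1 + t) < 1 by rewrite ltr_pdivrMr// mul1r ltrDr.
have r0 : 0 < t / (1 + t) by rewrite divr_gt0.
have kn0 : 0 <= kap / n%:R by rewrite divr_ge0// ltW.
have kqn : kap / n%:R * Num.sqrt t = kap * q.
  by rewrite sqt; field; rewrite gt_eqF.
have Vz : V z <= 3 / 2 * (kap * q).
  rewrite -kqn; apply: exit_weight_le => // s bs.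
  exact: (far_le n41 z4 bs n0).
(* An exit site is at distance at least [2 * n] from [z]; to come within [n] of [z] the walk must
   move more than [n]. So [1 - V x <= 3 / 2 * (kap * q)], which [kap * q <= 1 / 3] makes at most
   1/2. *)
have Vexit x : stop_dom K B x -> ~~ B x -> 1 <= 2 * V x.
  move=> /domP[Ax xz] /asboolP nBx.
  have xz2 : 2 * n%:R <= pnorm (x - z).
    by rewrite leNgt -nz2; apply/negP => h; apply: nBx.
  have : 1 - V x <= 3 / 2 * (kap / n%:R * Num.sqrt t).
    rewrite /V [X in 1 - X]exit_weightC//; last exact: ltW.
    rewrite opprB addrC subrK; apply: exit_weight_le => // s bs.
    have s0 : 0 <= s by exact: le_trans bs.
    apply: le_trans (far_le n41 (ball4 x Ax xz) bs n0).
    apply: le_heat => //.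
    - by exists 1 => y; have /andP[h1 h2] := far01' y; rewrite ger0_norm.
    - by exists 1 => y; rewrite ger0_norm ?ler0n// lern1 leq_b1.
    - move=> y; have yx : pnorm (x - y) = pnorm (y - x).
        by rewrite !embedB -enormN opprB.
      have := tri z x y; rewrite yx /far.
      have [h|h] := leP n%:R (pnorm (y - z)); first by rewrite subrr ler0n.
      move=> txy; have -> : n%:R <= pnorm (y - x) by lra.
      by rewrite subr0.
  by rewrite kqn; lra.
pose F y := if B y then pnorm (y - z) + enorm (psi y) else 0.
have psiB y : B y -> enorm (psi y) <= M4.
  move=> /asboolP[Ay yz]; apply: le_max_psi; apply: ball4 => //.
  by move: yz; rewrite nz2; lra.
have F_bound y : 0 <= F y <= 2 * n%:R + M4.
  rewrite /F; case: ifPn => [By|_]; last by rewrite lexx addr_ge0// mulr_ge0// ltW.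
  rewrite addr_ge0 ?enorm_ge0//= lerD ?psiB//.
  by move/asboolP: By => [_]; rewrite nz2 => /ltW.
have key : f z <= heat t F z + (M4 + 3 * n%:R) * (2 * V z) * expR (t / (t / (1 + t)) - t).
  have K0 := harmonic_le_heat K_ge0 K_sum1 (B := B) (r := t / (1 + t))
    (t := t) (M := M4 + 3 * n%:R) (C := 2 * n%:R + M4) (f := f) (F := F) (V := V) (z := z).
  apply: K0 => //.
  - by rewrite r0 ltW.
  - exact: ltW.
  - by rewrite addr_ge0// mulr_ge0// ltW.
  - by move=> x _; apply: exit_weight_ge0 => //; exact: ltW.
  - by move=> x _; apply: exit_weight_superharmonic => //; exact: ltW.
  - by move=> x nBx; rewrite /F (negbTE nBx).
  - by move=> x Bx; rewrite /F Bx.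
  - move=> x /domP[Ax xz] _; apply: (le_trans (f_le x)).
    by rewrite addrC lerD// le_max_psi//; exact: ball4.
have tE : t / (t / (1 + t)) - t = 1 by field; rewrite !gt_eqF.
move: key; rewrite fz tE => key; apply: (le_trans key).
set O := [seq y <- _ | _]; pose L := [seq y <- ball_seq R A (4 * n)%N | B y].
have memB y : B y -> y \in ball_seq R A (4 * n)%N.
  move=> /asboolP[Ay yz]; rewrite mem_ball_seq; apply/asboolP/ball4 => //.
  by move: yz; rewrite nz2; lra.
pose F1 y := \sum_(v <- L) pnorm (v - z) * delta R v y.
pose F3 y := \sum_(v <- O) M4 * delta R v y.
have [h1 bF1] := heat_sum_delta K_ge0 K_sum1 t L (fun v => pnorm (v - z)) z.
have [h3 bF3] := heat_sum_delta K_ge0 K_sum1 t O (fun=> M4) z.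
have sum_delta (c : site d -> R) (s : seq (site d)) y : uniq s -> y \in s ->
    \sum_(v <- s) c v * delta R v y = c y.
  move=> us ys; rewrite (bigD1_seq y)//= /delta eqxx mulr1 big1 ?addr0// => v vy.
  by rewrite eq_sym (negbTE vy) mulr0.
have F3_ge0 y : 0 <= F3 y.
  by apply: sumr_ge0 => v _; rewrite mulr_ge0 ?(andP (delta_between _ _ _)).1.
have F1_ge0 y : 0 <= F1 y.
  by apply: sumr_ge0 => v _; rewrite mulr_ge0 ?enorm_ge0 ?(andP (delta_between _ _ _)).1.
have uO : uniq O by rewrite filter_uniq ?ball_seq_uniq.
have uL : uniq L by rewrite filter_uniq ?ball_seq_uniq.
(* [F] is split into the displacement on [L], the threshold [eps * n], and the crude bound [M4] on
   the bad sites [O]. *)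
have FF y : F y <= F1 y + (eps * n%:R + F3 y).
  rewrite /F; case: ifPn => [By|_]; last first.
    by rewrite !addr_ge0// mulr_ge0// ltW.
  have -> : F1 y = pnorm (y - z) by rewrite /F1 sum_delta// mem_filter By memB.
  rewrite lerD2l; have [ey|ey] := leP (eps * n%:R) (enorm (psi y)); last first.
    by rewrite (le_trans (ltW ey))// lerDl.
  have -> : F3 y = M4 by rewrite /F3 sum_delta// mem_filter ey memB.
  by rewrite (le_trans (psiB y By))// lerDr mulr_ge0// ltW.
have bc : bounded_fun_on (fun y : site d => eps * n%:R) by exists `|eps * n%:R|.
have bc3 : bounded_fun_on (fun y => eps * n%:R + F3 y).
  have [C2 H2] := bF3; exists (`|eps * n%:R| + C2) => y.
  by apply: (le_trans (ler_normD _ _)); rewrite lerD2l; exact: H2.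
have heatF : heat t F z <= kap * (q * n%:R) + (eps * n%:R +
    M4 * ((size O)%:R * (kap / (q * n%:R) ^+ d))).
  apply: (@le_trans _ _ (heat t (fun y => F1 y + (eps * n%:R + F3 y)) z)).
    apply: le_heat => //; first exact: ltW.
      by exists (2 * n%:R + M4) => y; have /andP[? ?] := F_bound y; rewrite ger0_norm.
    have [C1 H1] := bF1; have [C2 H2] := bc3; exists (C1 + C2) => y.
    by apply: (le_trans (ler_normD _ _)); apply: lerD; [exact: H1|exact: H2].
  rewrite heatD// heatD// heat_const// h1 h3; apply: lerD.
    by rewrite -sqt; exact: (displacement_le n41).
  rewrite lerD2l -mulr_sumr ler_wpM2l//.
  have ret y : in_ball R A (4 * n)%N y -> heat t (delta R y) y <= kap / (q * n%:R) ^+ d.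
    move=> y4; rewrite ler_pdivlMr ?exprn_gt0// mulrC.
    have := return_le n41 y4 bn; congr (_ * _ <= _).
    by rewrite -!powR_mulrn ?(ltW qn0)// -powRrM; congr (_ `^ _); field.
  have <- : \sum_(v <- O) kap / (q * n%:R) ^+ d = (size O)%:R * (kap / (q * n%:R) ^+ d).
    by rewrite big_const_seq count_predT iter_addr_0 mulr_natl.
  rewrite big_seq_cond [leRHS]big_seq_cond; apply: ler_sum => v /andP[+ _].
  rewrite mem_filter => /andP[_]; rewrite mem_ball_seq => /asboolP v4.
  (* Both endpoints lie in the ball of radius [4 * n], so the return bound applies to the two
     diagonal terms. *)
  apply: (le_trans (heat_delta_le supp_uniq K_supp K_ge0 K_sum1 K_sym z v (ltW t0))).
  have := ret z z4; have := ret v v4; lra.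
have e2 : (M4 + 3 * n%:R) * (2 * V z) * expR 1 <= (M4 + 3 * n%:R) * (3 * (kap * q)) * expR 1.
  rewrite ler_wpM2r ?expR_ge0// ler_wpM2l//; first by rewrite addr_ge0// mulr_ge0// ltW.
  lra.
lra.
Qed.

Lemma max_psi_step (c del : R) : 0 < c -> 0 < del ->
  exists n0 : nat, forall n, (n0 <= n)%N ->
    M n <= c * n%:R + del * M (4 * n)%N.
Proof.
move=> c0 del0; set e := expR (1 : R); have e0 : 0 < e by exact: expR_gt0.
(* [x0] bounds [kap * q]. Its three entries serve the assumption of [psi_ball_le], the terms in [n]
   ([kap * q] from the displacement and [9 * e * (kap * q)] from the exits), and the exit term in
   [M (4 * n)]. *)
pose x0 : R := Num.min (1 / 3) (Num.min (c / (4 * (1 + 9 * e))) (del / (6 * e))).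
have e9 : 0 < 1 + 9 * e by lra.
have x00 : 0 < x0.
  by rewrite !lt_min !divr_gt0// ?mulr_gt0.
have x03 : x0 <= 1 / 3 by rewrite /x0 ge_min lexx.
have x0c : x0 * (1 + 9 * e) <= c / 4.
  apply: (@le_trans _ _ (c / (4 * (1 + 9 * e)) * (1 + 9 * e))).
    by rewrite ler_wpM2r ?(ltW e9)// /x0 !ge_min lexx orbT.
  by rewrite le_eqVlt; apply/orP; left; apply/eqP; field; rewrite gt_eqF.
have x0d : 3 * x0 * e <= del / 2.
  apply: (@le_trans _ _ (3 * (del / (6 * e)) * e)).
    by rewrite ler_wpM2r ?(ltW e0)// ler_wpM2l// /x0 !ge_min lexx !orbT.
  by rewrite le_eqVlt; apply/orP; left; apply/eqP; field; rewrite gt_eqF.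
have k1 : 0 < kap + 1 by rewrite ltr_wpDl.
pose q := x0 / (kap + 1); have q0 : 0 < q by rewrite divr_gt0.
have kq : kap * q <= x0.
  rewrite /q mulrCA -[leRHS]mulr1 ler_wpM2l ?(ltW x00)//.
  by rewrite ler_pdivrMr// mul1r lerDl.
have kq0 : 0 <= kap * q by rewrite mulr_ge0// ltW.
(* Rescaling to the radius [4 * n]: [kap / (q * n) ^+ d] is [g / (4 * n) ^+ d]. *)
pose g := kap * (4 / q) ^+ d.
have g0 : 0 <= g.
  by rewrite /g mulr_ge0// exprn_ge0// divr_ge0// ltW.
pose be := del / 2 / (g + 1); have be0 : 0 < be by rewrite !divr_gt0// ltr_wpDl.
(* At radius [4 * n] the threshold [c / 4 * n] reads [c / 16 * (4 * n)]; likewise [(q * n) ^+ 2] is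
   [q ^+ 2 / 16] times [(4 * n) ^+ 2]. *)
have ep0 : 0 < c / 4 / 4 by rewrite !divr_gt0.
have /cvgrPdist_lt/(_ be be0)[N1 _ HN1] := average ep0.
have /cvgrPdist_lt/(_ (q ^+ 2 / 16))[|N2 _ HN2] := b_small.
  by rewrite divr_gt0 ?exprn_gt0.
have [N3 HN3] := K_range.
exists (N1 + N2 + N3).+1 => n nN.
have n1 : (1 <= n)%N by apply: leq_trans nN.
have n0 : 0 < n%:R :> R by rewrite ltr0n.
have n4 : (4 * n)%N%:R = 4 * n%:R :> R by rewrite natrM.
have Kr := HN3 n.
have nN2 : (N2 <= 4 * n)%N by clear -nN; lia.
have nN1 : (N1 <= 4 * n)%N by clear -nN; lia.
have := HN2 _ nN2; rewrite sub0r normrN => bn.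
have := HN1 _ nN1; rewrite sub0r normrN => an.
have {}bn : b (4 * n)%N <= (q * n%:R) ^+ 2.
  move: bn => /(le_lt_trans (ler_norm _)); rewrite n4 ltr_pdivrMr ?exprn_gt0 ?mulr_gt0//.
  have -> : q ^+ 2 / 16 * (4 * n%:R) ^+ 2 = (q * n%:R) ^+ 2 by field.
  exact: ltW.
have {}an : ((4 * n)%N%:R ^+ d)^-1 * (size [seq y <- ball_seq R A (4 * n)%N |
    c / 4 * n%:R <= enorm (psi y)])%:R <= be.
  apply/ltW/(le_lt_trans (ler_norm _)); move: an; congr (`| _ * _ | < _).
  congr (size _)%:R; apply: eq_filter => y; congr (_ <= _).
  by rewrite n4; field.
apply: max_psi_le.
  by rewrite addr_ge0 ?mulr_ge0 ?max_psi_ge0 ?(ltW c0) ?(ltW del0).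
move=> z zn; apply: (le_trans (psi_ball_le (eps := c / 4) n1 q0 (le_trans kq x03) _ bn _ zn)).
- by apply: Kr; clear -nN; lia.
- by rewrite ltW// divr_gt0.
have W : (size [seq y <- ball_seq R A (4 * n)%N | c / 4 * n%:R <= enorm (psi y)])%:R *
    (kap / (q * n%:R) ^+ d) <= del / 2.
  set sz := (size _)%:R in an *.
  apply: (@le_trans _ _ (be * g)); last first.
    rewrite /be -mulrA ler_piMr ?divr_ge0 ?(ltW del0)//.
    by rewrite mulrC ler_pdivrMr ?ltr_wpDl// mul1r lerDl.
  rewrite (_ : sz * _ = ((4 * n)%N%:R ^+ d)^-1 * sz * g) ?ler_wpM2r//.
  rewrite n4 [(q * _) ^+ d]exprMn [(4 * _) ^+ d]exprMn.
  have -> : g = kap * (4 ^+ d / q ^+ d) by rewrite /g exprMn exprVn.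
  have E (s u v w' : R) : u != 0 -> v != 0 -> w' != 0 ->
    s * (kap / (v * w')) = (u * w')^-1 * s * (kap * (u / v)).
    by move=> u0 v0 w0; field; rewrite ?u0 ?v0 ?w0.
  by apply: E; apply: expf_neq0; rewrite gt_eqF.
have M40 := max_psi_ge0 A psi (4 * n)%N.
have h1 : M (4 * n)%N * ((size [seq y <- ball_seq R A (4 * n)%N |
   c / 4 * n%:R <= enorm (psi y)])%:R * (kap / (q * n%:R) ^+ d)) <= M (4 * n)%N * (del / 2).
  by rewrite ler_wpM2l.
have h2 : (M (4 * n)%N + 3 * n%:R) * (3 * (kap * q)) * e <= (M (4 * n)%N + 3 * n%:R) * (3 * x0 * e).
  rewrite -mulrA ler_wpM2l ?addr_ge0 ?mulr_ge0//.
  by rewrite ler_wpM2r ?(ltW e0)// ler_wpM2l.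
have h3 : M (4 * n)%N * (3 * x0 * e) <= M (4 * n)%N * (del / 2) by rewrite ler_wpM2l.
have h4 : kap * (q * n%:R) <= x0 * n%:R by rewrite mulrA ler_wpM2r// ltW.
have h5 : x0 * (1 + 9 * e) * n%:R <= c / 4 * n%:R by rewrite ler_wpM2r// ltW.
have h6 : 0 <= c * n%:R by rewrite mulr_ge0 ?ltW.
rewrite -/e; lra.
Qed.

(** If [M n > c * n] at one large [n], the recursion with [c / 2] and [1 / (2 * D)] multiplies [M]
    by at least [D = 4 ^+ m.+1] each time the radius is multiplied by 4, and the strict inequality
    persists. This outgrows the power [m]. *)
Lemma max_psi_sublinear (m n2 : nat) :
  (forall n, (n2 <= n)%N -> M n <= n%:R ^+ m) ->
  forall c : R, 0 < c -> exists n0 : nat, forall n, (n0 <= n)%N -> M n <= c * n%:R.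
Proof.
move=> growth c c0; pose D : R := 4 ^+ m.+1.
have D0 : 0 < D by rewrite exprn_gt0.
have D4 : 4 <= D by rewrite /D exprS ler_peMr// exprn_ege1// ler1n.
have [||N0 HN0] := @max_psi_step (c / 2) (1 / (2 * D)).
- by rewrite divr_gt0.
- by rewrite divr_gt0// mulr_gt0.
exists (N0 + n2).+1 => n nN; rewrite leNgt; apply/negP => Mn.
have n0 : 0 < n%:R :> R by rewrite ltr0n (leq_trans _ nN).
have Mn0 : 0 < M n by apply: lt_trans Mn; rewrite mulr_gt0.
have iterM k : (n <= 4 ^ k * n)%N /\ (D ^+ k * M n <= M (4 ^ k * n)%N /\
    c * (4 ^ k * n)%N%:R < M (4 ^ k * n)%N).
  elim: k => [|k [nk [IH1 IH2]]]; first by rewrite expn0 mul1n expr0 mul1r.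
  have e4 : (4 ^ k.+1 * n = 4 * (4 ^ k * n))%N by rewrite expnS mulnA.
  rewrite e4; set N := (4 ^ k * n)%N in nk IH1 IH2 *.
  have NN : (N0 <= N)%N by clear -nk nN; lia.
  have st := HN0 N NN.
  have st' : D * M N <= M (4 * N)%N.
    have : 1 / 2 * M N <= 1 / (2 * D) * M (4 * N)%N.
      by move: st IH2; rewrite -!mulrA; lra.
    rewrite (_ : 1 / (2 * D) * M (4 * N)%N = 1 / 2 * (M (4 * N)%N / D)); last first.
      by field; rewrite gt_eqF.
    by rewrite ler_pM2l// ler_pdivlMr// mulrC.
  split; first by rewrite (leq_trans nk)// leq_pmull.
  split; first by rewrite exprS -mulrA (le_trans _ st')// ler_wpM2l// ltW.
  apply: lt_le_trans st'; rewrite natrM mulrCA.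
  apply: (@lt_le_trans _ _ (4 * M N)); first by rewrite ltr_pM2l.
  by rewrite ler_wpM2r ?max_psi_ge0.
(* Of the factor [D ^+ k], the power [4 ^+ (k * m)] cancels against the growth bound; the remaining
   [4 ^+ k] is unbounded. *)
have bound k : 4 ^+ k * M n <= n%:R ^+ m.
  have [nk [h _]] := iterM k.
  have n2k : (n2 <= 4 ^ k * n)%N by rewrite (leq_trans _ nk)//; clear -nN; lia.
  have := le_trans h (growth _ n2k).
  have DE : D ^+ k = 4 ^+ k * 4 ^+ (k * m) by rewrite /D -exprM -exprD mulSn [(k * m)%N]mulnC.
  rewrite natrM natrX exprMn DE -[(4 ^+ k) ^+ m]exprM.
  by rewrite [4 ^+ k * _]mulrC -mulrA ler_pM2l// exprn_gt0.
pose k := Num.bound (n%:R ^+ m / M n).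
have kb : n%:R ^+ m / M n < k%:R by apply: archi_boundP; rewrite divr_ge0 ?exprn_ge0 ?(ltW Mn0).
have k4 : k%:R <= 4 ^+ k :> R by rewrite -natrX ler_nat ltnW// ltn_expl.
have := lt_le_trans kb k4; rewrite ltr_pdivrMr//.
by rewrite ltNge bound.
Qed.

End Sublinearity.

(** * Suprema, maxima and expectations *)

Lemma ereal_sup_bounded (R : realType) (E : set (\bar R)) : (ereal_sup E < +oo)%E ->
  exists2 c : R, 0 <= c & forall x, E x -> (x <= c%:E)%E.
Proof.
case e : (ereal_sup E) => [r| |] // _; last first.
  by exists 0 => // x /ereal_sup_ubound; rewrite e leeNy_eq => /eqP ->; rewrite leNye.
exists (Num.max r 0); first by rewrite le_max lexx orbT.
move=> x /ereal_sup_ubound; rewrite e => /le_trans; apply.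
by rewrite lee_fin le_max lexx.
Qed.

Lemma max_over_le (R : realType) (S : Type) (A : set S) (f : S -> R) c :
  0 <= c -> (forall x, A x -> f x <= c) -> max_over A f <= c.
Proof.
move=> c0 fc; rewrite /max_over; have [->|A0] := eqVneq A set0.
  by rewrite image_set0 sup0.
apply: ge_sup; last by move=> _ [x Ax <-]; exact: fc.
by move/set0P: A0 => [x Ax]; exists (f x), x.
Qed.

Lemma max_over_ge (R : realType) (S : choiceType) (s : seq S) (f : S -> R) x :
  x \in s -> f x <= max_over [set` s] f.
Proof.
move=> xs; apply: ub_le_sup; last by exists x.
exists (\big[Num.max/f x]_(y <- s) f y) => _ [y /= ys <-].
exact: (le_bigmax_seq (f x) y xpredT f ys isT).
Qed.

(** With a single set this yields Markov's inequality, with singletons a finite part of the mean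
    displacement. *)
Lemma expectation_ge_sum (R : realType) (S : countType) dT (T : measurableType dT)
    (Pr : probability T R) (Y : T -> S) (I : Type) (L : seq I) (c : I -> R)
    (D : I -> set S) (F : S -> R) :
  (forall y, measurable [set s | Y s = y]) -> (forall i, 0 <= c i) ->
  (forall y, \sum_(i <- L) c i * \1_(D i) y <= F y) ->
  (\sum_(i <- L) (c i)%:E * Pr [set s | D i (Y s)] <= 'E_Pr[fun s => F (Y s)])%E.
Proof.
move=> mY c0 cF.
have mF (G : S -> R) : measurable_fun setT (fun s => G (Y s) : measurableTypeR R).
  by move=> _ B mB; rewrite setTI; exact: (measurable_preimage_discrete (fun y => B (G y)) mY).
have mD i : measurable [set s | D i (Y s)] by exact: measurable_preimage_discrete.
have ind0 i y : 0 <= c i * \1_(D i) y by rewrite mulr_ge0// indicE.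
rewrite expectation.unlock.
apply: (@le_trans _ _ (\int[Pr]_s (\sum_(i <- L) c i * \1_(D i) (Y s))%:E)%E); last first.
  apply: ge0_le_integral => //.
  - by move=> s _; rewrite lee_fin sumr_ge0.
  - by apply/measurable_realfun.measurable_EFinP; 
    exact: (mF (fun y => \sum_(i <- L) c i * \1_(D i) y)).
  - by apply/measurable_realfun.measurable_EFinP; exact: mF.
  - by move=> s _; rewrite lee_fin.
rewrite (_ : (fun s => _) = fun s => (\sum_(i <- L) (c i * \1_(D i) (Y s))%:E)%E); last first.
  by apply/funext => s; rewrite sumEFin.
rewrite ge0_integral_sum//.
- rewrite le_eqVlt; apply/orP; left; apply/eqP; apply: eq_bigr => i _.
  rewrite (_ : (fun s => _) = fun s => ((c i)%:E * (\1_[set s | D i (Y s)] s)%:E)%E).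
    by rewrite ge0_integralZl_EFin// ?integral_indic ?setIT//;
      apply/measurable_realfun.measurable_EFinP; exact: measurable_realfun.measurable_indic.
  by apply/funext => s; rewrite -EFinM !indicE; congr (_ * _%:R)%:E; apply/idP/idP; rewrite !inE.
- by move=> i; apply/measurable_realfun.measurable_EFinP; exact: (mF (fun y => c i * \1_(D i) y)).
- by move=> i s _; rewrite lee_fin.
Qed.

(** * The deterministic statement for one environment *)

Section Pathwise.
Variables (R : realType) (d : nat) (A : set (site d)) (psi : site d -> 'rV[R]_d).
Variables (hat : site d -> site d -> R).
Context dY (TY : measurableType dY) (PY : site d -> probability TY R) (Y : R -> TY -> site d).
Hypotheses (hat_ge0 : forall x y, 0 <= hat x y)
  (hat_out : forall x y, ~ A y -> hat x y = 0)
  (hat_sym : forall x y, A x -> A y -> hat x y = hat y x).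
Local Notation pnorm x := (enorm (embed R x)).
Hypothesis hat_range : exists n1, forall n, (n1 <= n)%N -> forall x y, A x ->
  pnorm x <= (3 * n)%:R -> hat x y != 0 -> pnorm (y - x) <= n%:R.
Hypothesis hY : forall x, A x -> ctime_chain (PY x) Y hat x.

(** The identity off [A] keeps the kernel symmetric, as [hat] puts no mass outside [A], and makes
    averages of total mass one available at every site. *)
Definition full_kernel x y : R := if `[< A x >] then hat x y else (x == y)%:R.

Lemma full_kernel_in x y : A x -> full_kernel x y = hat x y.
Proof. by rewrite /full_kernel; case: asboolP. Qed.

Lemma full_kernel_ge0 x y : 0 <= full_kernel x y.
Proof. by rewrite /full_kernel; case: ifP. Qed.

Lemma full_kernel_sym x y : full_kernel x y = full_kernel y x.
Proof.
rewrite /full_kernel; case: asboolP => Ax; case: asboolP => Ay.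
- exact: hat_sym.
- by rewrite hat_out//; case: eqP => // yx; rewrite yx in Ay.
- by rewrite hat_out//; case: eqP => // yx; rewrite yx in Ax.
- by rewrite eq_sym.
Qed.

Lemma full_kernel_supp : exists supp : site d -> seq (site d),
  (forall x, uniq (supp x)) /\ forall x y, y \notin supp x -> full_kernel x y = 0.
Proof.
have [n1 Hn] := hat_range.
(* The radius is at least [n1], and large enough for three times it to exceed the norm of [x], as
   [hat_range] asks. *)
exists (fun x => if `[< A x >] then undup (box x (n1 + d * linf_dist 0%R x)) else [:: x]).
split => x; first by case: ifP; rewrite ?undup_uniq.
move=> y; rewrite /full_kernel; case: asboolP => Ax; last by rewrite inE eq_sym => /negbTE ->.
rewrite mem_undup; apply: contraNeq => hxy; apply: mem_box; apply: (@linf_le_enorm _ R).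
apply: Hn => //; first exact: leq_addr.
have := enorm_le_linf R (0%R : site d) x; rewrite subr0 => /le_trans; apply.
by rewrite -natrM ler_nat; lia.
Qed.

(** A trajectory of nonzero weight from a site of [A] stays in [A], where both kernels agree; the
    induction carries this fact along. *)
Lemma full_kernel_ctime x : A x -> ctime_chain (PY x) Y full_kernel x.
Proof.
move=> Ax; have [mY [Z [tau [mZ mtau law Yae]]]] := hY Ax; split => //.
exists Z, tau; split => // n z B mB; rewrite law//; congr (_%:E * _)%E.
have [] : trajectory_weight hat x z n = trajectory_weight full_kernel x z n /\
    (trajectory_weight hat x z n != 0 -> A (z n)); last by [].
elim: n => [|n [IH IHA]].
  rewrite /trajectory_weight !big_ord0; split => //.
  by case: (eqVneq (z 0%N) x) => [->//|_]; rewrite mul0r eqxx.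
have tS K : trajectory_weight K x z n.+1 = trajectory_weight K x z n * K (z n) (z n.+1).
  by rewrite /trajectory_weight big_ord_recr mulrA.
rewrite !tS -IH; have [->|w0] := eqVneq (trajectory_weight hat x z n) 0.
  by rewrite !mul0r eqxx.
have Az := IHA w0; rewrite full_kernel_in//; split => //.
apply: contra_neqP => nA; by rewrite hat_out ?mulr0.
Qed.

Lemma pathwise_sublinear (theta : R) (b : nat -> R) :
  0 < theta ->
  (forall x, A x -> forall i, generator hat A (fun y => (embed R y + psi y) 0 i) x = 0%E) ->
  (forall eps : R, 0 < eps ->
     (fun n : nat => (n%:R ^+ d)^-1 * \sum_(x \in in_ball R A n)
           (\1_[set y | eps * n%:R <= enorm (psi y)] x : R)) @ \oo --> (0 : R)) ->
  ((fun n : nat => max_over (in_ball R A n)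
      (fun x => enorm (psi x) / (n%:R `^ theta))) @ \oo --> (0 : R)) ->
  (forall n, (1 <= n)%N -> 0 < b n) ->
  ((fun n : nat => b n / n%:R ^+ 2) @ \oo --> (0 : R)) ->
  (ereal_sup [set ereal_sup [set ereal_sup
        [set 'E_(PY x)[fun s => enorm (embed R (Y t s - x)%R)] * ((Num.sqrt t)^-1)%:E
        | t in [set t : R | (b n <= t)%R]]
        | x in in_ball R A n] | n in [set n : nat | (1 <= n)%N]] < +oo)%E ->
  (ereal_sup [set ereal_sup [set ereal_sup
        [set (t `^ (d%:R / 2))%R%:E * PY x [set s | Y t s = x]
        | t in [set t : R | (b n <= t)%R]]
        | x in in_ball R A n] | n in [set n : nat | (1 <= n)%N]] < +oo)%E ->
  (fun n : nat => max_over (in_ball R A n) (fun x => enorm (psi x) / n%:R)) @ \oo --> (0 : R).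
Proof.
move=> theta0 harm average growth b0 b_small /ereal_sup_bounded[c1 c10 disp]
  /ereal_sup_bounded[c2 c20 ret].
have [supp [supp_uniq K_supp]] := full_kernel_supp.
have K_ge0 := full_kernel_ge0.
have K_sum1 x : \sum_(y <- supp x) full_kernel x y = 1.
  have [Ax|nAx] := pselect (A x).
    exact: (ctime_chain_sum1 supp_uniq (K_supp x) (full_kernel_ctime Ax)).
  have KE y : full_kernel x y = (x == y)%:R by rewrite /full_kernel; case: asboolP.
  have xs : x \in supp x.
    by apply: contraT => /K_supp; rewrite KE eqxx => /eqP; rewrite oner_eq0.
  rewrite (bigD1_seq x)//= KE eqxx big1 ?addr0// => y yx.
  by rewrite KE eq_sym (negbTE yx).
have law x t (D : set (site d)) : A x -> 0 < t ->
    heat full_kernel supp t \1_D x <= fine (PY x [set s | D (Y t s)]).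
  by move=> Ax t0; apply: ctime_chain_heat_le => //; exact: full_kernel_ctime.
have mY x t y : A x -> 0 < t -> measurable [set s | Y t s = y].
  by move=> Ax t0; have [+ _] := hY Ax; apply; exact: ltW.
have finP x t (D : set (site d)) : A x -> 0 < t -> PY x [set s | D (Y t s)] \is a fin_num.
  move=> Ax t0; apply: fin_num_measure.
  by apply: measurable_preimage_discrete => y; exact: (mY x).
have tpos n t : (1 <= n)%N -> b n <= t -> 0 < t.
  by move=> n1; apply: lt_le_trans; exact: b0.
have dispE n x t : (1 <= n)%N -> in_ball R A n x -> b n <= t ->
    ('E_(PY x)[fun s => enorm (embed R (Y t s - x)%R)] <= (c1 * Num.sqrt t)%:E)%E.
  move=> n1 xn bt; have t0 := tpos _ _ n1 bt.
  have st0 : 0 < Num.sqrt t by rewrite sqrtr_gt0.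
  have : ('E_(PY x)[fun s => enorm (embed R (Y t s - x)%R)] * ((Num.sqrt t)^-1)%:E <= c1%:E)%E.
    apply: le_trans (disp _ _); last by exists n.
    apply: le_trans (ereal_sup_ubound _); last by exists x.
    by apply: ereal_sup_ubound; exists t.
  by rewrite EFinM -lee_pdivrMr.
pose kap := Num.max c1 c2.
have kap0 : 0 <= kap by rewrite le_max c10.
have c1k : c1 <= kap by rewrite le_max lexx.
have c2k : c2 <= kap by rewrite le_max lexx orbT.
have K_range : exists n1, forall n, (n1 <= n)%N -> forall x y, A x ->
    pnorm x <= (3 * n)%:R -> full_kernel x y != 0 -> A y /\ pnorm (y - x) <= n%:R.
  have [n1 Hn] := hat_range; exists n1 => n nn x y Ax xn; rewrite full_kernel_in// => hxy.
  split; last exact: Hn.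
  by apply: contrapT => nA; rewrite hat_out ?eqxx in hxy.
have harmonic x : A x -> forall i, avg full_kernel supp
    (fun y => (embed R y + psi y) 0 i) x = (embed R x + psi x) 0 i.
  move=> Ax i; have := generator_eq0 (supp_uniq x) _ _ (harm x Ax i).
  have hs y : y \notin supp x -> hat x y = 0 by move=> /K_supp; rewrite full_kernel_in.
  move=> /(_ hs (fun y => @hat_out x y)) H; apply/eqP; rewrite -subr_eq0; apply/eqP.
  rewrite -[RHS]H /avg -[X in _ - X]mul1r -(K_sum1 x) mulr_suml -sumrB.
  by apply: eq_bigr => y _; rewrite full_kernel_in// mulrBr.
have average' eps : 0 < eps -> (fun n : nat => (n%:R ^+ d)^-1 *
     (size [seq y <- ball_seq R A n | eps * n%:R <= enorm (psi y)])%:R)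
  @ \oo --> (0 : R).
  move=> e0; have := average eps e0; set u := fun n => _; set v := fun n => _.
  suff -> : u = v by [].
  apply/funext => n; rewrite /u /v.
  congr (_ * _); rewrite in_ballE -fsbig_seq ?ball_seq_uniq//.
  rewrite -sum1_size big_filter natr_sum [RHS]big_mkcond; apply: eq_bigr => y _.
  rewrite indicE; case: ifPn => h; first by rewrite mem_set.
  by rewrite memNset//; exact/negP.
have far_le n x (s r : R) : (1 <= n)%N -> in_ball R A n x -> b n <= s -> 0 < r ->
    heat full_kernel supp s (fun y => (r <= pnorm (y - x))%R%:R) x <= kap / r * Num.sqrt s.
  move=> n1 xn bs r0; have s0 := tpos _ _ n1 bs; have Ax := xn.1.
  pose D := [set y : site d | r <= pnorm (y - x)].
  have -> : (fun y => (r <= pnorm (y - x))%R%:R) = \1_D :> (site d -> R).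
    apply/funext => y; rewrite indicE; case: (boolP (r <= _)) => h.
      by rewrite mem_set.
    by rewrite memNset//; exact/negP.
  apply: (le_trans (law x s D Ax s0)).
  have := @expectation_ge_sum R (site d) dY TY (PY x) (Y s) unit [:: tt] (fun=> r)
    (fun=> D) (fun y => pnorm (y - x)) (fun y => mY x s y Ax s0) (fun=> ltW r0).
  rewrite big_seq1 -(fineK (finP x s D Ax s0)) => H.
  have H' := le_trans (H _) (dispE n x s n1 xn bs).
  have : r * fine (PY x [set w | D (Y s w)]) <= c1 * Num.sqrt s.
    rewrite -lee_fin EFinM; apply: H' => y; rewrite big_seq1 indicE.
    have [yD|yD] := boolP (y \in D); last by rewrite mulr0 enorm_ge0.
    by rewrite mulr1; move: yD; rewrite inE.
  move=> h; rewrite mulrAC ler_pdivlMr// mulrC (le_trans h)//.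
  by rewrite ler_wpM2r ?sqrtr_ge0.
have deltaE y : delta R y = \1_[set y] :> (site d -> R).
  by apply/funext => z; rewrite indicE in_set1.
have displacement_le n x s (L : seq (site d)) : (1 <= n)%N -> in_ball R A n x -> b n <= s ->
    uniq L -> \sum_(v <- L) pnorm (v - x) * heat full_kernel supp s (delta R v) x <=
      kap * Num.sqrt s.
  move=> n1 xn bs uL; have s0 := tpos _ _ n1 bs; have Ax := xn.1.
  apply: (@le_trans _ _ (\sum_(v <- L) pnorm (v - x) * fine (PY x [set w | Y s w = v]))).
    by apply: ler_sum => v _; rewrite ler_wpM2l ?enorm_ge0// deltaE law.
  apply: (@le_trans _ _ (c1 * Num.sqrt s)); last by rewrite ler_wpM2r ?sqrtr_ge0.
  rewrite -lee_fin; apply: le_trans (dispE n x s n1 xn bs).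
  have := @expectation_ge_sum R (site d) dY TY (PY x) (Y s) _ L (fun v => pnorm (v - x))
    (fun v => [set v]) (fun y => pnorm (y - x)) (fun y => mY x s y Ax s0) (fun=> enorm_ge0 _).
  rewrite -sumEFin (eq_bigr (fun v => (pnorm (v - x) * fine (PY x [set w | Y s w = v]))%:E)).
    apply => y; have [yL|yL] := boolP (y \in L).
      rewrite (bigD1_seq y)//= indicE mem_set// mulr1 big1 ?addr0// => v vy.
      by rewrite indicE memNset ?mulr0//= => yv; rewrite yv eqxx in vy.
    rewrite big1_seq ?enorm_ge0// => v /andP[_ vL].
    by rewrite indicE memNset ?mulr0//= => yv; rewrite yv vL in yL.
  by move=> v _; rewrite EFinM fineK//; exact: (finP x s [set v]).
have return_le n x s : (1 <= n)%N -> in_ball R A n x -> b n <= s ->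
    s `^ (d%:R / 2) * heat full_kernel supp s (delta R x) x <= kap.
  move=> n1 xn bs; have s0 := tpos _ _ n1 bs; have Ax := xn.1.
  apply: (@le_trans _ _ (s `^ (d%:R / 2) * fine (PY x [set w | Y s w = x]))).
    by rewrite ler_wpM2l ?powR_ge0// deltaE law.
  apply: le_trans c2k; rewrite -lee_fin EFinM fineK; last exact: (finP x s [set x]).
  apply: le_trans (ret _ _); last by exists n.
  apply: le_trans (ereal_sup_ubound _); last by exists x.
  by apply: ereal_sup_ubound; exists s.
(* An integer exponent is wanted for the comparison of powers of 4. Replacing [theta] by it needs
   [1 <= n], whence [N.+1]. *)
have growth' : exists m n2, forall n, (n2 <= n)%N -> max_psi A psi n <= n%:R ^+ m.
  exists (Num.bound theta).
  have /cvgrPdist_lt/(_ 1 ltr01)[N _ HN] := growth; exists N.+1 => n nN.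
  have n1 : 1 <= n%:R :> R by rewrite ler1n (leq_trans _ nN).
  have n0 : 0 < n%:R :> R by exact: lt_le_trans n1.
  apply: max_psi_le; first by rewrite exprn_ge0// ltW.
  move=> x xn; have := HN n (ltnW nN); rewrite sub0r normrN => /(le_lt_trans (ler_norm _)) h.
  have xs : x \in ball_seq R A n by rewrite mem_ball_seq; apply/asboolP.
  move: h; rewrite in_ballE => /(le_lt_trans (max_over_ge (fun x => _) xs)).
  rewrite ltr_pdivrMr ?powR_gt0// mul1r => /ltW /le_trans; apply.
  rewrite -powR_mulrn ?(ltW n0)//; apply: ler_powR => //.
  by apply/ltW/archi_boundP/ltW.
have [m [n2 gr]] := growth'.
have fin := max_psi_sublinear supp_uniq K_supp K_ge0 K_sum1 full_kernel_sym K_range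
  harmonic average' b0 b_small kap0 far_le displacement_le return_le gr.
apply/cvgrPdist_le => e e0; have [n0 Hn] := fin e e0.
exists n0.+1 => // n /= nn; have n_gt0 : 0 < n%:R :> R by rewrite ltr0n (leq_trans _ nn).
rewrite sub0r normrN ler_norml; apply/andP; split; last first.
  apply: max_over_le => [|x xn]; first exact: ltW.
  by rewrite ler_pdivrMr// (le_trans (le_max_psi psi xn))// Hn// ltnW.
apply: (@le_trans _ _ 0); first by rewrite oppr_le0 ltW.
have [->|/set0P[x xn]] := eqVneq (in_ball R A n) set0; first by rewrite /max_over image_set0 sup0.
have xs : x \in ball_seq R A n by rewrite mem_ball_seq; apply/asboolP.
rewrite in_ballE; apply: le_trans (max_over_ge (fun x => _) xs).
by rewrite divr_ge0 ?enorm_ge0// ltW.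
Qed.

End Pathwise.

Theorem theorem2p4 (R : realType) (d : nat) (hd : (2 <= d)%N)
  (P : probability (env R d) R) (hP : iid_conductances P)
  (p : R) (hp : forall b, P [set w | 0 < omega w b] = p%:E)
  (hpc : p_c R d < p)
  (c : R) (hc : admissible_constant d p c)
  (alpha : R) (halpha : 0 < alpha)
  (halpha_pc : forall b, ((p_c R d)%:E < P [set w | (alpha <= omega w b)%R])%E)
  (halpha_c : forall b, (P [set w | (0 < omega w b < alpha)%R] < c%:E)%E)
  (* the discrete-time walk X under P_{omega,z} *)
  (dX : measure_display) (TX : measurableType dX)
  (PX : env R d -> site d -> probability TX R) (X : nat -> TX -> site d)
  (hX : forall w z, C_infty w z -> markov_chain (PX w z) X (rw_kernel w) z)
  (hat_omega : env R d -> site d -> site d -> R)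
  (hhat : forall w, hat_omega w = return_kernel (PX w) X (C_alpha alpha w))
  (psi : env R d -> site d -> 'rV[R]_d) (theta : R) (htheta : 0 < theta)
  (harmonicity : {ae P, forall w, forall x, C_alpha alpha w x ->
     forall i : 'I_d,
       generator (hat_omega w) (C_alpha alpha w)
         (fun y => (embed R y + psi w y) 0 i) x = 0%E})
  (sublinearity_on_average : {ae P, forall w, forall eps : R, 0 < eps ->
     (fun n : nat => (n%:R ^+ d)^-1 *
        \sum_(x \in in_ball R (C_alpha alpha w) n)
           (\1_[set y | eps * n%:R <= enorm (psi w y)] x : R))
       @ \oo --> (0 : R)})
  (polynomial_growth : {ae P, forall w,
     (fun n : nat => max_over (in_ball R (C_alpha alpha w) n)
        (fun x => enorm (psi w x) / (n%:R `^ theta)))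
       @ \oo --> (0 : R)})
  (* the continuous-time walk Y under P_{omega,x} *)
  (dY : measure_display) (TY : measurableType dY)
  (PY : env R d -> site d -> probability TY R) (Y : R -> TY -> site d)
  (hY : {ae P, forall w, forall x, C_alpha alpha w x ->
     ctime_chain (PY w x) Y (hat_omega w) x})
  (b : nat -> R) (hb : forall n, (1 <= n)%N -> 0 < b n)
  (hb_small : (fun n : nat => b n / n%:R ^+ 2) @ \oo --> (0 : R))
  (diffusive_displacement : {ae P, forall w,
     (ereal_sup [set ereal_sup [set ereal_sup
        [set 'E_(PY w x)[fun s => enorm (embed R (Y t s - x)%R)]
               * ((Num.sqrt t)^-1)%:E
        | t in [set t : R | (b n <= t)%R]]
        | x in in_ball R (C_alpha alpha w) n]
        | n in [set n : nat | (1 <= n)%N]] < +oo)%E})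
  (diffusive_return : {ae P, forall w,
     (ereal_sup [set ereal_sup [set ereal_sup
        [set (t `^ (d%:R / 2))%R%:E * PY w x [set s | Y t s = x]
        | t in [set t : R | (b n <= t)%R]]
        | x in in_ball R (C_alpha alpha w) n]
        | n in [set n : nat | (1 <= n)%N]] < +oo)%E}) :
  {ae P, forall w,
     (fun n : nat => max_over (in_ball R (C_alpha alpha w) n)
        (fun x => enorm (psi w x) / n%:R))
       @ \oo --> (0 : R)}.

Proof.
have d0 : (0 < d)%N by exact: leq_trans hd.
have [_ adm] := hc.
have [_ [C [eta [eta0 PC]]]] := adm P alpha hP hp halpha halpha_pc halpha_c.
(* With [n' = n %/ (2 * d)] as below, [n < 4 * d * n'] gives [3 * n + 1 <= 12 * d * n'], so this box
   holds all neighbours of the ball of radius [3 * n]. *)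
have holes := @holes_small R d alpha halpha P C eta (12 * d)%N eta0 d0 PC.
have ae_mono (Q1 Q2 : set (env R d)) :
    Q1 `<=` Q2 -> {ae P, forall w, Q1 w} -> {ae P, forall w, Q2 w}.
  move=> QQ; apply: filterS; exact: QQ.
have ae_and (Q1 Q2 : set (env R d)) :
    {ae P, forall w, Q1 w} -> {ae P, forall w, Q2 w} -> {ae P, forall w, Q1 w /\ Q2 w}.
  by move=> h1 h2; apply: filterI.
have Hae := ae_and _ _ holes (ae_and _ _ harmonicity (ae_and _ _ sublinearity_on_average
  (ae_and _ _ polynomial_growth (ae_and _ _ hY
  (ae_and _ _ diffusive_displacement diffusive_return))))).
refine (ae_mono _ _ _ Hae) => w [[n0 hol] [harm [subl [gro [hYw [dis ret]]]]]].
have hatE := hhat w.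
have AD := C_alpha_infty halpha (w := w).
have chain x (Cx : C_infty w x) := hX w x Cx.
have Ksym := rw_kernel_sym w.
apply: (pathwise_sublinear _ _ _ _ hYw htheta harm subl gro hb hb_small dis ret).
- by move=> x y; rewrite hatE; exact: return_kernel_ge0.
- by move=> x y nAy; rewrite hatE; exact: return_kernel_notin.
- by move=> x y Ax Ay; rewrite hatE; exact: (return_kernel_sym AD chain Ksym Ax Ay).
(* A jump spans at most [n' + 1] in sup distance, hence at most [d * (n' + 1) <= 2 * d * n' <= n] in
   Euclidean norm; the summand 2 ensures [n' + 1 <= 2 * n']. *)
exists (2 * d * (n0 + 2))%N => n nn x y Ax xn; rewrite hatE => hxy.
have Ay : C_alpha alpha w y.
  by apply: contrapT => nAy; rewrite return_kernel_notin ?eqxx in hxy.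
have [pw [pA wp]] := return_kernel_word AD chain Ax hxy.
pose n' := (n %/ (2 * d))%N.
have n'1 : (n' * (2 * d) <= n)%N by exact: leq_trunc_div.
have n'2 : (n < n'.+1 * (2 * d))%N by rewrite ltn_ceil// muln_gt0.
have n'3 : (n0 + 2 <= n')%N by rewrite leq_divRL ?muln_gt0// mulnC.
have x3 : (linf_dist 0%R x <= 3 * n)%N.
  by apply: (@linf_le_enorm _ R); rewrite subr0.
have xy : (linf_dist x y <= n'.+1)%N.
  apply: (word_weight_range halpha Ax Ay pA wp) => z xz Cz u v hu hv.
  apply: (hol n' _ z _ Cz) => //; first by lia.
  apply: leq_trans (linf_dist_triangle x 0%R z) _.
  have n'4 : (n'.+1 * (2 * d) <= 2 * n' * (2 * d))%N by rewrite leq_mul2r; apply/orP; right; lia.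
  nia.
apply: le_trans (enorm_le_linf R x y) _; rewrite -natrM ler_nat.
apply: (@leq_trans (d * n'.+1)%N); first by rewrite leq_mul2l xy orbT.
nia.
Qed.
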